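(* Assume the standing setup below and $\beta_n n^{-\alpha}\to\gamma\in(0,\infty)$. Let $\mathcal M_\gamma$ be a Poisson point process on $[0,\infty)\times\mathbb S_q^{d-2}$ with intensity measure $\frac{C(q)}{\alpha\gamma^{1/\alpha}}\,y^{1/\alpha-1}\,dy\,\nu_q(d\theta)$. Then $\sqrt{\beta_n}\,\mathcal Y_n(q)\to V\Xi$ in distribution, where $$\Xi=\frac{\int_0^\infty\int_{\mathbb S_q^{d-2}}e^{-y}\sqrt{2y}\,\theta\,\mathcal M_\gamma(dy,d\theta)}{\int_0^\infty\int_{\mathbb S_q^{d-2}}e^{-y}\,\mathcal M_\gamma(dy,d\theta)}$$ (the denominator is a.s. finite and strictly positive). In particular $\mathcal Y_n(q)\to0$ and $\mathrm{ATT}(n)\to Vq$ in probability.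
   Context: Standing setup: Fix an integer $d\ge 2$; let $\mathbb S^{d-1}\subset\mathbb R^d$ be the unit sphere with surface measure $\sigma$. Fix $q\in\mathbb S^{d-1}$. Let $x_1,x_2,\dots$ be i.i.d. random vectors on $\mathbb S^{d-1}$ with law $\rho(x)\,d\sigma(x)$, where $\rho$ is a $C^2$ probability density on $\mathbb S^{d-1}$ with $\rho(q)>0$. Let $(\beta_n)_{n\ge1}$ be positive reals and set $\alpha=2/(d-1)$. Define $T_i=1-\langle q,x_i\rangle$, $Z_n=\sum_{j=1}^n e^{-\beta_nT_j}$, $A_i=e^{-\beta_nT_i}/Z_n$. Let $V\in\mathbb R^{d\times d}$ be fixed, $\mathrm{ATT}(n)=V\sum_{j=1}^nA_jx_j$ and $\mathcal Y_n(q)=\mathrm{ATT}(n)-Vq=V\sum_{i=1}^nA_i(x_i-q)$. Let $C(q)=\frac{2^{1/\alpha}\sigma_{d-2}}{d-1}\rho(q)$ with $\sigma_{d-2}$ the surface area of $\mathbb S^{d-2}$. Let $\mathbb S_q^{d-2}=\{\theta\in\mathbb R^d:\langle\theta,q\rangle=0,\ \|\theta\|=1\}$ and let $\nu_q$ be the uniform probability measure on $\mathbb S_q^{d-2}$. *)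

(* Defs.v *)
(* Vectors of R^d are d.-tuple R,
   which carries the product (= Borel) sigma-algebra of the library. *)
From HB Require Import structures.
From mathcomp Require Import all_boot all_order all_algebra.
From mathcomp Require Import all_classical all_reals all_analysis.
From mathcomp Require Import measurable_realfun.
Set Implicit Arguments. Unset Strict Implicit. Unset Printing Implicit Defensive.
Import Order.TTheory GRing.Theory Num.Theory.
Import numFieldNormedType.Exports.
Local Open Scope classical_set_scope.
Local Open Scope ring_scope.

Section Defs.
Context {R : realType}.

Definition dotv n (u v : n.-tuple R) : R := \sum_(i < n) tnth u i * tnth v i.
Definition enorm n (u : n.-tuple R) : R := Num.sqrt (dotv u u).
Definition tscale n (c : R) (u : n.-tuple R) : n.-tuple R :=
  [tuple c * tnth u i | i < n].
Definition tsub n (u v : n.-tuple R) : n.-tuple R :=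
  [tuple tnth u i - tnth v i | i < n].
Definition tzero n : n.-tuple R := [tuple 0 | i < n].
Definition mxv n (V : 'M[R]_n) (u : n.-tuple R) : n.-tuple R :=
  [tuple \sum_(j < n) V i j * tnth u j | i < n].
Definition sphere n : set (n.-tuple R) := [set u | dotv u u = 1].
Definition unit_ball n : set (n.-tuple R) := [set u | dotv u u <= 1].
Definition tsphere n (q : n.-tuple R) : set (n.-tuple R) :=
  [set u | dotv u q = 0 /\ dotv u u = 1].
Definition normalize n (u : n.-tuple R) := tscale (enorm u)^-1 u.

(* Lebesgue integral on R^n of a nonnegative function, as the iterated
   (Tonelli) integral of one-dimensional Lebesgue integrals *)
Fixpoint iint n : (n.-tuple R -> \bar R) -> \bar R :=
  match n with
  | 0 => fun f => f [tuple]
  | m.+1 => fun f =>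
      (\int[@lebesgue_measure R]_t iint (fun v : m.-tuple R => f (cons_tuple t v)))%E
  end.
Definition lebn n (E : set (n.-tuple R)) : \bar R := iint (fun u => (\1_E u)%:E).

(* surface area of S^{m-1} (Folland's definition sigma(S) = m * |B^m|) *)
Definition sphere_area m : R := fine (m%:R%:E * lebn (@unit_ball m))%E.

(* cone over a subset of the sphere: {t x : 0 < t <= 1, x in A};
   Folland's surface measure is sigma(A) = n * lebn (cone A) *)
Definition cone n (A : set (n.-tuple R)) : set (n.-tuple R) :=
  [set u | exists t, exists2 y, (0 < t <= 1) /\ A y & u = tscale t y].

(* integral over the sphere of rho against surface measure, restricted to A:
   int_A rho dsigma  (polar-coordinate / cone form of sigma) *)
Definition sphere_int n (rho : n.-tuple R -> R) (A : set (n.-tuple R)) : \bar R :=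
  (n%:R%:E * iint (fun u => (\1_(cone A) u * rho (normalize u))%:E))%E.

Definition has_sphere_law n d0 (Om : measurableType d0) (P : probability Om R)
  (rho : n.-tuple R -> R) (X : Om -> n.-tuple R) : Prop :=
  forall A, measurable A -> A `<=` @sphere n -> P (X @^-1` A) = sphere_int rho A.

Definition tup_of_row n (v : 'rV[R]_n) : n.-tuple R := [tuple v ord0 i | i < n].

Definition C2_on_sphere n (rho : n.-tuple R -> R) : Prop :=
  exists U : set 'rV[R]_n, open U /\ (forall v, @sphere n (tup_of_row v) -> U v) /\
  exists g : 'rV[R]_n -> R,
    (forall v, @sphere n (tup_of_row v) -> g v = rho (tup_of_row v)) /\
    forall v, U v -> forall a b : 'rV[R]_n,
      [/\ derivable g v a, derivable ('D_a g) v b &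
          {for v, continuous ('D_b ('D_a g))}].

Definition mutually_indep n d0 (Om : measurableType d0) (P : probability Om R)
  (X : nat -> Om -> n.-tuple R) : Prop :=
  forall (k : nat) (A : nat -> set (n.-tuple R)), (forall i, measurable (A i)) ->
    P (\bigcap_(i in `I_k) (X i @^-1` A i)) = (\prod_(i < k) P (X i @^-1` A i))%E.

Definition uniform_tsphere n (q : n.-tuple R) (nu : probability (n.-tuple R) R) : Prop :=
  nu (tsphere q) = 1%E /\
  forall Q : n.-tuple R -> n.-tuple R,
    (forall u v, dotv (Q u) (Q v) = dotv u v) -> Q q = q ->
    forall A, measurable A -> nu (Q @^-1` A) = nu A.

Definition intensity n (nu : probability (n.-tuple R) R) (h : R -> R)
  (B : set (R * n.-tuple R)) : \bar R :=
  (\int[@lebesgue_measure R]_(y in [set y : R | (0 <= y)%R])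
     \int[nu]_th ((\1_B (y, th)) * h y)%:E)%E.

Definition is_PPP n d0 (Om : measurableType d0) (P : probability Om R)
  (M : Om -> {measure set (R * n.-tuple R) -> \bar R})
  (mu : set (R * n.-tuple R) -> \bar R) : Prop :=
  [/\ (forall B, measurable B -> measurable_fun [set: Om] (fun w => M w B : \bar R)),
      (forall w B, measurable B -> M w B = +oo%E \/ exists k : nat, M w B = k%:R%:E),
      (forall B, measurable B -> (mu B < +oo)%E -> forall k : nat,
          P [set w | M w B = k%:R%:E] =
          (expR (- fine (mu B)) * fine (mu B) ^+ k / k`!%:R)%:E),
      (forall B, measurable B -> mu B = +oo%E -> P [set w | M w B = +oo%E] = 1%E) &
      (forall (k : nat) (B : nat -> set (R * n.-tuple R)) (c : nat -> \bar R),
          (forall i, measurable (B i)) ->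
          (forall i j, (i < k)%N -> (j < k)%N -> i <> j -> B i `&` B j = set0) ->
          P (\bigcap_(i in `I_k) [set w | M w (B i) = c i]) =
          (\prod_(i < k) P [set w | M w (B i) = c i])%E)].

Definition ppp_dom n (q : n.-tuple R) : set (R * n.-tuple R) :=
  [set z | 0 <= z.1 /\ tsphere q z.2].
Definition Xi_den n (q : n.-tuple R) (m : {measure set (R * n.-tuple R) -> \bar R}) :=
  (\int[m]_(z in ppp_dom q) (expR (- z.1))%:E)%E.
Definition Xi_num n (q : n.-tuple R) (m : {measure set (R * n.-tuple R) -> \bar R})
  (i : 'I_n) :=
  (\int[m]_(z in ppp_dom q) (expR (- z.1) * Num.sqrt (2 * z.1) * tnth z.2 i)%:E)%E.
Definition Xi n (q : n.-tuple R) (m : {measure set (R * n.-tuple R) -> \bar R}) :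
  n.-tuple R := [tuple fine (Xi_num q m i) / fine (Xi_den q m) | i < n].

(* attention quantities; samples x_1,...,x_n are xs 0, ..., xs (n-1) *)
Definition Tq n (q u : n.-tuple R) : R := 1 - dotv q u.
Definition Zn n (beta : nat -> R) (q : n.-tuple R) (xs : nat -> n.-tuple R) (k : nat) : R :=
  \sum_(j < k) expR (- beta k * Tq q (xs j)).
Definition Aw n (beta : nat -> R) (q : n.-tuple R) (xs : nat -> n.-tuple R) (k i : nat) : R :=
  expR (- beta k * Tq q (xs i)) / Zn beta q xs k.
Definition ATT n (V : 'M[R]_n) (beta : nat -> R) (q : n.-tuple R)
  (xs : nat -> n.-tuple R) (k : nat) : n.-tuple R :=
  mxv V [tuple \sum_(j < k) Aw beta q xs k j * tnth (xs j) i | i < n].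
Definition Ycal n (V : 'M[R]_n) (beta : nat -> R) (q : n.-tuple R)
  (xs : nat -> n.-tuple R) (k : nat) : n.-tuple R :=
  mxv V [tuple \sum_(j < k) Aw beta q xs k j * (tnth (xs j) i - tnth q i) | i < n].

Definition tcont n (f : n.-tuple R -> R) : Prop :=
  forall u e, 0 < e -> exists2 del, 0 < del &
    forall v, (forall i, `|tnth v i - tnth u i| < del) -> `|f v - f u| < e.

Definition conv_dist n d1 d2 (O1 : measurableType d1) (O2 : measurableType d2)
  (P1 : probability O1 R) (X : nat -> O1 -> n.-tuple R)
  (P2 : probability O2 R) (Y : O2 -> n.-tuple R) : Prop :=
  forall f : n.-tuple R -> R, tcont f -> (exists K, forall u, `|f u| <= K) ->
    ((fun k => \int[P1]_w (f (X k w))%:E) @ \oo --> \int[P2]_w (f (Y w))%:E)%E.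

Definition conv_prob n d1 (O1 : measurableType d1) (P1 : probability O1 R)
  (X : nat -> O1 -> n.-tuple R) (c : n.-tuple R) : Prop :=
  forall e, 0 < e -> (fun k => P1 [set w | e <= enorm (tsub (X k w) c)]) @ \oo --> 0%E.

Definition alpha (d : nat) : R := 2 / (d - 1)%:R.
Definition Cq d (rho : d.-tuple R -> R) (q : d.-tuple R) : R :=
  2 `^ (alpha d)^-1 * sphere_area (d - 1) / (d - 1)%:R * rho q.

End Defs.
Arguments sphere {R} n.
Arguments tzero {R} n.

(* Main.v *)
Require Import Defs.
From HB Require Import structures.
From mathcomp Require Import all_boot all_order all_algebra.
From mathcomp Require Import all_classical all_reals all_analysis.
From mathcomp Require Import measurable_realfun ring lra.
Set Implicit Arguments. Unset Strict Implicit. Unset Printing Implicit Defensive.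
Import Order.TTheory GRing.Theory Num.Theory.
Import numFieldNormedType.Exports.
Local Open Scope classical_set_scope.
Local Open Scope ring_scope.

(* Put [y_i = beta_n T_i].  The triple of sums over the sample of [e^{-y_i}], [e^{-y_i/2}]
   and [e^{-y_i/2} + e^{-y_i} sqrt(beta_n) (x_i - q)_j] has nonnegative summands, because
   [|x_i - q|^2 = 2 T_i]; its joint Laplace transform at integer points is
   [(1 - E(1 - e^{-h(x_1)}))^n] for a combination [h] of the summands.  In the gnomonic chart
   [u = (t, t v)] rescaled by [sqrt(beta_n)], dominated convergence gives
   [n E(1 - e^{-h(x_1)}) -> rho(q) gamma^{-1/alpha} \int_{R^{d-1}} (1 - e^{-h})], and in
   polar coordinates [y = |z|^2/2] the limit is the exponent of the Laplace functional of the
   Poisson process.  The Laplace transforms at integer points are the moments of the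
   exponentials of the sums, which lie in a cube, so Bernstein polynomials upgrade their
   convergence to convergence in law.  The ratio defining the attention average is a
   continuous function of these exponentials away from the faces where the total mass is
   infinite or the denominator vanishes, and the limit does not charge those faces. *)

(** The surface measure is given through cones and iterated one-dimensional integrals, and [nu] only
    through its support and its invariance under isometries fixing [q]. Changes of variables are
    therefore reduced to translations, dilations, Householder reflections and one-dimensional
    substitutions, applied to functions of a few scalar products. The Poisson process is given only
    by its counts, which yields its Laplace functional for nonnegative functions, whereas the
    numerator of [Xi] is signed. The weight [e^{-y/2}] is the remedy: it dominates [sqrt(2y) e^{-y}]
    because [2y <= e^y], and it is still integrable against [y^{p-1} dy] with [p = (d-1)/2], so the
    shift can be subtracted again almost surely. No separate tightness estimate is made for the
    sample: the convergence of the expectation of a continuous cut-off transfers tightness from the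
    limit law. *)

Lemma prod_sigma_finite d1 d2 (T1 : measurableType d1) (T2 : measurableType d2)
  (R : realType) (m1 : {sigma_finite_measure set T1 -> \bar R})
  (m2 : {sigma_finite_measure set T2 -> \bar R}) : sigma_finite setT (m1 \x m2)%E.
Proof.
have /sigma_finiteP[F [FT ndF Foo]] := sigma_finiteT m1.
have /sigma_finiteP[G [GT ndG Goo]] := sigma_finiteT m2.
exists (fun n => F n `*` G n).
  rewrite -setXTT FT GT; apply/seteqP; split => -[x y] /=.
    move=> [[n _ Fnx] [k _ Gky]]; exists (maxn n k) => //; split.
    - by move: x Fnx; exact/subsetPset/ndF/leq_maxl.
    - by move: y Gky; exact/subsetPset/ndG/leq_maxr.
  by move=> [n _ []/= ? ?]; split; exists n.
move=> k; have [? ?] := Foo k; have [? ?] := Goo k.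
by split; [exact: measurableX|rewrite product_measure1E// lte_mul_pinfty// ge0_fin_numE].
Qed.

(** * Lebesgue measure on tuples *)

Section TupleMeasure.
Context {R : realType}.

(** A recursion on functions carries no limit theorems; the pushforward of a product measure along
    [cons_tuple] does. Sigma-finiteness is part of the statement because the next product needs it
    for Tonelli. *)
Lemma iint_measure n : exists mu : {sigma_finite_measure set (n.-tuple R) -> \bar R},
  forall f, measurable_fun setT f -> (forall u, 0 <= f u)%E ->
  (\int[mu]_u f u = iint f)%E.
Proof.
elim: n => [|n [mu muE]].
  exists (dirac ([tuple] : 0.-tuple R)) => f mf f0.
  by rewrite integral_dirac// diracE in_setT mul1e.
pose phi (z : R * n.-tuple R) : n.+1.-tuple R := cons_tuple z.1 z.2.
pose psi (u : n.+1.-tuple R) : R * n.-tuple R := (thead u, [tuple of behead u]).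
have mphi : measurable_fun setT phi by exact: measurable_cons.
have mpsi : measurable_fun setT psi.
  apply/measurable_fun_pairP; split => /=.
    exact: (measurable_tnth ord0).
  exact: measurable_behead.
have phiK z : psi (phi z) = z.
  by case: z => t v; rewrite /psi /phi /=; congr (_, _); apply: val_inj.
pose m := (@lebesgue_measure R \x mu)%E.
pose pm0 : {measure set (n.+1.-tuple R) -> \bar R} := pushforward m phi.
pose pm := pm0 mphi.
(* The inverse [psi] of the chart carries the exhaustion of the product over to tuples. *)
have sf : sigma_finite setT pm.
  have [F FT Foo] := prod_sigma_finite (@lebesgue_measure R) mu.
  exists (fun k => psi @^-1` F k).
    by rewrite -preimage_bigcup -FT preimage_setT.
  move=> k; have [mF moo] := Foo k; split; first by rewrite -[X in measurable X]setTI; exact: mpsi.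
  rewrite /pm /pm0 /= /pushforward (_ : _ @^-1` _ = F k)//.
  by apply/seteqP; split => z /=; rewrite phiK.
pose mx := Measure_isSigmaFinite.Build _ _ _ pm sf.
exists (HB.pack_for {sigma_finite_measure set (n.+1.-tuple R) -> \bar R} (Measure.sort pm) mx).
move=> f mf f0 /=.
rewrite [LHS](_ : _ = (\int[pushforward (@lebesgue_measure R \x mu)%E phi]_u f u)%E)//.
rewrite ge0_integral_pushforward//= preimage_setT.
apply: (etrans (@fubini_tonelli1 _ _ _ _ _ (@lebesgue_measure R) mu (f \o phi) _ _)) => //=.
  exact: measurableT_comp.
apply: eq_integral => t _; rewrite /fubini_F/= muE//=.
by apply: measurableT_comp => //; exact: (measurableT_comp mphi (measurable_pair1 _)).
Qed.
Definition lam n : {sigma_finite_measure set (n.-tuple R) -> \bar R} :=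
  projT1 (cid (iint_measure n)).

Lemma lamE n f : measurable_fun setT f -> (forall u, 0 <= f u)%E ->
  (\int[lam n]_u f u = iint f)%E.
Proof. exact: (projT2 (cid (iint_measure n))). Qed.

Lemma measurable_cons_tuple n : measurable_fun setT
  (fun z : measurableTypeR R * n.-tuple R => cons_tuple z.1 z.2 : n.+1.-tuple R).
Proof. exact: measurable_cons. Qed.

Lemma measurable_cons_tuple2 n t : measurable_fun setT
  (fun v : n.-tuple R => cons_tuple t v : n.+1.-tuple R).
Proof. exact: (measurableT_comp (@measurable_cons_tuple n) (pair1_measurable _)). Qed.

Lemma lamS n f : measurable_fun setT f -> (forall u, 0 <= f u)%E ->
  (\int[lam n.+1]_u f u =
   \int[@lebesgue_measure R]_t \int[lam n]_v f (cons_tuple t v))%E.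
Proof.
move=> mf f0; rewrite lamE//=; apply: eq_integral => t _; rewrite lamE//.
by apply: measurableT_comp => //; exact: measurable_cons_tuple2.
Qed.

(** By uniqueness of Lebesgue measure: [a] times the image under [t |-> a t + b] gives every
    half-open interval its length. *)
Lemma integral_affine (a b : R) (f : measurableTypeR R -> \bar R) : 0 < a ->
  measurable_fun setT f -> (forall t, 0 <= f t)%E ->
  (\int[@lebesgue_measure R]_t f t =
   a%:E * \int[@lebesgue_measure R]_t f (a * t + b)%R)%E.
Proof.
move=> a0 mf f0.
pose phi (t : measurableTypeR R) : measurableTypeR R := a * t + b.
have mphi : measurable_fun setT phi.
  apply: measurable_funD => //; exact: measurable_funM.
pose pm0 : {measure set (measurableTypeR R) -> \bar R} :=
   pushforward (@lebesgue_measure R) phi.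
pose pm := pm0 mphi.
pose an := NngNum (ltW a0).
have E A : measurable A -> lebesgue_measure A = mscale an pm A.
  apply: lebesgue_measure_unique => _ [[c d]] _ <- /=.
  rewrite /mscale /= /pm/pm0/= /pushforward.
  rewrite (_ : _ @^-1` _ = [set` `](c - b) / a, (d - b) / a]]); last first.
    apply/seteqP; split => t /=; rewrite !in_itv/= /phi ltr_pdivrMr// ler_pdivlMr// ltrBlDr lerBrDr mulrC//.
  rewrite !lebesgue_measure_itv/= !lte_fin ltr_pM2r ?invr_gt0// ltrD2r.
  case: ifP => // _; last by rewrite mule0.
  by rewrite -!EFinB -EFinM; congr EFin; field; rewrite gt_eqF.
rewrite (eq_measure_integral (mscale an pm)); last by move=> A mA _; exact: E.
rewrite ge0_integral_mscale//=; congr (_ * _)%E.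
by rewrite ge0_integral_pushforward//= preimage_setT.
Qed.

Definition tadd n (u v : n.-tuple R) : n.-tuple R := [tuple tnth u i + tnth v i | i < n].

Lemma tadd_cons n a b (u v : n.-tuple R) :
  tadd (cons_tuple a u) (cons_tuple b v) = cons_tuple (a + b) (tadd u v).
Proof.
apply: eq_from_tnth => i; rewrite !tnth_mktuple.
by case: (unliftP ord0 i) => [j|] ->; rewrite ?tnthS ?tnth_mktuple// !tnth0.
Qed.

Lemma tscale_cons n c a (u : n.-tuple R) :
  tscale c (cons_tuple a u) = cons_tuple (c * a) (tscale c u).
Proof.
apply: eq_from_tnth => i; rewrite !tnth_mktuple.
by case: (unliftP ord0 i) => [j|] ->; rewrite ?tnthS ?tnth_mktuple// !tnth0.
Qed.

Lemma measurable_tadd d (T : measurableType d) n (f g : T -> n.-tuple R) :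
  measurable_fun setT f -> measurable_fun setT g ->
  measurable_fun setT (fun z => tadd (f z) (g z)).
Proof.
move=> mf mg; apply/measurable_fun_tnthP => i.
rewrite (_ : _ \o _ = fun z => tnth (f z) i + tnth (g z) i); last first.
  by apply/funext => z; rewrite /= tnth_mktuple.
by apply: measurable_funD; exact: (measurableT_comp (measurable_tnth i)).
Qed.

Lemma measurable_tscale d (T : measurableType d) n (f : T -> n.-tuple R) (c : T -> R) :
  measurable_fun setT c -> measurable_fun setT f ->
  measurable_fun setT (fun z => tscale (c z) (f z)).
Proof.
move=> mc mf; apply/measurable_fun_tnthP => i.
rewrite (_ : _ \o _ = fun z => c z * tnth (f z) i); last first.
  by apply/funext => z; rewrite /= tnth_mktuple.
by apply: measurable_funM => //; exact: (measurableT_comp (measurable_tnth i)).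
Qed.

Lemma tsubE n (u v : n.-tuple R) : tsub u v = tadd u (tscale (-1) v).
Proof. by apply: eq_from_tnth => i; rewrite !tnth_mktuple mulN1r. Qed.

Lemma measurable_tsub d (T : measurableType d) n (f g : T -> n.-tuple R) :
  measurable_fun setT f -> measurable_fun setT g ->
  measurable_fun setT (fun z => tsub (f z) (g z)).
Proof.
move=> mf mg; under eq_fun do rewrite tsubE.
by apply: measurable_tadd => //; exact: measurable_tscale.
Qed.

Lemma tuple_cons_eta n (u : n.+1.-tuple R) : exists a v, u = cons_tuple a v.
Proof. by exists (thead u), [tuple of behead u]; rewrite {1}(tuple_eta u); exact: val_inj. Qed.

(** Induction on the dimension splits off one coordinate, to which [integral_affine] with slope 1
    applies. *)
Lemma lam_translation n (v : n.-tuple R) f : measurable_fun setT f -> (forall u, 0 <= f u)%E ->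
  (\int[lam n]_u f (tadd u v) = \int[lam n]_u f u)%E.
Proof.
have mv m (w : m.-tuple R) : measurable_fun setT (fun u : m.-tuple R => tadd u w).
  exact: measurable_tadd.
elim: n v f => [|n IH] v f mf f0.
  by apply: eq_integral => u _; rewrite (tuple0 (tadd _ _)) (tuple0 u).
have [a [w ->]] := tuple_cons_eta v.
rewrite (lamS mf f0) (lamS (measurableT_comp mf (mv _ _)) (fun=> f0 _)).
transitivity (\int[@lebesgue_measure R]_t \int[lam n]_u f (cons_tuple (1 * t + a)%R u))%E.
  apply: eq_integral => t _; rewrite mul1r -[RHS](IH w)//; last exact: (measurableT_comp mf (measurable_cons_tuple2 _)).
  by apply: eq_integral => u _; rewrite /= tadd_cons.
rewrite [RHS](@integral_affine 1 a)//; first by rewrite mul1e.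
- apply: (@measurable_fun_fubini_tonelli_F _ _ _ _ _ (lam n) (f \o (fun z => cons_tuple z.1 z.2))) => //=.
  by apply: measurableT_comp => //; exact: measurable_cons_tuple.
- by move=> t; exact: integral_ge0.
Qed.

Lemma lam_scale n c f : 0 < c -> measurable_fun setT f -> (forall u, 0 <= f u)%E ->
  (\int[lam n]_u f u = (c ^+ n)%:E * \int[lam n]_u f (tscale c u))%E.
Proof.
move=> c0.
elim: n f => [|n IH] f mf f0.
  by rewrite mul1e; apply: eq_integral => u _; rewrite (tuple0 (tscale _ _)) (tuple0 u).
have mg : measurable_fun setT (f \o (fun z : measurableTypeR R * n.-tuple R => cons_tuple z.1 z.2)).
  by apply: measurableT_comp => //; exact: measurable_cons_tuple.
have mi := @measurable_fun_fubini_tonelli_F _ _ _ _ _ (lam n) _ mg (fun=> f0 _).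
rewrite !lamS//; last by apply: measurableT_comp => //; exact: measurable_tscale.
rewrite (@integral_affine c 0)//; last by move=> t; exact: integral_ge0.
rewrite exprS EFinM -muleA; congr (_ * _)%E.
rewrite -ge0_integralZl; [|exact: measurableT|..|by rewrite lee_fin exprn_ge0// ltW]; last 2 first.
- apply: (measurable_fun_fubini_tonelli_F (fun z => f (tscale c (cons_tuple z.1 z.2)))) => //.
  apply: measurableT_comp => //; apply: measurableT_comp (@measurable_cons_tuple n).
  exact: measurable_tscale.
- by move=> t _; exact: integral_ge0.
apply: eq_integral => t _; rewrite addr0 IH//; last first.
  exact: (measurableT_comp mf (measurable_cons_tuple2 _)).
by congr (_ * _)%E; apply: eq_integral => u _; rewrite tscale_cons.
Qed.

End TupleMeasure.

(** * Scalar products and Householder reflections *)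

Section DotProduct.
Context {R : realType} {n : nat}.
Implicit Types u v w p r q : n.-tuple R.

Lemma dotvC u v : dotv u v = dotv v u.
Proof. by apply: eq_bigr => i _; rewrite mulrC. Qed.

Lemma dotvDl u v w : dotv (tadd u v) w = dotv u w + dotv v w.
Proof. by rewrite -big_split; apply: eq_bigr => i _; rewrite tnth_mktuple mulrDl. Qed.

Lemma dotvBl u v w : dotv (tsub u v) w = dotv u w - dotv v w.
Proof. by rewrite -sumrB; apply: eq_bigr => i _; rewrite tnth_mktuple mulrBl. Qed.

Lemma dotvZl c u v : dotv (tscale c u) v = c * dotv u v.
Proof. by rewrite /dotv mulr_sumr; apply: eq_bigr => i _; rewrite tnth_mktuple mulrA. Qed.

Lemma dotvBr u v w : dotv w (tsub u v) = dotv w u - dotv w v.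
Proof. by rewrite dotvC dotvBl !(dotvC w). Qed.

Lemma dotvZr c u v : dotv u (tscale c v) = c * dotv u v.
Proof. by rewrite dotvC dotvZl dotvC. Qed.

Lemma dotv_ge0 u : 0 <= dotv u u.
Proof. by apply: sumr_ge0 => i _; rewrite -expr2 sqr_ge0. Qed.

Lemma dotv_eq0 u i : dotv u u = 0 -> tnth u i = 0.
Proof.
move=> /eqP; rewrite psumr_eq0; last by move=> j _; rewrite -expr2 sqr_ge0.
by move=> /allP /(_ i (mem_index_enum _)) /=; rewrite -expr2 sqrf_eq0 => /eqP.
Qed.

Lemma coord_le_enorm u i : `|tnth u i| <= enorm u.
Proof.
rewrite -sqrtr_sqr ler_wsqrtr// /dotv (bigD1 i)//= -expr2 lerDl.
by apply: sumr_ge0 => j _; rewrite -expr2 sqr_ge0.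
Qed.

(* The Householder reflection in the hyperplane orthogonal to [p]; it is the
   identity when [p = 0], because then the division by [dotv p p] gives 0. *)
Definition reflection p u := tsub u (tscale (2 * dotv u p / dotv p p) p).

Lemma dotv_reflection p u v : dotv (reflection p u) (reflection p v) = dotv u v.
Proof.
rewrite /reflection !(dotvBl, dotvBr, dotvZl, dotvZr) (dotvC p v).
have [->|p0] := eqVneq (dotv p p) 0; first by rewrite invr0; ring.
by field.
Qed.

Lemma reflection_adj p u v : dotv (reflection p u) v = dotv u (reflection p v).
Proof.
by rewrite /reflection !(dotvBl, dotvBr, dotvZl, dotvZr) (dotvC p v); ring.
Qed.

Lemma reflectionK p : involutive (reflection p).
Proof.
move=> u; apply: eq_from_tnth => i.
rewrite /reflection !tnth_mktuple dotvBl dotvZl.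
have [->|p0] := eqVneq (dotv p p) 0; first by rewrite invr0; ring.
by field.
Qed.

Lemma reflectionD p u v : reflection p (tadd u v) = tadd (reflection p u) (reflection p v).
Proof.
by apply: eq_from_tnth => i; rewrite /reflection !tnth_mktuple dotvDl; ring.
Qed.

Lemma reflectionZ p c u : reflection p (tscale c u) = tscale c (reflection p u).
Proof.
by apply: eq_from_tnth => i; rewrite /reflection !tnth_mktuple dotvZl; ring.
Qed.

Lemma reflection_fix p q : dotv q p = 0 -> reflection p q = q.
Proof.
by move=> qp; apply: eq_from_tnth => i; rewrite /reflection !tnth_mktuple qp; ring.
Qed.

(** Equal norms give [|p - r|^2 = 2 <p, p - r>], so the coefficient of the reflection is 1 and [p]
    goes to [p - (p - r)]. If [p = r] the reflection is the identity. *)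
Lemma reflection_swap p r : dotv p p = dotv r r -> reflection (tsub p r) p = r.
Proof.
move=> pr; apply: eq_from_tnth => i.
have [N0|N0] := eqVneq (dotv (tsub p r) (tsub p r)) 0.
  have := dotv_eq0 i N0; rewrite /reflection !tnth_mktuple N0 invr0 => /subr0_eq ->.
  by ring.
rewrite /reflection !tnth_mktuple.
rewrite (_ : dotv (tsub p r) (tsub p r) = 2 * dotv p (tsub p r)) in N0 *; last first.
  by rewrite !(dotvBl, dotvBr) (dotvC r p) pr; ring.
by rewrite divff// mul1r subKr.
Qed.

End DotProduct.

(** * Invariance of Lebesgue measure under reflections *)

Section Invariance.
Context {R : realType}.

Lemma measurable_dotv d (T : measurableType d) n (f g : T -> n.-tuple R) :
  measurable_fun setT f -> measurable_fun setT g ->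
  measurable_fun setT (fun z => dotv (f z) (g z)).
Proof.
move=> mf mg; apply: measurable_sum => i; apply: measurable_funM;
exact: (measurableT_comp (measurable_tnth i)).
Qed.

Lemma measurable_reflection n (p : n.-tuple R) : measurable_fun setT (reflection p).
Proof.
apply: measurable_tsub => //; apply: measurable_tscale => //.
by do 2 apply: measurable_funM => //; exact: measurable_dotv.
Qed.

Lemma dotv_cons n a b (u v : n.-tuple R) :
  dotv (cons_tuple a u) (cons_tuple b v) = a * b + dotv u v.
Proof.
rewrite /dotv big_ord_recl !tnth0; congr (_ + _).
by apply: eq_bigr => i _; rewrite !tnthS.
Qed.

Lemma measurable_expNdotv n : measurable_fun setT (fun u : n.-tuple R => (expR (- dotv u u))%:E).
Proof.
apply/measurable_EFinP; apply: measurableT_comp => //.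
by apply: measurable_funN; exact: measurable_dotv.
Qed.

(** The Gaussian has two uses: it is an isometry-invariant reference function of finite positive
    integral for the Haar argument, and a majorant from which the finiteness of volumes and of the
    dominating integral follows. *)
Lemma lam_gauss n :
  (\int[lam n]_u (expR (- dotv u u))%:E = ((Num.sqrt pi) ^+ n)%:E :> \bar R)%E.
Proof.
elim: n => [|n IH].
  rewrite lamE//=; first by rewrite /dotv big_ord0 oppr0 expR0 expr0.
  exact: measurable_expNdotv.
rewrite lamS//; last exact: measurable_expNdotv.
under eq_integral => t _.
  under eq_integral do rewrite dotv_cons opprD expRD EFinM.
  rewrite ge0_integralZl//=; last exact: measurable_expNdotv.
  rewrite IH muleC -expr2.
over.
rewrite ge0_integralZl//=; last by apply/measurable_EFinP; exact: measurable_gauss_fun.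
by rewrite integralT_gauss -EFinM -exprSr.
Qed.

(* Uniqueness of Haar measure: the double integral of [f (x + Q y) g y]
   can be computed by translating either variable. *)
Lemma lam_involution n (Q : n.-tuple R -> n.-tuple R) (f g : n.-tuple R -> \bar R) :
  measurable_fun setT Q -> involutive Q ->
  (forall u v, Q (tadd u v) = tadd (Q u) (Q v)) ->
  measurable_fun setT f -> (forall u, 0 <= f u)%E ->
  measurable_fun setT g -> (forall u, 0 <= g u)%E ->
  (forall u, g (tscale (-1) (Q u)) = g u) ->
  ((\int[lam n]_u f (Q u)) * \int[lam n]_u g u =
   (\int[lam n]_u f u) * \int[lam n]_u g u)%E.
Proof.
move=> mQ QK QD mf f0 mg g0 gQ.
have mfQ : measurable_fun setT (f \o Q) := measurableT_comp mf mQ.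
have mt w : measurable_fun setT (fun u : n.-tuple R => tadd u w) by exact: measurable_tadd.
have mQ2 : measurable_fun setT (fun z : n.-tuple R * n.-tuple R => Q z.2).
  exact: (measurableT_comp mQ).
have mQ1 : measurable_fun setT (fun z : n.-tuple R * n.-tuple R => Q z.1).
  exact: (measurableT_comp mQ).
have mF : measurable_fun setT (fun z : n.-tuple R * n.-tuple R => f (tadd z.1 (Q z.2)) * g z.2)%E.
  apply: emeasurable_funM; first exact: (measurableT_comp mf (measurable_tadd measurable_fst mQ2)).
  exact: (measurableT_comp mg).
have mG : measurable_fun setT (fun z : n.-tuple R * n.-tuple R => f (Q z.2) * g (tsub z.2 (Q z.1)))%E.
  apply: emeasurable_funM; first exact: (measurableT_comp mf mQ2).
  exact: (measurableT_comp mg (measurable_tsub measurable_snd mQ1)).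
have taddC (u v : n.-tuple R) : tadd u v = tadd v u.
  by apply: eq_from_tnth => i; rewrite !tnth_mktuple addrC.
transitivity (\int[lam n]_x \int[lam n]_y (f (tadd x (Q y)) * g y))%E; last first.
  rewrite (fubini_tonelli _ mF); last by move=> z; exact: mule_ge0.
  rewrite -ge0_integralZl; [|exact: measurableT|exact: mg|by move=> u _; exact: g0|by apply: integral_ge0 => u _; exact: f0].
  apply: eq_integral => y _ /=.
  rewrite ge0_integralZr; [by rewrite (lam_translation (Q y) mf f0)|exact: measurableT| |by move=> u _; exact: f0|exact: g0].
  exact: (measurableT_comp mf (mt _)).
transitivity (\int[lam n]_x \int[lam n]_y (f (Q y) * g (tsub y (Q x))))%E; last first.
  apply: eq_integral => x _.
  rewrite -(lam_translation (Q x) (measurableT_comp mG (pair1_measurable x))); last first.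
    by move=> y; exact: mule_ge0.
  apply: eq_integral => y _ /=; congr (f _ * g _)%E.
    by rewrite QD QK taddC.
  by apply: eq_from_tnth => i; rewrite !tnth_mktuple addrK.
rewrite (fubini_tonelli _ mG); last by move=> z; exact: mule_ge0.
rewrite -ge0_integralZr; [|exact: measurableT|exact: mfQ|by move=> u _; exact: f0|by apply: integral_ge0 => u _; exact: g0].
apply: eq_integral => y _ /=.
have mgy : measurable_fun setT (fun x => g (tsub y (Q x))).
  exact: (measurableT_comp mg (measurable_tsub (measurable_cst _) mQ)).
rewrite ge0_integralZl; [|exact: measurableT|exact: mgy|by move=> u _; exact: g0|exact: f0].
(* [Q] is an additive involution, so [y - Q (x + Q y) = - Q x], and [gQ] restores [g x]. *)
congr (_ * _)%E; rewrite -(lam_translation (Q y) mgy); last by move=> u; exact: g0.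
apply: eq_integral => x _; rewrite -gQ; congr g; apply: eq_from_tnth => i.
by rewrite QD QK !tnth_mktuple; ring.
Qed.

(** With the Gaussian as [g] in [lam_involution], the common factor [pi^{n/2}] is finite and
    nonzero, so it cancels. *)
Lemma lam_reflection n (p : n.-tuple R) f : measurable_fun setT f -> (forall u, 0 <= f u)%E ->
  (\int[lam n]_u f (reflection p u) = \int[lam n]_u f u)%E.
Proof.
move=> mf f0.
have := @lam_involution n _ f _ (@measurable_reflection n p) (reflectionK p)
  (reflectionD p) mf f0 (@measurable_expNdotv n).
rewrite lam_gauss => H.
have {}H : ((\int[lam n]_u f (reflection p u)) * (Num.sqrt pi ^+ n)%:E =
  (\int[lam n]_u f u) * (Num.sqrt pi ^+ n)%:E)%E.
  apply: H => u; first by rewrite lee_fin expR_ge0.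
  by congr (expR (- _))%:E; rewrite dotvZl dotvZr dotv_reflection; ring.
have s0 : Num.sqrt (pi : R) ^+ n != 0 by rewrite expf_neq0// gt_eqF// sqrtr_gt0 pi_gt0.
by rewrite -[LHS]mule1 -[RHS]mule1 -(divff s0) EFinM !muleA H.
Qed.

End Invariance.

(** * Transfer of integrals between weighted measures *)

Section IntegralTransfer.
Context {R : realType} d1 d2 d3 (S1 : measurableType d1) (S2 : measurableType d2)
  (T : measurableType d3).
Context (m1 : {measure set S1 -> \bar R}) (m2 : {measure set S2 -> \bar R}).
Import HBNNSimple.

Let measurable_indic_weight (f : {nnsfun T >-> R}) d (S : measurableType d) (N : S -> T)
    (g : S -> R) r :
  measurable_fun setT N -> measurable_fun setT g ->
  measurable_fun setT (fun s => (\1_(f @^-1` [set r]) (N s))%:E * (g s)%:E)%E.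
Proof.
move=> mN /measurable_EFinP mg; apply: emeasurable_funM => //; apply/measurable_EFinP.
by apply: (measurableT_comp _ mN); exact: measurable_indic.
Qed.

Let nnsfun_transfer (f : {nnsfun T >-> R}) d (S : measurableType d)
  (m : {measure set S -> \bar R}) (N : S -> T) (g : S -> R) :
  measurable_fun setT N -> measurable_fun setT g -> (forall s, 0 <= g s) ->
  (\int[m]_s ((f (N s))%:E * (g s)%:E) =
   \sum_(r \in range f) r%:E * \int[m]_s ((\1_(f @^-1` [set r]) (N s))%:E * (g s)%:E))%E.
Proof.
move=> mN mg g0.
under eq_integral => s _.
  rewrite fimfunE -fsumEFin// ge0_mule_fsuml; last first.
    by move=> r; exact: nnfun_muleindic_ge0.
  under eq_fsbigr do rewrite EFinM -muleA.
over.
rewrite ge0_integral_fsum//.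
- apply: eq_fsbigr => r _.
  have [r0|r0] := leP 0 r.
    rewrite ge0_integralZl//; first exact: measurable_indic_weight.
    by move=> s _; rewrite mule_ge0// lee_fin.
  rewrite preimage_nnfun0// !integral0_eq ?mule0// => s _.
    by rewrite indicE in_set0 mul0e.
  by rewrite indicE in_set0 mul0e mule0.
- move=> r; move/measurable_EFinP : (mg) => mg'; apply: emeasurable_funM => //; exact: measurable_indic_weight.
- by move=> r s _; rewrite muleA mule_ge0 ?lee_fin//; exact: (@nnfun_muleindic_ge0 _ _ _ f r (N s)).
Qed.

(** Agreement on indicators passes to simple functions by linearity and to nonnegative functions by
    monotone convergence. The weights let one statement cover image measures, densities and the
    linear identities behind independence. *)
Lemma integral_transfer (N1 : S1 -> T) (N2 : S2 -> T) (g1 : S1 -> R) (g2 : S2 -> R)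
    (F : T -> \bar R) :
  measurable_fun setT N1 -> measurable_fun setT N2 ->
  measurable_fun setT g1 -> measurable_fun setT g2 ->
  (forall s, 0 <= g1 s) -> (forall s, 0 <= g2 s) ->
  (forall A, measurable A ->
     (\int[m1]_s ((\1_A (N1 s))%:E * (g1 s)%:E) = \int[m2]_s ((\1_A (N2 s))%:E * (g2 s)%:E))%E) ->
  measurable_fun setT F -> (forall x, 0 <= F x)%E ->
  (\int[m1]_s (F (N1 s) * (g1 s)%:E) = \int[m2]_s (F (N2 s) * (g2 s)%:E))%E.
Proof.
move=> mN1 mN2 mg1 mg2 g10 g20 H mF F0.
pose f_ := nnsfun_approx measurableT mF.
have E d (S : measurableType d) (m : {measure set S -> \bar R}) (N : S -> T) (g : S -> R) :
    measurable_fun setT N -> measurable_fun setT g -> (forall s, 0 <= g s) ->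
    (\int[m]_s (F (N s) * (g s)%:E) = limn (fun n => \int[m]_s ((f_ n (N s))%:E * (g s)%:E)))%E.
  move=> mN mg g0; rewrite -monotone_convergence//.
  - apply: eq_integral => s _; apply/esym/cvg_lim => //.
    apply: cvgeZr => //.
    by apply: cvg_nnsfun_approx => // *; apply: F0.
  - move=> n; move/measurable_EFinP : (mg) => mg'; apply: emeasurable_funM => //; apply/measurable_EFinP.
    exact: (measurableT_comp (measurable_funP _)).
  - by move=> n s _; rewrite mule_ge0// lee_fin.
  - move=> s _ a b ab; rewrite lee_wpmul2r ?lee_fin//.
    exact/lefP/nd_nnsfun_approx.
rewrite !E//; congr (limn _); apply/funext => n.
rewrite !nnsfun_transfer//; apply: eq_fsbigr => r _.
by rewrite H.
Qed.

End IntegralTransfer.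

(** * Continuity and measurability of the density *)

Section ContinuousMeasurable.
Context {R : realType}.

Definition cont_at n (f : n.-tuple R -> R) (u : n.-tuple R) := forall e, 0 < e ->
  exists2 del, 0 < del & forall v, (forall i, `|tnth v i - tnth u i| < del) -> `|f v - f u| < e.

Let grid n (k : nat) (u : n.-tuple R) : n.-tuple int := [tuple Num.floor (tnth u i * k.+1%:R) | i < n].
Let ungrid n (k : nat) (z : n.-tuple int) : n.-tuple R := [tuple (tnth z i)%:~R / k.+1%:R | i < n].

Let measurable_gridfun n k (h : n.-tuple int -> R) : measurable_fun setT (h \o grid k).
Proof.
move=> _ B mB; rewrite setTI.
rewrite (_ : _ @^-1` _ = \bigcup_m
   (if unpickle m is Some z then if h z \in B then [set u | grid k u = z] else set0 else set0)).
  apply: bigcupT_measurable => m; case: (unpickle m) => [z|]//; case: ifP => // _.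
  rewrite (_ : mkset _ = \bigcap_(i in [set: 'I_n]) [set u | (tnth z i)%:~R <= tnth u i * k.+1%:R < (tnth z i + 1)%:~R]).
    apply: fin_bigcap_measurable => // i _.
    rewrite (_ : mkset _ = (fun u => tnth u i * k.+1%:R) @^-1` `[(tnth z i)%:~R, (tnth z i + 1)%:~R[%classic); last first.
      by apply/seteqP; split => u /=; rewrite in_itv.
    rewrite -[X in measurable X]setTI; apply: (measurable_funM (measurable_tnth i) (measurable_cst _)) => //.
  apply/seteqP; split => u /=.
    by move=> <- i _; rewrite !tnth_mktuple; exact: floor_itv.
  move=> H; apply: eq_from_tnth => i; rewrite tnth_mktuple.
  by apply/floor_def/H.
apply/seteqP; split => u /=.
  move=> Bu; exists (pickle (grid k u)) => //; rewrite pickleK.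
  by rewrite mem_set.
by move=> [m _]; case: (unpickle m) => // z; case: ifPn => // /set_mem Bz /= ->.
Qed.

(** Rounding each coordinate down to a multiple of [1/(k+1)] gives approximants that are constant on
    countably many cells, hence measurable; continuity at the points of [D] makes them converge
    there. *)
Lemma measurable_cont_at n (D : set (n.-tuple R)) f : measurable D ->
  (forall u, D u -> cont_at f u) -> measurable_fun D f.
Proof.
move=> mD cf.
apply: (@measurable_fun_cvg _ _ _ _ (fun k u => f (ungrid k (grid k u)))).
  move=> k; apply: measurable_funTS; exact: (@measurable_gridfun n k (f \o @ungrid n k)).
move=> u Du; apply/cvgrPdist_lt => e e0.
have [del del0 H] := cf _ Du _ e0.
near=> k; rewrite distrC; apply: H => i; rewrite !tnth_mktuple.
set t := tnth u i.
have k0 : 0 < k.+1%:R :> R by [].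
have h1 : (Num.floor (t * k.+1%:R))%:~R <= t * k.+1%:R by exact: floor_le.
have h2 : t * k.+1%:R < (Num.floor (t * k.+1%:R) + 1)%:~R by exact: floorD1_gt.
rewrite ler0_norm ?subr_le0 ?ler_pdivrMr// opprB.
apply: (@lt_trans _ _ (k.+1%:R^-1)); last by near: k; exact: near_infty_natSinv_lt (PosNum del0).
rewrite ltrBlDr -{1}(mul1r k.+1%:R^-1) -mulrDl addrC ltr_pdivlMr//.
by rewrite intrD in h2.
Unshelve. all: by end_near. Qed.

End ContinuousMeasurable.

Section PartialDerivatives.
Context {R : realType} {n : nat}.
Implicit Types (F : 'rV[R]_n -> R) (x e : 'rV[R]_n).

Let line_derive F x e t :
  derivable F (x + t *: e) e -> is_derive t 1 (fun s => F (x + s *: e)) ('D_e F (x + t *: e)).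
Proof.
move=> dF.
have E : (fun h => h^-1 *: (((fun s => F (x + s *: e)) \o shift t) (h *: (1 : R)) - F (x + t *: e))) =
         (fun h => h^-1 *: ((F \o shift (x + t *: e)) (h *: e) - F (x + t *: e))).
  apply/funext => h /=; congr (_ *: (F _ - _)).
  by rewrite scaler1 scalerDl addrCA addrC.
apply: DeriveDef; first by rewrite /derivable E.
by rewrite /derive E.
Qed.

Let line_bound F x e h M : 0 <= h ->
  (forall t, 0 <= t <= h -> derivable F (x + t *: e) e /\ `|'D_e F (x + t *: e)| <= M) ->
  `|F (x + h *: e) - F x| <= M * h.
Proof.
move=> h0 H.
have dF t : t \in `]0, h[%R -> is_derive t 1 (fun s => F (x + s *: e)) ('D_e F (x + t *: e)).
  by rewrite in_itv/= => /andP[t0 th]; apply/line_derive/(H t _).1; rewrite !ltW.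
have cF : {within `[0, h], continuous (fun s => F (x + s *: e))}.
  apply: derivable_within_continuous => t; rewrite in_itv/= => th.
  by have := line_derive (H t th).1; move=> /@ex_derive.
have [c] := MVT_segment h0 dF cF.
rewrite in_itv/= => hc; rewrite scale0r addr0 subr0 => ->.
by rewrite normrM (ger0_norm h0) ler_wpM2r// (H c hc).2.
Qed.

Let line_bound_abs F x e h M :
  (forall t, `|t| <= `|h| -> derivable F (x + t *: e) e /\ `|'D_e F (x + t *: e)| <= M) ->
  `|F (x + h *: e) - F x| <= M * `|h|.
Proof.
have [h0|h0] := leP 0 h => H.
  by rewrite (ger0_norm h0); apply: line_bound => // t /andP[t0 th]; apply: H; rewrite !ger0_norm.
have hN : 0 <= - h by rewrite oppr_ge0 ltW.
rewrite (ltr0_norm h0) in H *.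
have := @line_bound F (x + h *: e) e (- h) M hN.
rewrite -addrA -scalerDl subrr scale0r addr0 distrC; apply => t /andP[t0 th].
rewrite -addrA -scalerDl; apply: H; rewrite ler_norml; lra.
Qed.

(** Moving from [v] to [w] one coordinate at a time, each move is controlled by the mean value
    theorem and a bound on the partial derivative near [v]. *)
Lemma continuous_partials F (U : set 'rV[R]_n) v : open U -> U v ->
  (forall u, U u -> forall a, derivable F u a) ->
  (forall b, {for v, continuous ('D_b F)}) -> {for v, continuous F}.
Proof.
move=> oU Uv dF cF.
(* Each partial derivative is continuous at [v], so nearby its modulus exceeds the value there by
   less than 1; [M] bounds them all. *)
pose M := 1 + \sum_i `|'D_(delta_mx 0 i) F v|.
have M1 : 1 <= M by rewrite lerDl sumr_ge0.
have [r r0 rU] : exists2 r : R, 0 < r & forall w : 'rV[R]_n, (forall i, `|v 0 i - w 0 i| < r) ->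
    U w /\ forall i, `|'D_(delta_mx 0 i) F w| <= M.
  have : \forall w \near v, U w /\ forall i, `|'D_(delta_mx 0 i) F w| <= M.
    apply: filterI; first exact: open_nbhs_nbhs.
    have near_i (i : 'I_n) : \forall w \near v, `|'D_(delta_mx 0 i) F w| <= M; last first.
      exact: (@filter_forall _ _ (fun i (w : 'rV[R]_n) => `|'D_(delta_mx 0 i) F w| <= M) (nbhs v) _ near_i).
    have /cvgrPdist_lt/(_ _ ltr01) := cF (delta_mx 0 i).
    apply: filterS => w /= h.
    have : `|'D_(delta_mx 0 i) F v| <= \sum_i `|'D_(delta_mx 0 i) F v|.
      by rewrite (bigD1 i)//= lerDl sumr_ge0.
    by rewrite /M; move: h; rewrite distrC => h; have := lerB_dist ('D_(delta_mx 0 i) F w) ('D_(delta_mx 0 i) F v); lra.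
  move=> /nbhs_ballP[r r0 H]; exists r => // w vw; apply: H.
  by split => // i j; rewrite ord1; exact: vw.
(* [mix w k] has the first [k] coordinates of [w] and the others of [v], so consecutive points
   differ along one axis. *)
pose mix (w : 'rV[R]_n) k : 'rV[R]_n := \row_i (if (i < k)%N then w 0 i else v 0 i).
have step del (w : 'rV[R]_n) : 0 <= del -> del <= r -> (forall i, `|v 0 i - w 0 i| < del) ->
    forall k, (k <= n)%N -> `|F (mix w k) - F v| <= k%:R * (M * del).
  move=> del0 delr vw; elim=> [_|k IH kn].
    by rewrite (_ : mix w 0 = v) ?subrr ?normr0 ?mul0r//; apply/rowP => i; rewrite mxE.
  pose i := Ordinal kn.
  have E : mix w k.+1 = mix w k + (w 0 i - v 0 i) *: delta_mx 0 i.
    apply/rowP => j; rewrite !mxE eqxx/= ltnS leq_eqVlt -val_eqE /=.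
    case: (ltngtP j k) => jk /=; rewrite ?mulr0 ?addr0 ?mulr1; [by []|by []|].
    have -> : j = i by exact: val_inj.
    by rewrite addrC subrK.
  rewrite E -(subrKA (F (mix w k))) (le_trans (ler_normD _ _))//.
  rewrite -natr1 mulrDl mul1r addrC lerD//; last first.
    apply: le_trans (_ : M * `|w 0 i - v 0 i| <= _); last first.
      by rewrite ler_wpM2l ?(le_trans ler01)// distrC ltW.
    apply: line_bound_abs => t ht.
    have [|Uw Dw] := rU (mix w k + t *: delta_mx 0 i); last by split; [exact: dF|exact: Dw].
    move=> j; rewrite !mxE eqxx/=.
    have [ji|ji] := eqVneq j i.
      rewrite ji ltnn mulr1 opprD addNKr normrN (le_lt_trans ht)//.
      by rewrite distrC (lt_le_trans (vw _)).
    rewrite mulr0 addr0; case: ifP => _; last by rewrite subrr normr0.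
    exact: lt_le_trans (vw _) _.
  by apply: IH; exact: ltnW.
apply/(@cvgrPdist_lt _ _ _ (nbhs v)) => e e0.
(* The [n] moves cost at most [n M del]; dividing by [n+1] makes the final inequality strict and
   covers [n = 0]. *)
pose del := Num.min r (e / (n.+1%:R * M)).
have del0 : 0 < del by rewrite lt_min r0/= divr_gt0// mulr_gt0// (lt_le_trans ltr01).
near=> w.
have vw i : `|v 0 i - w 0 i| < del.
  have : ball v del w by near: w; exact: nbhsx_ballx.
  by move=> [_ /(_ 0 i)].
rewrite distrC.
have -> : w = mix w n by apply/rowP => i; rewrite mxE ltn_ord.
have delr : del <= r by rewrite ge_min lexx.
apply: le_lt_trans (step _ _ (ltW del0) delr vw n (leqnn n)) _.
have M0 : 0 < M by exact: lt_le_trans ltr01 _.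
apply: (@lt_le_trans _ _ (n.+1%:R * (M * del))).
  by rewrite ltr_pM2r ?mulr_gt0// ltr_nat.
by rewrite mulrA mulrC -ler_pdivlMr ?mulr_gt0// ge_min lexx orbT.
Unshelve. all: by end_near.
Qed.

(** The previous lemma is used twice: continuity of the second derivatives gives that of the first
    ones, which gives that of [F]. *)
Lemma continuous_second_partials F (U : set 'rV[R]_n) : open U ->
  (forall v, U v -> forall a b : 'rV[R]_n, [/\ derivable F v a, derivable ('D_a F) v b &
     {for v, continuous ('D_b ('D_a F))}]) ->
  forall v, U v -> {for v, continuous F}.
Proof.
move=> oU H v Uv; apply: (continuous_partials oU Uv) => [u Uu a|b].
  by have [] := H u Uu a a.
apply: (continuous_partials oU Uv) => [u Uu a|c].
  by have [] := H u Uu b a.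
by have [] := H v Uv b c.
Qed.

End PartialDerivatives.

(** * The law of a sample point as an integral over the ball *)

Section SphereLaw.
Context {R : realType}.

Lemma measurable_sphere n : measurable (sphere n : set (n.-tuple R)).
Proof.
rewrite (_ : sphere n = (fun u : n.-tuple R => dotv u u) @^-1` [set 1])//.
by rewrite -[X in measurable X]setTI; apply: measurable_dotv.
Qed.

Lemma C2_on_sphere_cont n (rho : n.-tuple R -> R) : C2_on_sphere rho ->
  exists g : n.-tuple R -> R, (forall u, sphere n u -> g u = rho u) /\
    forall u, sphere n u -> cont_at g u.
Proof.
move=> [U [oU [SU [g [gE Hg]]]]].
pose row (u : n.-tuple R) : 'rV[R]_n := \row_i tnth u i.
have rowK u : tup_of_row (row u) = u.
  by apply: eq_from_tnth => i; rewrite tnth_mktuple mxE.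
exists (g \o row); split => [u Su|u Su e e0] /=.
  by rewrite gE ?rowK.
have Uu : U (row u) by apply: SU; rewrite rowK.
have /(@cvgrPdist_lt _ _ _ (nbhs (row u))) /(_ _ e0) := continuous_second_partials oU Hg Uu.
move=> /nbhs_ballP[del /= del0 H]; exists del => // v uv.
rewrite distrC; apply: H; split => // i j; rewrite !mxE /ball/= distrC; exact: uv.
Qed.

Lemma measurable_enorm d (T : measurableType d) n (f : T -> n.-tuple R) :
  measurable_fun setT f -> measurable_fun setT (fun z => enorm (f z)).
Proof.
have ms : measurable_fun setT (Num.sqrt : R -> R).
  by apply: continuous_measurable_fun; exact: sqrt_continuous.
by move=> mf; exact: (measurableT_comp ms (measurable_dotv mf mf)).
Qed.

Lemma measurable_inv_ge0 d (T : measurableType d) (f : T -> R) :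
  (forall z, 0 <= f z) -> measurable_fun setT f -> measurable_fun setT (fun z => (f z)^-1).
Proof.
move=> f0 mf; under eq_fun do rewrite -powR_inv1//.
exact: (measurableT_comp (measurable_powR _)).
Qed.

Lemma measurable_normalize n : measurable_fun setT (@normalize R n).
Proof.
apply: measurable_tscale => //; apply: measurable_inv_ge0; first by move=> u; exact: sqrtr_ge0.
exact: measurable_enorm.
Qed.

Lemma enorm_sqr n (u : n.-tuple R) : enorm u ^+ 2 = dotv u u.
Proof. by rewrite sqr_sqrtr// dotv_ge0. Qed.

Lemma enorm_gt0 n (u : n.-tuple R) : (0 < enorm u) = (0 < dotv u u).
Proof. by rewrite sqrtr_gt0. Qed.

Lemma normalize_sphere n (u : n.-tuple R) : 0 < dotv u u -> sphere n (normalize u).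
Proof.
move=> u0; rewrite /sphere/= /normalize dotvZl dotvZr -enorm_sqr expr2.
have e0 : enorm u != 0 by rewrite gt_eqF// enorm_gt0.
by field.
Qed.

Lemma cone_sphereE n (A : set (n.-tuple R)) u :
  cone (A `&` sphere n) u <-> 0 < dotv u u <= 1 /\ A (normalize u).
Proof.
split=> [[t [y [/andP[t0 t1] [Ay Sy]] ->]]|[/andP[u0 u1] Au]].
  rewrite dotvZl dotvZr Sy mulr1 mulr_gt0//= mulr_ile1 ?(ltW t0)//; split => //.
  rewrite (_ : normalize _ = y)//; apply: eq_from_tnth => i.
  rewrite /normalize /enorm dotvZl dotvZr Sy mulr1 -expr2 sqrtr_sqr gtr0_norm//.
  by rewrite !tnth_mktuple mulKf// gt_eqF.
exists (enorm u), (normalize u).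
- split; last by split => //; exact: normalize_sphere.
  rewrite enorm_gt0 u0/= -(ler_pXn2r (ltn0Sn 1)) ?nnegrE ?sqrtr_ge0//.
  by rewrite enorm_sqr expr1n.
- by apply: eq_from_tnth => i; rewrite !tnth_mktuple mulVKf// gt_eqF// enorm_gt0.
Qed.

(** The cone over the whole sphere: the cone parameter is positive, so the origin is left out, and
    [normalize] sends every remaining point to the sphere. *)
Definition punctured_ball n : set (n.-tuple R) := [set u | 0 < dotv u u <= 1].

Lemma measurable_punctured_ball n : measurable (@punctured_ball n).
Proof.
rewrite (_ : @punctured_ball n = (fun u : n.-tuple R => dotv u u) @^-1` `]0, 1]%classic).
  by rewrite -[X in measurable X]setTI; apply: measurable_dotv.
by apply/seteqP; split => u /=; rewrite in_itv.
Qed.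

Section Law.
Context d0 (Om : measurableType d0) (P : probability Om R) (n : nat)
  (rho : n.-tuple R -> R) (X : Om -> n.-tuple R).
Hypothesis C2 : C2_on_sphere rho.
Hypothesis rho_ge0 : forall u, sphere n u -> 0 <= rho u.
Hypothesis rho1 : sphere_int rho (sphere n) = 1%E.
Hypothesis mX : measurable_fun setT X.
Hypothesis lawX : has_sphere_law P rho X.

(** The extension of [rho] that is constant along rays. Times [n], it is the density on the ball
    whose image under [normalize] is the law of [X]. *)
Definition ball_density (u : n.-tuple R) : R := \1_(@punctured_ball n) u * rho (normalize u).

Lemma ball_density_ge0 u : 0 <= ball_density u.
Proof.
rewrite /ball_density indicE; case: (boolP (u \in _)) => [|_]; last by rewrite mul0r.
by rewrite inE => /andP[u0 _]; rewrite mul1r rho_ge0//; exact: normalize_sphere.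
Qed.

Lemma measurable_ball_density : measurable_fun setT ball_density.
Proof.
have [g [gE cg]] := C2_on_sphere_cont C2.
have mg : measurable_fun (sphere n) g := measurable_cont_at (@measurable_sphere n) cg.
(* [rho] is controlled on the sphere only, so it is replaced by the extension [g], set to 0
   elsewhere. *)
rewrite (_ : ball_density = (fun u => \1_(@punctured_ball n) u * (g \_ (sphere n)) (normalize u))).
  apply: measurable_funM; first exact: (measurable_indic (@measurable_punctured_ball n)).
  apply: measurableT_comp; last exact: measurable_normalize.
  by apply/(measurable_restrictT _ _).1 => //; exact: measurable_sphere.
apply/funext => u; rewrite /ball_density indicE; case: (boolP (u \in _)) => [|_]; last by rewrite !mul0r.
rewrite inE => /andP[u0 _]; rewrite patchE mem_set ?gE//; exact: normalize_sphere.
Qed.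

Lemma sphere_law_as : P (X @^-1` sphere n) = 1%E.
Proof. by rewrite lawX// ?rho1//; exact: measurable_sphere. Qed.

Lemma sphere_law_indic A : measurable A ->
  P (X @^-1` A) = (\int[lam n]_u (\1_A (normalize u) * (n%:R * ball_density u))%:E)%E.
Proof.
move=> mA.
have mS := @measurable_sphere n.
(* The law is prescribed on subsets of the sphere; since the sphere has full probability, [A] may be
   cut down to it. *)
have -> : P (X @^-1` A) = P (X @^-1` (A `&` sphere n)).
  have mXA B : measurable B -> measurable (X @^-1` B).
    by move=> mB; rewrite -[X in measurable X]setTI; exact: mX.
  rewrite (measureDI P (mXA _ mA) (mXA _ mS)) preimage_setI.
  rewrite -[RHS]add0e; congr (_ + _)%E; apply/eqP; rewrite eq_le measure_ge0 andbT.
  rewrite (@le_trans _ _ (P (~` (X @^-1` sphere n))))//.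
    apply: (le_measure P); rewrite ?inE; [by apply: measurableD; exact: mXA|by apply: measurableC; exact: mXA|].
    by move=> w [].
  by rewrite probability_setC ?sphere_law_as ?subee//; exact: mXA.
rewrite lawX//; last exact: measurableI.
have mI : measurable_fun setT (fun u => \1_A (normalize u) * ball_density u).
  apply: measurable_funM; last exact: measurable_ball_density.
  exact: (measurableT_comp (measurable_indic mA) (@measurable_normalize n)).
have E u : \1_(cone (A `&` sphere n)) u * rho (normalize u) = \1_A (normalize u) * ball_density u.
  rewrite /ball_density mulrA -[RHS]/(_ * _ * _); congr (_ * _).
  rewrite !indicE -natrM mulnb; congr (_%:R); congr nat_of_bool.
  apply/idP/andP; rewrite !inE; first by move=> /cone_sphereE[].
  by move=> [Au Bu]; apply/cone_sphereE.
rewrite /sphere_int; under eq_fun do rewrite E.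
rewrite -lamE; last 2 first.
- exact/measurable_EFinP.
- by move=> u; rewrite lee_fin mulr_ge0// ball_density_ge0.
rewrite -ge0_integralZl//.
- by apply: eq_integral => u _; rewrite -EFinM mulrCA.
- exact/measurable_EFinP.
- by move=> u _; rewrite lee_fin mulr_ge0// ball_density_ge0.
Qed.

Lemma sphere_law_integral F : measurable_fun setT F -> (forall u, 0 <= F u)%E ->
  (\int[P]_w F (X w) = \int[lam n]_u (F (normalize u) * (n%:R * ball_density u)%:E))%E.
Proof.
move=> mF F0.
transitivity (\int[P]_w (F (X w) * (1 : R)%:E))%E.
  by apply: eq_integral => w _; rewrite mule1.
apply: integral_transfer => //.
- exact: measurable_normalize.
- by apply: measurable_funM => //; exact: measurable_ball_density.
- by move=> u; rewrite mulr_ge0// ball_density_ge0.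
move=> A mA; under eq_integral do rewrite mule1.
rewrite (_ : (fun w => _) = (fun w => (\1_(X @^-1` A) w)%:E))//.
rewrite integral_indic//; last by rewrite -[X in measurable X]setTI; exact: mX.
rewrite setIT; etransitivity; first exact: sphere_law_indic.
by under eq_integral do rewrite EFinM.
Qed.

End Law.

End SphereLaw.

(** * Averaging over rotations and the gnomonic chart *)

Section Averaging.
Context {R : realType} {n : nat} (q : n.-tuple R) (nu : probability (n.-tuple R) R).
Hypothesis Sq : sphere n q.
Hypothesis nuq : uniform_tsphere q nu.

Lemma measurable_tsphere : measurable (tsphere q).
Proof.
rewrite (_ : tsphere q = (fun u => dotv u q) @^-1` [set 0] `&` sphere n)//.
apply: measurableI; last exact: measurable_sphere.
by rewrite -[X in measurable X]setTI; apply: measurable_dotv.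
Qed.

Lemma integral_tsphere_eq (f g : n.-tuple R -> \bar R) :
  measurable_fun setT f -> measurable_fun setT g ->
  (forall th, tsphere q th -> f th = g th) ->
  (\int[nu]_th f th = \int[nu]_th g th)%E.
Proof.
move=> mf mg fg; apply: ae_eq_integral => //.
exists (~` tsphere q); split.
- by apply: measurableC; exact: measurable_tsphere.
- have [nu1 _] := nuq.
  apply: (etrans (probability_setC nu measurable_tsphere)).
  by rewrite nu1 subee.
- by move=> th /= H Hth; apply: H => _; exact: fg.
Qed.

Lemma integral_uniform_reflection p F : dotv q p = 0 ->
  measurable_fun setT F -> (forall th, 0 <= F th)%E ->
  (\int[nu]_th F (reflection p th) = \int[nu]_th F th)%E.
Proof.
move=> qp mF F0.
transitivity (\int[nu]_th (F (reflection p th) * (1 : R)%:E))%E.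
  by apply: eq_integral => th _; rewrite mule1.
transitivity (\int[nu]_th (F th * (1 : R)%:E))%E; last first.
  by apply: eq_integral => th _; rewrite mule1.
have mQ : measurable_fun setT (reflection p) := measurable_reflection p.
apply: integral_transfer => // A mA.
under eq_integral do rewrite mule1.
under [RHS]eq_integral do rewrite mule1.
rewrite (_ : (fun th => _) = (fun th => (\1_(reflection p @^-1` A) th)%:E))//.
have mQA : measurable (reflection p @^-1` A) by rewrite -[X in measurable X]setTI; exact: mQ.
rewrite !integral_indic// !setIT.
have [_ inv] := nuq; apply: inv => //.
- by move=> u v; rewrite dotv_reflection.
- exact: reflection_fix.
Qed.

Definition perp u : n.-tuple R := tsub u (tscale (dotv q u) q).

Lemma dotv_perp_q u : dotv (perp u) q = 0.
Proof. by rewrite /perp dotvBl dotvZl Sq (dotvC q) mulr1 subrr. Qed.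

Lemma dotv_perp_tsphere u th : dotv th q = 0 -> dotv (perp u) th = dotv u th.
Proof. by move=> thq; rewrite /perp dotvBl dotvZl (dotvC q th) thq mulr0 subr0. Qed.

Lemma dotv_perp u : dotv (perp u) (perp u) = dotv u u - dotv q u ^+ 2.
Proof. by rewrite {2}/perp dotvBr dotvZr dotv_perp_q mulr0 subr0 /perp dotvBl dotvZl expr2. Qed.

Let measurable_triple d (T : measurableType d) (f g h : T -> R) :
  measurable_fun setT f -> measurable_fun setT g -> measurable_fun setT h ->
  measurable_fun setT (fun z => (f z, g z, h z)).
Proof.
move=> mf mg mh; apply/measurable_fun_pairP; split => //=.
by apply/measurable_fun_pairP; split.
Qed.

Variable a : n.-tuple R.

(** Against [th] orthogonal to [q] only the perpendicular parts count. The vectors [|u_perp| a_perp]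
    and [|a_perp| u_perp] have the same length, hence are exchanged by a reflection; it fixes [q],
    so it leaves [nu] invariant. *)
Let nu_rotate (k : R -> \bar R) u : measurable_fun setT k -> (forall s, 0 <= k s)%E ->
  (\int[nu]_th k (enorm (perp a) * dotv u th)%R =
   \int[nu]_th k (enorm (perp u) * dotv th a)%R)%E.
Proof.
move=> mk k0.
pose p := tsub (tscale (enorm (perp u)) (perp a)) (tscale (enorm (perp a)) (perp u)).
have qp : dotv q p = 0 by rewrite dotvC /p dotvBl !dotvZl !dotv_perp_q !mulr0 subrr.
have mkd (c : R) v : measurable_fun setT (fun th : n.-tuple R => k (c * dotv th v)).
  by apply: (measurableT_comp mk); apply: measurable_funM => //; exact: measurable_dotv.
transitivity (\int[nu]_th k (enorm (perp u) * dotv (reflection p th) (perp a))%R)%E.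
  apply: integral_tsphere_eq.
  - by under eq_fun do rewrite dotvC; exact: mkd.
  - by have := measurableT_comp (mkd (enorm (perp u)) (perp a)) (measurable_reflection p).
  have E : reflection p (tscale (enorm (perp u)) (perp a)) = tscale (enorm (perp a)) (perp u).
    by apply: reflection_swap; rewrite !dotvZl !dotvZr !mulrA -!expr2 !enorm_sqr mulrC.
  move=> th [thq _]; congr k; rewrite reflection_adj -[RHS]dotvZr -reflectionZ E dotvZr.
  by rewrite [dotv th _]dotvC dotv_perp_tsphere.
rewrite (integral_uniform_reflection (F := fun th => k (enorm (perp u) * dotv th (perp a))%R)%E)//.
apply: integral_tsphere_eq => // th [thq _].
by rewrite [dotv th (perp a)]dotvC dotv_perp_tsphere// dotvC.
Qed.

(* The average over the rotations fixing [q] is realised by reflections, so no Haar measure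
   on the orthogonal group is needed. *)
Lemma lam_average (K : R * R * R -> \bar R) :
  measurable_fun setT K -> (forall z, 0 <= K z)%E ->
  (\int[lam n]_u K (dotv u u, dotv q u, dotv u a) =
   \int[lam n]_u \int[nu]_th K (dotv u u, dotv q u,
      (dotv q a * dotv q u + enorm (perp u) * dotv th a)%R))%E.
Proof.
move=> mK K0.
set L := LHS.
pose J u th := K (dotv u u, dotv q u, (dotv q a * dotv q u + enorm (perp a) * dotv u th)%R).
have mJ : measurable_fun setT (fun z : n.-tuple R * n.-tuple R => J z.1 z.2).
  apply: (measurableT_comp mK); apply: measurable_triple.
  - exact: measurable_dotv.
  - exact: measurable_dotv.
  - apply: measurable_funD; apply: measurable_funM => //; exact: measurable_dotv.
have mf : measurable_fun setT (fun u : n.-tuple R => K (dotv u u, dotv q u, dotv u a)).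
  by apply: (measurableT_comp mK); apply: measurable_triple; exact: measurable_dotv.
(* The reflection exchanging [|a_perp| th] with [a_perp] fixes [q]. Applied to [u] it keeps the
   first two scalars and turns [<u,a>] into the scalar product of [u] with
   [<q,a> q + |a_perp| th]. *)
have LJ th : tsphere q th -> (L = \int[lam n]_u J u th)%E.
  move=> [thq thth].
  pose p := tsub (tscale (enorm (perp a)) th) (perp a).
  have qp : dotv q p = 0 by rewrite dotvC /p dotvBl !dotvZl thq dotv_perp_q !mulr0 subrr.
  rewrite /L -(lam_reflection p mf)//; apply: eq_integral => u _.
  rewrite dotv_reflection (dotvC q (reflection p u)) !reflection_adj reflection_fix// (dotvC u q).
  congr (K (_, _, _)).
  have aE : a = tadd (tscale (dotv q a) q) (perp a).
    by apply: eq_from_tnth => i; rewrite !tnth_mktuple addrC subrK.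
  have E : reflection p (perp a) = tscale (enorm (perp a)) th.
    rewrite -[RHS](reflectionK p) reflection_swap//.
    by rewrite !dotvZl !dotvZr thth mulr1 -expr2 enorm_sqr.
  rewrite {1}aE reflectionD reflectionZ (reflection_fix qp) E.
  by rewrite dotvC dotvDl !dotvZl (dotvC th).
(* [L] does not depend on [th], so it equals its [nu]-average; then the order of integration is
   exchanged. *)
transitivity (\int[nu]_th L)%E.
  apply: etrans (esym (integral_cst nu measurableT L)).
  by apply: etrans (esym (mule1 L)) _; congr (_ * _)%E; exact: esym (probability_setT nu).
have mJ2 : measurable_fun setT (fun th => \int[lam n]_u J u th)%E.
  exact: (measurable_fun_fubini_tonelli_G _ mJ (fun=> K0 _)).
rewrite (integral_tsphere_eq (measurable_cst L) mJ2 LJ).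
rewrite -(fubini_tonelli _ mJ (fun=> K0 _)).
apply: eq_integral => u _ /=.
rewrite (nu_rotate (k := fun s => K (dotv u u, dotv q u, dotv q a * dotv q u + s)))//.
apply: (measurableT_comp mK); apply: measurable_triple => //.
exact: measurable_funD.
Qed.

End Averaging.

Section Chart.
Context {R : realType}.
Local Notation leb := (@lebesgue_measure R).

Lemma measurable_triple d (T : measurableType d) (f g h : T -> R) :
  measurable_fun setT f -> measurable_fun setT g -> measurable_fun setT h ->
  measurable_fun setT (fun z => (f z, g z, h z)).
Proof.
move=> mf mg mh; apply/measurable_fun_pairP; split => //=.
by apply/measurable_fun_pairP; split.
Qed.

Lemma integral_primitive (f F : R -> R) a b : a < b ->
  (forall t : R, a <= t <= b -> is_derive t 1 F (f t)) ->
  (forall t : R, a <= t <= b -> {for t, continuous f}) ->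
  (\int[leb]_(t in `[a, b]) (f t)%:E = (F b - F a)%:E)%E.
Proof.
move=> ab dF cf.
have cF (t : R) : a <= t <= b -> F x @[x --> t] --> F t.
  move=> /dF dFt; apply: differentiable_continuous.
  by apply/derivable1_diffP; exact: ex_derive.
rewrite (@continuous_FTC2 _ f F)//.
- by apply: continuous_in_subspaceT => t; rewrite inE/= in_itv/= => /cf.
- split.
  + by move=> t; rewrite in_itv/= => /andP[ta tb]; apply: (ex_derive (is_derive := dF t _)); rewrite !ltW.
  + by apply: cvg_at_right_filter; apply: cF; rewrite lexx ltW.
  + by apply: cvg_at_left_filter; apply: cF; rewrite lexx ltW.
- move=> t; rewrite in_itv/= => /andP[ta tb]; rewrite derive1E.
  by apply: (derive_val (is_derive := dF t _)); rewrite !ltW.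
Qed.

Lemma integral_powX m (a : R) : 0 < a ->
  (\int[leb]_(t in `[0%R, a]) ((t ^+ m)%:E) = (a ^+ m.+1 / m.+1%:R)%:E)%E.
Proof.
move=> a0.
have dF (t : R) : is_derive t 1 (fun t => t ^+ m.+1 / m.+1%:R) (t ^+ m).
  apply: DeriveDef; first by apply: derivableM => //; exact: exprn_derivable.
  rewrite -derive1E derive1Mr; last exact: exprn_derivable.
  rewrite derive1E exp_derive /= /GRing.scale/= mulr1 mulrAC divff ?mul1r//.
apply: etrans (integral_primitive (F := fun t => t ^+ m.+1 / m.+1%:R) a0 (fun t _ => dF t) _) _.
  by move=> t _; exact: exprn_continuous.
by rewrite expr0n/= mul0r subr0.
Qed.

Lemma integral_powX1 m (a : R) : 0 < a ->
  (\int[leb]_t ((if 0 < t <= a then t ^+ m else 0)%:E) = (a ^+ m.+1 / m.+1%:R)%:E)%E.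
Proof.
move=> a0; rewrite -(integral_powX m a0) -integral_itv_obnd_cbnd; last first.
  apply/measurable_funTS/measurable_EFinP; exact: exprn_measurable.
rewrite [RHS]integral_mkcond; apply: eq_integral => t _.
rewrite patchE; case: ifPn => [ht|ht].
  by rewrite mem_set//= in_itv.
by rewrite memNset//= in_itv/=; exact/negP.
Qed.

Lemma measurable_tnth0_dotv m : measurable_fun setT
  (fun u : m.+1.-tuple R => (dotv u u, tnth u ord0)).
Proof.
apply/measurable_fun_pairP; split => //=; first exact: measurable_dotv.
exact: measurable_tnth.
Qed.

(* The substitution [u = (t, t v)] for [t > 0]. *)
Lemma lam_chart m (K : R * R -> \bar R) :
  measurable_fun setT K -> (forall z, 0 <= K z)%E ->
  (forall r t, t <= 0 -> K (r, t) = 0%E) ->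
  (\int[lam m.+1]_u K (dotv u u, tnth u ord0) =
   \int[lam m]_v \int[leb]_t ((if 0 < t then t ^+ m else 0)%:E *
     K (t ^+ 2 * (1 + dotv v v), t)%R))%E.
Proof.
move=> mK K0 KN.
have mKr (g : measurableTypeR R * m.-tuple R -> R) : measurable_fun setT g ->
    measurable_fun setT (fun z => K (g z, z.1)).
  move=> mg; apply: (measurableT_comp mK).
  apply/measurable_fun_pairP; split => /=; first exact: mg.
  exact: (@measurable_fst _ _ (measurableTypeR R)).
have mdot : measurable_fun setT (fun z : measurableTypeR R * m.-tuple R => dotv z.2 z.2).
  exact: measurable_dotv.
have mw : measurable_fun setT (fun t : measurableTypeR R => (if 0 < t then t ^+ m else 0)%:E : \bar R).
  apply/measurable_EFinP; apply: measurable_fun_ifT => //.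
  exact: measurable_fun_ltr.
have mG : measurable_fun setT (fun z : measurableTypeR R * m.-tuple R =>
    ((if 0 < z.1 then z.1 ^+ m else 0)%:E * K (z.1 ^+ 2 * (1 + dotv z.2 z.2), z.1)%R)%E).
  apply: emeasurable_funM; first exact: (measurableT_comp mw).
  apply: mKr; apply: measurable_funM; last exact: measurable_funD.
  by apply: (@measurable_funX _ _ R); exact: (@measurable_fst _ _ (measurableTypeR R)).
have w0 (t : R) : (0 <= (if 0 < t then t ^+ m else 0)%:E)%E.
  by rewrite lee_fin; case: ifPn => // t0; rewrite exprn_ge0// ltW.
rewrite -(fubini_tonelli _ mG); last by move=> z; exact: mule_ge0.
have mK' : measurable_fun setT (fun u : m.+1.-tuple R => K (dotv u u, tnth u ord0)).
  exact: (measurableT_comp mK (@measurable_tnth0_dotv m)).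
rewrite (lamS mK' (fun=> K0 _)); apply: eq_integral => t _ /=.
have mKt : measurable_fun setT (fun v : m.-tuple R => K (t * t + dotv v v, t)).
  apply: (measurableT_comp mK); apply: measurable_fun_pair; last exact: measurable_cst.
  by apply: measurable_funD => //; exact: measurable_dotv.
have [t0|t0] := ltP 0 t; last first.
  under eq_integral do rewrite KN//.
  under [RHS]eq_integral do rewrite mul0e.
  by rewrite !integral0.
transitivity (\int[lam m]_v K (t * t + dotv v v, t)%R)%E.
  by apply: eq_integral => v _; rewrite dotv_cons tnth0.
rewrite (lam_scale t0 mKt (fun=> K0 _)) -ge0_integralZl//; last 2 first.
- apply: (measurableT_comp mKt); exact: measurable_tscale.
- by rewrite lee_fin exprn_ge0// ltW.
apply: eq_integral => v _; congr (_ * K (_, _))%E.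
by rewrite dotvZl dotvZr; ring.
Qed.

End Chart.

Section SphereChart.
Context {R : realType} {m : nat} (q : m.+1.-tuple R) (nu : probability (m.+1.-tuple R) R).
Hypothesis Sq : sphere m.+1 q.
Hypothesis nuq : uniform_tsphere q nu.

(** The reflection exchanging [q] with the first basis vector [e] turns the axis [q] into the
    coordinate that [lam_chart] singles out. *)
Lemma lam_axis (G : R * R -> \bar R) : measurable_fun setT G -> (forall z, 0 <= G z)%E ->
  (\int[lam m.+1]_u G (dotv u u, dotv q u) =
   \int[lam m.+1]_u G (dotv u u, tnth u ord0))%E.
Proof.
move=> mG G0.
pose e : m.+1.-tuple R := cons_tuple 1 (tzero m).
have eE u : dotv e u = tnth u ord0.
  rewrite /dotv big_ord_recl tnth0 mul1r big1 ?addr0// => i _.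
  by rewrite tnthS tnth_mktuple mul0r.
have ee : dotv q q = dotv e e by rewrite eE tnth0 Sq.
have mGe : measurable_fun setT (fun u : m.+1.-tuple R => G (dotv u u, tnth u ord0)).
  exact: (measurableT_comp mG (@measurable_tnth0_dotv R m)).
rewrite -(lam_reflection (tsub q e) mGe)//; apply: eq_integral => u _.
by rewrite dotv_reflection -eE [dotv e _]dotvC reflection_adj -{2}(reflection_swap ee) reflectionK dotvC.
Qed.

(** The cosine of the angle between the axis and the direction [(1, v)]. *)
Definition gnomonic_cos (v : m.-tuple R) : R := (Num.sqrt (1 + dotv v v))^-1.

Lemma gnomonic_cos_gt0 v : 0 < gnomonic_cos v.
Proof. by rewrite invr_gt0 sqrtr_gt0 ltr_wpDr// dotv_ge0. Qed.

Lemma measurable_gnomonic_cos : measurable_fun setT gnomonic_cos.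
Proof.
apply: measurable_inv_ge0; first by move=> v; exact: sqrtr_ge0.
have ms : measurable_fun setT (Num.sqrt : R -> R).
  by apply: continuous_measurable_fun; exact: sqrt_continuous.
apply: (measurableT_comp ms); apply: measurable_funD => //; exact: measurable_dotv.
Qed.

Variable a : m.+1.-tuple R.

(** Write [s = gnomonic_cos v]. The point [(t, t v)] has norm [t / s], so the ball condition is
    [t <= s], and the weight [(m+1) t^m] integrates to the Jacobian [s^{m+1}] of the gnomonic
    projection. The vanishing of [Psi] for [t <= 0] confines the integral to the open hemisphere
    that the chart covers. *)
Lemma sphere_chart (Psi : R * R -> \bar R) :
  measurable_fun setT Psi -> (forall z, 0 <= Psi z)%E ->
  (forall t b, t <= 0 -> Psi (t, b) = 0%E) ->
  (\int[lam m.+1]_u ((m.+1%:R * \1_(@punctured_ball R m.+1) u)%:E *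
     Psi (dotv q (normalize u), dotv (normalize u) a)) =
   \int[lam m]_v ((gnomonic_cos v ^+ m.+1)%:E *
     \int[nu]_th Psi (gnomonic_cos v, dotv q a * gnomonic_cos v +
        Num.sqrt (1 - gnomonic_cos v ^+ 2) * dotv th a)%R))%E.
Proof.
move=> mPsi Psi0 PsiN.
(* The integrand depends on [u] only through [|u|^2], [<q,u>] and [<u,a>], the form that
   [lam_average] requires; [w] encodes the ball and [i] the division by [|u|]. *)
pose w (r : R) : R := if 0 < r <= 1 then m.+1%:R else 0.
pose i (r : R) : R := (Num.sqrt r)^-1.
pose K (z : R * R * R) : \bar R := ((w z.1.1)%:E * Psi (i z.1.1 * z.1.2, i z.1.1 * z.2)%R)%E.
have ms : measurable_fun setT (Num.sqrt : R -> R).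
  by apply: continuous_measurable_fun; exact: sqrt_continuous.
have mi : measurable_fun setT i.
  by apply: measurable_inv_ge0 => // r; exact: sqrtr_ge0.
have mw : measurable_fun setT w.
  apply: measurable_fun_ifT => //; apply: measurable_and; [exact: measurable_fun_ltr|exact: measurable_fun_ler].
have w0 r : 0 <= w r by rewrite /w; case: ifP.
have mK : measurable_fun setT K.
  have m1 : measurable_fun setT (fun z : R * R * R => z.1.1).
    exact: (measurableT_comp measurable_fst measurable_fst).
  have m2 : measurable_fun setT (fun z : R * R * R => z.1.2).
    exact: (measurableT_comp measurable_snd measurable_fst).
  apply: emeasurable_funM; first by apply/measurable_EFinP; exact: (measurableT_comp mw m1).
  apply: (measurableT_comp mPsi); apply: measurable_fun_pair.
    by apply: measurable_funM => //; exact: (measurableT_comp mi m1).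
  by apply: measurable_funM => //; exact: (measurableT_comp mi m1).
have K0 z : (0 <= K z)%E by rewrite mule_ge0// lee_fin.
transitivity (\int[lam m.+1]_u K (dotv u u, dotv q u, dotv u a))%E.
  apply: eq_integral => u _; rewrite /K /= /normalize dotvZl dotvZr; congr (_%:E * _)%E.
  rewrite /w indicE; case: ifPn => h; first by rewrite mem_set// mulr1.
  by rewrite memNset ?mulr0//; exact/negP.
rewrite (lam_average Sq nuq a mK K0).
pose G (z : R * R) : \bar R :=
  (\int[nu]_th K (z.1, z.2, dotv q a * z.2 + Num.sqrt (z.1 - z.2 ^+ 2) * dotv th a)%R)%E.
have G0 z : (0 <= G z)%E by exact: integral_ge0.
have mG : measurable_fun setT G.
  apply: (measurable_fun_fubini_tonelli_F (m2 := nu) (fun y : (R * R) * m.+1.-tuple R =>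
    K (y.1.1, y.1.2, dotv q a * y.1.2 + Num.sqrt (y.1.1 - y.1.2 ^+ 2) * dotv y.2 a)%R)) => //.
  have m1 : measurable_fun setT (fun z : (R * R) * m.+1.-tuple R => z.1.1).
    exact: (measurableT_comp measurable_fst measurable_fst).
  have m2 : measurable_fun setT (fun z : (R * R) * m.+1.-tuple R => z.1.2).
    exact: (measurableT_comp measurable_snd measurable_fst).
  apply: (measurableT_comp mK); apply: measurable_triple => //.
  apply: measurable_funD; first exact: measurable_funM.
  apply: measurable_funM; last exact: measurable_dotv.
  apply: (measurableT_comp ms); apply: measurable_funB => //; exact: measurable_funX.
transitivity (\int[lam m.+1]_u G (dotv u u, dotv q u))%E.
  apply: eq_integral => u _; rewrite /G /=; apply: eq_integral => th _.
  by rewrite /enorm dotv_perp.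
rewrite (lam_axis mG G0) (@lam_chart R m G mG G0); last first.
  move=> r t t0; rewrite /G /=; apply: integral0_eq => th _; rewrite /K/= PsiN ?mule0//.
  by rewrite mulr_ge0_le0// invr_ge0 sqrtr_ge0.
apply: eq_integral => v _.
set s := gnomonic_cos v.
have s0 : 0 < s := gnomonic_cos_gt0 v.
have sE : 1 + dotv v v = (s ^+ 2)^-1.
  by rewrite /s /gnomonic_cos exprVn invrK sqr_sqrtr// addr_ge0// dotv_ge0.
have s1 : s <= 1.
  by rewrite /s /gnomonic_cos invf_le1 ?sqrtr_gt0 ?ltr_wpDr ?dotv_ge0// -{1}sqrtr1 ler_wsqrtr// lerDl dotv_ge0.
set c := (\int[nu]_th _)%E.
have mPc : measurable_fun setT (fun th : m.+1.-tuple R =>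
    Psi (s, dotv q a * s + Num.sqrt (1 - s ^+ 2) * dotv th a)).
  apply: (measurableT_comp mPsi); apply: measurable_fun_pair; first exact: measurable_cst.
  by apply: measurable_funD => //; apply: measurable_funM => //; exact: measurable_dotv.
have c0 : (0 <= c)%E by apply: integral_ge0.
transitivity (\int[@lebesgue_measure R]_t ((if (0 < t <= s)%R then t ^+ m else 0)%:E * (m.+1%:R%:E * c)))%E.
  apply: eq_integral => t _; have [t0|t0] /= := ltP 0 t; last by rewrite !mul0e.
  rewrite sE /G /K /=.
  have iE : i (t ^+ 2 * (s ^+ 2)^-1) = s / t.
    have ts0 : 0 <= t / s by rewrite divr_ge0 ?(ltW t0) ?(ltW s0).
    by rewrite /i -exprVn -exprMn sqrtr_sqr ger0_norm// invf_div.
  have wE : w (t ^+ 2 * (s ^+ 2)^-1) = if t <= s then m.+1%:R else 0.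
    rewrite /w mulr_gt0 ?invr_gt0 ?exprn_gt0//= ler_pdivrMr ?exprn_gt0// mul1r.
    by rewrite ler_pXn2r// nnegrE ltW.
  rewrite iE wE; case: ifPn => ts; last first.
    by rewrite !mul0e integral0_eq ?mule0// => th _; rewrite mul0e.
  rewrite ge0_integralZl//; last first.
    apply: (measurableT_comp mPsi); apply: measurable_fun_pair; first exact: measurable_cst.
    apply: measurable_funM => //.
    by apply: measurable_funD => //; apply: measurable_funM => //; exact: measurable_dotv.
  congr (_ * (_ * _))%E; apply: eq_integral => th _; congr (Psi (_, _)).
    by rewrite divfK// gt_eqF.
  rewrite mulrDr mulrCA divfK ?gt_eqF// mulrA; congr (_ + _ * _).
  rewrite -(_ : Num.sqrt ((s / t) ^+ 2) = s / t); last first.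
    by rewrite sqrtr_sqr ger0_norm// divr_ge0 ?(ltW t0) ?(ltW s0).
  rewrite -sqrtrM ?sqr_ge0//; congr Num.sqrt.
  by field; rewrite !gt_eqF.
rewrite ge0_integralZr//; last 3 first.
- apply/measurable_EFinP; apply: measurable_fun_ifT => //.
  by apply: measurable_and; [exact: measurable_fun_ltr|exact: measurable_fun_ler].
- by move=> t _; rewrite lee_fin; case: ifPn => // /andP[t0 _]; rewrite exprn_ge0// ltW.
- by rewrite mule_ge0// lee_fin.
rewrite integral_powX1// muleA -EFinM divfK//.
Qed.

End SphereChart.

(** * Polar coordinates in the variable |z|^2 / 2 *)

Section Radial.
Context {R : realType}.
Local Notation leb := (@lebesgue_measure R).

(** For [p < 1], in particular [p = 1/2] when [d = 2], the integrand is unbounded at 0. The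
    fundamental theorem is applied on [[b/(k+2), b]], and these intervals increase to []0, b]]. *)
Lemma integral_powR (p b : R) : 0 < p -> 0 < b ->
  (\int[leb]_(y in `]0%R, b]) (y `^ (p - 1))%:E = (b `^ p / p)%:E)%E.
Proof.
move=> p0 b0.
pose E (k : nat) := `[b / k.+2%:R, b]%classic.
have bk k : b / k.+2%:R < b by rewrite ltr_pdivrMr// ltr_pMr// ltr1n.
have bk0 k : 0 < b / k.+2%:R by rewrite divr_gt0.
have mf (D : set R) : measurable_fun D (fun y => (y `^ (p - 1))%:E).
  by apply/measurable_funTS/measurable_EFinP; exact: measurable_powR.
have I k : (\int[leb]_(y in E k) (y `^ (p - 1))%:E =
    ((b `^ p - (b / k.+2%:R) `^ p) / p)%:E)%E.
  apply: etrans (integral_primitive (F := fun y => y `^ p / p) (bk k) _ _) _.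
  - move=> t /andP[t0 _].
    have {}t0 : 0 < t by exact: lt_le_trans t0.
    apply: DeriveDef.
      by apply: derivableM => //; apply: derivable_powR; rewrite in_itv/= t0.
    rewrite -derive1E derive1Mr; last by apply: derivable_powR; rewrite in_itv/= t0.
    by rewrite powR_derive1 ?in_itv/= ?t0// mulrAC divff ?mul1r// gt_eqF.
  - move=> t /andP[t0 _].
    have {}t0 : 0 < t by exact: lt_le_trans t0.
    apply: differentiable_continuous; apply/derivable1_diffP.
    by apply: derivable_powR; rewrite in_itv/= t0.
  by rewrite -mulrBl.
have mE k : measurable (E k) by exact: measurable_itv.
have U : `]0, b]%classic = \bigcup_k E k.
  apply/seteqP; split => y /=.
    rewrite in_itv/= => /andP[y0 yb].
    have [k hk] : exists k : nat, b / y < k%:R.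
      by exists (Num.bound (b / y)); rewrite archi_boundP// divr_ge0// ltW.
    exists k => //; rewrite /E/= in_itv/= yb andbT ler_pdivrMr// mulrC -ler_pdivrMr//.
    by rewrite (le_trans (ltW hk))// ler_nat -addn2 leq_addr.
  by move=> [k _]; rewrite /E/= !in_itv/= => /andP[h ->]; rewrite (lt_le_trans _ h).
have nd : nondecreasing_seq E.
  move=> k l kl; apply/subsetPset => y; rewrite /E/= !in_itv/= => /andP[h ->]; rewrite andbT.
  by rewrite (le_trans _ h)// ler_pM2l// lef_pV2 ?posrE// ler_nat !ltnS.
rewrite U.
have : (\int[leb]_(y in E k) (y `^ (p - 1))%:E @[k --> \oo] --> \int[leb]_(y in \bigcup_k E k) (y `^ (p - 1))%:E)%E.
  apply: ge0_nondecreasing_set_cvg_integral => //.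
  - by move=> k; exact: mf.
  - by move=> k y _; rewrite lee_fin powR_ge0.
move=> /(cvg_unique (@ereal_hausdorff R)); apply.
have -> : (fun k => \int[leb]_(y in E k) (y `^ (p - 1))%:E)%E =
  (fun k => ((b `^ p - (b / k.+2%:R) `^ p) / p)%:E) by apply/funext => k; exact: I.
apply: cvg_EFin; first exact: nearW.
rewrite -[X in _ --> X](_ : (b `^ p - 0) / p = _); last by rewrite subr0.
apply: cvgMr_tmp; apply: cvgB; first exact: cvg_cst.
apply/cvgrPdist_lt => e e0; near=> k.
rewrite sub0r normrN ger0_norm ?powR_ge0//.
have -> : e = (e `^ p^-1) `^ p by rewrite -powRrM mulVf ?gt_eqF// powRr1// ltW.
rewrite gt0_ltr_powR ?nnegrE ?powR_ge0 ?(ltW (bk0 _))//.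
rewrite ltr_pdivrMr// mulrC -ltr_pdivrMr ?powR_gt0//.
apply: lt_le_trans (_ : k%:R <= _); last by rewrite ler_nat -addn2 leq_addr.
by near: k; exact: nbhs_infty_gtr.
Unshelve. all: by end_near.
Qed.

Variable m : nat.
Hypothesis m0 : (0 < m)%N.
Local Notation p := (m%:R / 2 : R).

Definition half_sqr (z : m.-tuple R) : R := dotv z z / 2.

Lemma measurable_half_sqr : measurable_fun setT half_sqr.
Proof. by apply: measurable_funM => //; exact: measurable_dotv. Qed.

Lemma measurable_half_sqr_lt b : measurable (half_sqr @^-1` `]-oo, b[).
Proof. by rewrite -[X in measurable X]setTI; exact: measurable_half_sqr. Qed.

Lemma measurable_unit_ball n : measurable (@unit_ball R n).
Proof.
rewrite (_ : @unit_ball R n = (fun u : n.-tuple R => dotv u u) @^-1` `]-oo, 1]).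
  by rewrite -[X in measurable X]setTI; apply: measurable_dotv.
by apply/seteqP; split => u /=; rewrite in_itv.
Qed.

Lemma lam_unit_ball n : lam n (@unit_ball R n) = lebn (@unit_ball R n).
Proof.
rewrite /lebn -lamE; last 2 first.
- by apply/measurable_EFinP; exact: (measurable_indic (@measurable_unit_ball n)).
- by move=> u; rewrite lee_fin.
by rewrite integral_indic ?setIT//; exact: measurable_unit_ball.
Qed.

(** On the ball [1 <= e^{1 - |u|^2}], and the Gaussian has finite integral. *)
Lemma lam_unit_ball_lty n : (lam n (@unit_ball R n) < +oo)%E.
Proof.
have mb := @measurable_unit_ball n.
rewrite -[X in lam n X]setIT -integral_indic//.
apply: (@le_lt_trans _ _ (\int[lam n]_u ((expR 1)%:E * (expR (- dotv u u))%:E))%E).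
  apply: ge0_le_integral => //.
  - by apply/measurable_EFinP; exact: measurable_indic.
  - by apply: emeasurable_funM => //; exact: measurable_expNdotv.
  - move=> u _; rewrite -EFinM -expRD lee_fin indicE; case: (boolP (u \in _)) => [|_].
      by rewrite inE /unit_ball/= -expR0 ler_expR subr_ge0.
    exact: expR_ge0.
rewrite ge0_integralZl//; last exact: measurable_expNdotv.
by rewrite lam_gauss -EFinM ltry.
Qed.

Let vol := fine (lam m (half_sqr @^-1` `]-oo, (2^-1 : R)[)).

Let volE : lam m (half_sqr @^-1` `]-oo, (2^-1 : R)[) = vol%:E.
Proof.
rewrite fineK// ge0_fin_numE//; apply: le_lt_trans (lam_unit_ball_lty m).
apply: le_measure; rewrite ?inE.
- exact: measurable_half_sqr_lt.
- exact: measurable_unit_ball.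
- by move=> u; rewrite /= in_itv/= /half_sqr /unit_ball/= -[X in _ < X]mul1r ltr_pM2r ?invr_gt0// => /ltW.
Qed.

Let half_sqr_cdf (b : R) : lam m (half_sqr @^-1` `]-oo, b[) =
  if 0 < b then ((2 * b) `^ p * vol)%:E else 0%E.
Proof.
case: ifPn => [b0|]; last first.
  rewrite -leNgt => b0; rewrite (_ : _ @^-1` _ = set0) ?measure0//.
  apply/seteqP; split => // z; rewrite /= in_itv/= ltNge => /negP; apply.
  by rewrite (le_trans b0)// /half_sqr divr_ge0// dotv_ge0.
have mb c := measurable_half_sqr_lt c.
have E c : lam m (half_sqr @^-1` `]-oo, c[) = (\int[lam m]_z (\1_(half_sqr @^-1` `]-oo, c[) z)%:E)%E.
  by rewrite integral_indic ?setIT.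
have s0 : 0 < Num.sqrt (2 * b) by rewrite sqrtr_gt0 mulr_gt0.
rewrite E (lam_scale s0); last 2 first.
- by apply/measurable_EFinP; exact: measurable_indic.
- by move=> z; rewrite lee_fin.
rewrite EFinM -volE E; congr (_ * _)%E.
  have b2 : 0 <= 2 * b by rewrite mulr_ge0// ltW.
  by congr (_%:E); rewrite -powR_mulrn ?sqrtr_ge0// -powR12_sqrt// -powRrM [_ * m%:R]mulrC.
apply: eq_integral => z _; rewrite !indicE; congr ((nat_of_bool _)%:R%:E).
have e2 : half_sqr (tscale (Num.sqrt (2 * b)) z) = 2 * b * half_sqr z.
  by rewrite /half_sqr dotvZl dotvZr mulrA -expr2 sqr_sqrtr ?mulr_ge0 ?(ltW b0)// mulrA.
have e3 (x : R) : (2 * b * x < b) = (x < 2^-1).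
  by rewrite mulrAC -[X in _ < X]mul1r (ltr_pM2r b0) mulrC -ltr_pdivlMr// div1r.
by apply/idP/idP; rewrite !inE/= !in_itv/= e2 e3.
Qed.

(** The derivative in [b] of [(2b)^p vol], the volume of the set where [|z|^2 / 2 < b]. *)
Let weight (y : R) : R := (if 0 < y then 2 `^ p * vol * p * y `^ (p - 1) else 0).

Let weight_ge0 y : 0 <= weight y.
Proof.
by rewrite /weight; case: ifP => // _; rewrite !mulr_ge0 ?powR_ge0// fine_ge0.
Qed.

Let measurable_weight : measurable_fun setT weight.
Proof.
apply: measurable_fun_ifT => //; first exact: measurable_fun_ltr.
by apply: measurable_funM => //; exact: measurable_powR.
Qed.

Let weighted (A : set (measurableTypeR R)) : \bar R := (\int[leb]_(y in A) (weight y)%:E)%E.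
Let weighted0 : weighted set0 = 0%E. Proof. exact: integral_set0. Qed.
Let weighted_ge0 A : (0 <= weighted A)%E.
Proof. by apply: integral_ge0 => y _; rewrite lee_fin. Qed.
Let weighted_sigma : semi_sigma_additive weighted.
Proof.
apply: semi_sigma_additive_nng_induced; first exact/measurable_EFinP.
by move=> y; rewrite lee_fin.
Qed.
HB.instance Definition _ := isMeasure.Build _ _ _ weighted weighted0 weighted_ge0 weighted_sigma.

Let weighted_cdf (b : R) c : weighted [set` Interval -oo%O (BSide c b)] =
  if 0 < b then ((2 * b) `^ p * vol)%:E else 0%E.
Proof.
have M (D : set (measurableTypeR R)) : measurable_fun D (fun y => (y `^ (p - 1))%:E).
  by apply/measurable_funTS/measurable_EFinP; exact: measurable_powR.
case: ifPn => [b0|]; last first.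
  rewrite -leNgt => b0; apply: integral0_eq => y /=; rewrite in_itv/= /weight => yb.
  case: ifPn => // y0; have : y <= b by move: yb; case: (c) => // /ltW.
  by move=> /le_trans /(_ b0); rewrite leNgt y0.
have p0 : 0 < p by rewrite divr_gt0 ?ltr0n.
transitivity (\int[leb]_(y in [set` Interval (BRight (0%R:R)) (BSide c b)]) ((2 `^ p * vol * p)%:E * (y `^ (p - 1))%:E))%E.
  rewrite /weighted integral_mkcond [RHS]integral_mkcond; apply: eq_integral => y _.
  rewrite !patchE !mem_setE !in_itv/=; have [y0|y0] := ltP 0 y => /=.
    by rewrite /weight y0 EFinM.
  by rewrite /weight ltNge y0/=; case: ifP.
rewrite ge0_integralZl//; last 2 first.
- by move=> y _; rewrite lee_fin powR_ge0.
- by rewrite lee_fin !mulr_ge0 ?powR_ge0 ?fine_ge0.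
have -> : (\int[leb]_(y in [set` Interval (BRight (0%R:R)) (BSide c b)]) (y `^ (p - 1))%:E =
    (b `^ p / p)%:E)%E.
  case: c; last exact: integral_powR.
  by rewrite (integral_itv_bndo_bndc (a := BRight 0%R)); [exact: integral_powR|exact: M].
rewrite -EFinM powRM ?(ltW b0)//; congr (_%:E).
by field; rewrite gt_eqF ?ltr0n.
Qed.

Let cdf_lty k : (lam m (half_sqr @^-1` `]-oo, k%:R[) < +oo)%E.
Proof. by rewrite half_sqr_cdf; case: ifP; rewrite ltry. Qed.

(** The open left rays form a pi-system generating the Borel sets, and both measures are finite on
    the rays that exhaust the line, so equality of distribution functions suffices. *)
Let weightedE A : measurable A -> lam m (half_sqr @^-1` A) = weighted A.
Proof.
pose pf0 : {measure set (measurableTypeR R) -> \bar R} :=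
  pushforward (lam m) (half_sqr : m.-tuple R -> measurableTypeR R).
pose pf := pf0 measurable_half_sqr.
move=> mA; have := @measure_unique _ R (measurableTypeR R) (@RGenInftyO.G R) (fun k => `]-oo, k%:R[%classic) _ _ _ _ pf weighted _ _ A mA.
apply.
- exact: (RGenInftyO.measurableE R).
- move=> _ _ [a ->] [b ->]; exists (Num.min a b); apply/seteqP; split => y /=.
    by rewrite !in_itv/= lt_min => -[-> ->].
  by rewrite !in_itv/= lt_min => /andP.
- by move=> k; exists k%:R.
- apply/seteqP; split => // y _; exists (Num.bound `|y : R|) => //=; rewrite in_itv/=.
  by apply: le_lt_trans (ler_norm (y : R)) _; rewrite archi_boundP.
- by move=> _ [b ->]; exact: etrans (half_sqr_cdf b) (esym (weighted_cdf b true)).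
- exact: cdf_lty.
Qed.

(** [vol] is the volume of the open ball. Since [weighted_cdf] gives the same value with and without
    the endpoint, the closed ball in the definition of [sphere_area] has the same volume. *)
Let volE' : vol = fine (lebn (@unit_ball R m)).
Proof.
rewrite -lam_unit_ball (_ : @unit_ball R m = half_sqr @^-1` `]-oo, 2^-1]); last first.
  have e (x : R) : (x / 2 <= 2^-1) = (x <= 1).
    by rewrite -[X in _ <= X]mul1r ler_pM2r ?invr_gt0.
  by apply/seteqP; split => z; rewrite /= in_itv/= /half_sqr /unit_ball/= e.
rewrite weightedE// (weighted_cdf _ false) ifT// ?invr_gt0//.
by rewrite divff// powR1 mul1r.
Qed.

(** Equal to [2^{m/2 - 1}] times the area [m |B^m|] of the unit sphere of [R^m]. *)
Definition radial_const : R := 2 `^ p * fine (lebn (@unit_ball R m)) * p.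

Lemma radial_const_ge0 : 0 <= radial_const.
Proof. by rewrite /radial_const -volE' !mulr_ge0 ?powR_ge0// fine_ge0. Qed.

Lemma lam_radial (k : R -> \bar R) : measurable_fun setT k -> (forall y, 0 <= k y)%E ->
  (\int[lam m]_z k (half_sqr z) =
   \int[leb]_(y in [set y : R | (0 <= y)%R]) (k y * (radial_const * y `^ (p - 1))%:E))%E.
Proof.
move=> mk k0.
transitivity (\int[lam m]_z (k (half_sqr z) * (1 : R)%:E))%E.
  by apply: eq_integral => z _; rewrite mule1.
transitivity (\int[leb]_y (k y * (weight y)%:E))%E.
  apply: (@integral_transfer R _ _ _ (m.-tuple R) (measurableTypeR R) R _ _ half_sqr id) => //.
    exact: measurable_half_sqr.
  move=> A mA; under eq_integral do rewrite mule1.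
  rewrite (_ : (fun z => _) = (fun z => (\1_(half_sqr @^-1` A) z)%:E))//.
  rewrite integral_indic//; last by rewrite -[X in measurable X]setTI; exact: measurable_half_sqr.
  rewrite setIT; apply: etrans (weightedE mA) _.
  rewrite -[weighted A]/(\int[leb]_(y in A) (weight y)%:E)%E [LHS]integral_mkcond.
  congr (integral _ _ _); apply/funext => y.
  by rewrite patchE indicE; case: ifP; rewrite ?mul1e ?mul0e.
have -> : [set y : R | 0 <= y] = `[0, +oo[%classic.
  by apply/seteqP; split => y; rewrite /= in_itv/= andbT.
rewrite -integral_itv_obnd_cbnd; last first.
  apply: emeasurable_funM; first exact: measurable_funTS.
  by apply/measurable_EFinP; apply: measurable_funM => //; apply: measurable_funTS; exact: measurable_powR.
rewrite [RHS]integral_mkcond; apply: eq_integral => y _.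
rewrite patchE mem_setE in_itv/= andbT /weight; case: ifPn => y0; last by rewrite mule0.
by rewrite /radial_const -volE'.
Qed.

End Radial.

(** * Local limit of the law of a sample point *)

Section Exponent.
Context {R : realType}.
Implicit Types (sw y g c x : R).

Definition clip c x : R := Num.max (- c) (Num.min c x).

Lemma clip_ge c x : - c <= clip c x.
Proof. by rewrite /clip le_max lexx. Qed.

Lemma clip_le c x : 0 <= c -> clip c x <= c.
Proof. by move=> c0; rewrite /clip ge_max ge_min lexx/= andbT ge0_cp. Qed.

Lemma clip_id c x : `|x| <= c -> clip c x = x.
Proof.
rewrite ler_norml => /andP[h1 h2]; rewrite /clip min_r// max_r//.
Qed.

Lemma cvg_clip (u v : nat -> R) c x : u @ \oo --> c -> v @ \oo --> x ->
  clip (u n) (v n) @[n --> \oo] --> clip c x.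
Proof.
move=> uc vx; rewrite /clip; under eq_fun do rewrite maxr_absE minr_absE.
rewrite maxr_absE minr_absE.
have W : (u n + v n - `|u n - v n|) / 2 @[n --> \oo] --> (c + x - `|c - x|) / 2.
  by apply: cvgMr_tmp; apply: cvgB; [exact: cvgD|apply: cvg_norm; exact: cvgB].
apply: cvgMr_tmp; apply: cvgD.
  by apply: cvgD W; exact: cvgN.
by apply: cvg_norm; apply: cvgB W; exact: cvgN.
Qed.

Lemma measurable_clip d (T : measurableType d) (f g : T -> R) :
  measurable_fun setT f -> measurable_fun setT g -> measurable_fun setT (fun z => clip (f z) (g z)).
Proof.
move=> mf mg; apply: measurable_maxr; first exact: measurable_funN.
exact: measurable_minr.
Qed.

(* The exponent contributed by a point at rescaled height [y]; clipping changes nothing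
   on the sphere but makes the bounds below hold everywhere. *)
Definition expo (s0 sw y g : R) : R :=
  s0 * expR (- y) + sw * expR (- (y / 2)) + clip (sw * expR (- (y / 2))) (expR (- y) * g).

(** Its expectation times the sample size drives the limit of the product over the sample, and its
    integral against the intensity is the Poisson exponent. *)
Definition damp (s0 sw y g : R) : R := 1 - expR (- expo s0 sw y g).

Section Bounds.
Variables (s0 sw : R).
Hypotheses (s00 : 0 <= s0) (sw0 : 0 <= sw).

(** The lower bound [- sw e^{-y/2}] of the clipped term is exactly offset by the middle term. *)
Lemma expo_ge0 y g : 0 <= expo s0 sw y g.
Proof.
have := clip_ge (sw * expR (- (y / 2))) (expR (- y) * g); rewrite /expo.
have : 0 <= s0 * expR (- y) by rewrite mulr_ge0 ?expR_ge0.
by lra.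
Qed.

Lemma expo_le y g : 0 <= y -> expo s0 sw y g <= (s0 + 2 * sw) * expR (- (y / 2)).
Proof.
move=> y0; have c0 : 0 <= sw * expR (- (y / 2)) by rewrite mulr_ge0 ?expR_ge0.
have := clip_le (expR (- y) * g) c0; rewrite /expo.
have : s0 * expR (- y) <= s0 * expR (- (y / 2)).
  by rewrite ler_wpM2l// ler_expR lerN2 ler_pdivrMr// ler_peMr ?ler1n.
by lra.
Qed.

Lemma damp_ge0 y g : 0 <= damp s0 sw y g.
Proof. by rewrite subr_ge0 -expR0 ler_expR oppr_le0 expo_ge0. Qed.

Lemma damp_le y g : 0 <= y -> damp s0 sw y g <= (s0 + 2 * sw) * expR (- (y / 2)).
Proof.
move=> y0; apply: le_trans (expo_le g y0).
by rewrite /damp; have := expR_ge1Dx (- expo s0 sw y g); lra.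
Qed.

Lemma damp_le1 y g : damp s0 sw y g <= 1.
Proof. by rewrite /damp lerBlDr lerDl expR_ge0. Qed.

End Bounds.

Lemma cvg_damp s0 sw (u v : nat -> R) y g : u @ \oo --> y -> v @ \oo --> g ->
  damp s0 sw (u n) (v n) @[n --> \oo] --> damp s0 sw y g.
Proof.
move=> uy vg.
have E (w : nat -> R) z : w @ \oo --> z -> expR (- w n) @[n --> \oo] --> expR (- z).
  move=> wz; apply: continuous_cvg; last exact: cvgN.
  exact: continuous_expR.
have E2 : expR (- (u n / 2)) @[n --> \oo] --> expR (- (y / 2)).
  by apply: E; apply: cvgMr_tmp.
apply: cvgB; first exact: cvg_cst.
apply: (E (fun n => expo s0 sw (u n) (v n))); apply: cvgD; first by apply: cvgD; apply: cvgMl_tmp => //; exact: E.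
by apply: cvg_clip; [exact: cvgMl_tmp|apply: cvgM => //; exact: E].
Qed.

Lemma measurable_expo d (T : measurableType d) s0 sw (f g : T -> R) :
  measurable_fun setT f -> measurable_fun setT g ->
  measurable_fun setT (fun z => expo s0 sw (f z) (g z)).
Proof.
move=> mf mg.
have E (w : T -> R) : measurable_fun setT w -> measurable_fun setT (fun z => expR (- w z)).
  by move=> mw; apply: (measurableT_comp (@measurable_expR R)); exact: measurable_funN.
have m1 := E _ mf.
have m2 : measurable_fun setT (fun z => expR (- (f z / 2))) by apply: E; exact: measurable_funM.
apply: measurable_funD; first by apply: measurable_funD; exact: measurable_funM.
by apply: measurable_clip; exact: measurable_funM.
Qed.

Lemma measurable_damp d (T : measurableType d) s0 sw (f g : T -> R) :
  measurable_fun setT f -> measurable_fun setT g ->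
  measurable_fun setT (fun z => damp s0 sw (f z) (g z)).
Proof.
move=> mf mg; apply: measurable_funB => //.
apply: (measurableT_comp (@measurable_expR R)); apply: measurable_funN; exact: measurable_expo.
Qed.

End Exponent.

Lemma probability_integral_cst d (T : measurableType d) (R : realType)
  (P : probability T R) (c : \bar R) : (\int[P]_x c = c)%E.
Proof.
apply: etrans (integral_cst P measurableT c) _.
by apply: etrans _ (mule1 c); congr (_ * _)%E; exact: probability_setT P.
Qed.

(** * Dominated convergence in the rescaled chart *)

Section ChartLimit.
Context {R : realType} {m : nat} (q a : m.+1.-tuple R) (nu : probability (m.+1.-tuple R) R).
Variables (s0 sw T0 : R).
Hypotheses (s00 : 0 <= s0) (sw0 : 0 <= sw) (T00 : 0 < T0) (T02 : T0 <= 1 / 2).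

(** The argument stands for the pair [(<q,u>, <u,a>)]. Restricting to the cap [1 - T0 < <q,u>] with
    [T0 <= 1/2] stays inside the hemisphere of the chart and keeps the cosine above 1/2, where the
    height is comparable with [|z|^2]. *)
Definition cap_damp (B : R) (z : R * R) : R :=
  if 1 - T0 < z.1 then damp s0 sw (B * (1 - z.1)) (Num.sqrt B * (z.2 - dotv q a)) else 0.

Lemma cap_damp_ge0 B z : 0 <= cap_damp B z.
Proof. by rewrite /cap_damp; case: ifP => // _; exact: damp_ge0. Qed.

Lemma measurable_cap_damp B : measurable_fun setT (cap_damp B).
Proof.
apply: measurable_fun_ifT => //; first exact: measurable_fun_ltr.
apply: measurable_damp; apply: measurable_funM => //; exact: measurable_funB.
Qed.

Section Fixed.
Variables (B : R) (z : m.-tuple R).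
Hypothesis B0 : 0 < B.
Let s := gnomonic_cos (tscale (Num.sqrt B)^-1 z).

Let sqrtB0 : 0 < Num.sqrt B. Proof. by rewrite sqrtr_gt0. Qed.
Let s_gt0 : 0 < s. Proof. exact: gnomonic_cos_gt0. Qed.

Let sE : s ^+ 2 = (1 + dotv z z / B)^-1.
Proof.
rewrite /s /gnomonic_cos exprVn sqr_sqrtr ?addr_ge0 ?dotv_ge0//; congr (_^-1).
by rewrite dotvZl dotvZr mulrA -invfM -expr2 sqr_sqrtr 1?mulrC// ltW.
Qed.

Let sE1 : B * (1 - s ^+ 2) = s ^+ 2 * dotv z z.
Proof.
have h : 0 < B + dotv z z by rewrite ltr_wpDr// dotv_ge0.
rewrite sE; have := B0; move: h; set D := dotv z z => h h2.
by field; rewrite !gt_eqF// ?divr_gt0// ltr_wpDr// divr_ge0 ?dotv_ge0 ?ltW.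
Qed.

Lemma scaled_height : B * (1 - s) = s ^+ 2 * dotv z z / (1 + s).
Proof.
rewrite -sE1; have : 1 + s != 0 by rewrite gt_eqF// ltr_wpDr// ltW.
by move=> h; field.
Qed.

Lemma scaled_radius : Num.sqrt B * Num.sqrt (1 - s ^+ 2) = s * enorm z.
Proof. by rewrite -sqrtrM ?(ltW B0)// sE1 sqrtrM ?sqr_ge0// sqrtr_sqr gtr0_norm. Qed.

Lemma scaled_height_sqrt : Num.sqrt B * (1 - s) = (Num.sqrt B)^-1 * (B * (1 - s)).
Proof.
rewrite mulrA; congr (_ * _); rewrite -[X in _ = _ * X](sqr_sqrtr (ltW B0)) expr2 mulKf//.
by rewrite gt_eqF.
Qed.

Lemma gnomonic_cos_le1 : s <= 1.
Proof.
rewrite -(ler_pXn2r (ltn0Sn 1)) ?nnegrE ?(ltW s_gt0)// expr1n sE invf_le1.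
  by rewrite lerDl divr_ge0 ?dotv_ge0 ?ltW.
by rewrite ltr_wpDr// divr_ge0 ?dotv_ge0 ?ltW.
Qed.

(** For [1/2 <= s <= 1] the factor [s^2 / (1 + s)] of [scaled_height] is at least [(1/4) / 2]. *)
Lemma scaled_height_ge : 1 - T0 < s -> dotv z z / 8 <= B * (1 - s).
Proof.
move=> sT; have s2 : 1 / 2 <= s by have := T02; lra.
have s1 := gnomonic_cos_le1.
rewrite scaled_height ler_pdivlMr ?ltr_wpDr ?(ltW s_gt0)//.
have D0 := dotv_ge0 z.
have h1 : dotv z z / 8 * (1 + s) <= dotv z z / 8 * 2 by rewrite ler_wpM2l ?divr_ge0//; lra.
have h2 : (1 / 2) ^+ 2 * dotv z z <= s ^+ 2 * dotv z z.
  by rewrite ler_wpM2r// ler_pXn2r// nnegrE ?divr_ge0 ?(ltW s_gt0).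
by rewrite expr2 in h2; lra.
Qed.

Definition chart_damp (th : m.+1.-tuple R) : R :=
  s ^+ m.+1 * cap_damp B (s, dotv q a * s + Num.sqrt (1 - s ^+ 2) * dotv th a).

(** Isolates the component along [q]: [sqrt B (1 - s)] is [1 / sqrt B] times the rescaled height,
    which converges, so this component disappears in the limit. *)
Lemma chart_dampE th : 1 - T0 < s ->
  chart_damp th = s ^+ m.+1 * damp s0 sw (s ^+ 2 * dotv z z / (1 + s))
    (- dotv q a * ((Num.sqrt B)^-1 * (s ^+ 2 * dotv z z / (1 + s))) + s * enorm z * dotv th a).
Proof.
move=> sT; rewrite /chart_damp /cap_damp/= sT -scaled_height; congr (_ * damp _ _ _ _).
by rewrite -scaled_height_sqrt -scaled_radius; ring.
Qed.

Lemma chart_damp_ge0 th : 0 <= chart_damp th.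
Proof. by rewrite mulr_ge0 ?exprn_ge0 ?(ltW s_gt0)// cap_damp_ge0. Qed.

(** The majorant for dominated convergence, uniform in [B] and [th]. The 16 is twice the 8 of
    [scaled_height_ge], because [damp] is bounded by a multiple of [e^{-y/2}]. *)
Lemma chart_damp_le th : chart_damp th <= (s0 + 2 * sw) * expR (- (dotv z z / 16)).
Proof.
have C0 : 0 <= s0 + 2 * sw by rewrite addr_ge0// mulr_ge0.
have s1 := gnomonic_cos_le1.
rewrite /chart_damp /cap_damp/=; case: ifPn => [sT|_]; last by rewrite mulr0 mulr_ge0 ?expR_ge0.
rewrite -[leRHS]mul1r ler_pM ?exprn_ge0 ?(ltW s_gt0) ?damp_ge0 ?exprn_ile1 ?(ltW s_gt0)//.
have y0 : 0 <= B * (1 - s) by rewrite mulr_ge0 ?(ltW B0)// subr_ge0.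
apply: le_trans (damp_le s00 sw0 _ y0) _.
rewrite ler_wpM2l// ler_expR lerN2; have := scaled_height_ge sT; lra.
Qed.

End Fixed.

Variable b : nat -> R.
Hypotheses (b0 : forall n, 0 < b n) (boo : b @ \oo --> +oo).

Definition limit_damp (z : m.-tuple R) (th : m.+1.-tuple R) : R :=
  damp s0 sw (half_sqr z) (enorm z * dotv th a).

Let cvg_sqrt_inv : (Num.sqrt (b n))^-1 @[n --> \oo] --> (0 : R).
Proof.
apply/cvgrPdist_lt => e e0; near=> n; rewrite sub0r normrN ger0_norm ?invr_ge0 ?sqrtr_ge0//.
rewrite invf_plt ?posrE ?sqrtr_gt0 ?b0// -(gtr0_norm (_ : 0 < e^-1)) ?invr_gt0// -sqrtr_sqr ltr_sqrt ?b0//.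
by near: n; move/cvgryPgt : boo; apply.
Unshelve. all: by end_near. Qed.

Let cvg_cos (z : m.-tuple R) : gnomonic_cos (tscale (Num.sqrt (b n))^-1 z) @[n --> \oo] --> (1 : R).
Proof.
rewrite -[X in _ --> X]invr1 -sqrtr1 -[X in Num.sqrt X]addr0 -(mul0r (dotv z z)) -(mul0r 0).
apply: cvgV; first by rewrite mul0r mul0r addr0 sqrtr1 oner_neq0.
apply: continuous_cvg; first exact: sqrt_continuous.
apply: cvgD; first exact: cvg_cst.
under eq_fun do rewrite dotvZl dotvZr mulrA.
by apply: cvgMr_tmp; exact: cvgM.
Qed.

Lemma chart_damp_cvg (z : m.-tuple R) th : chart_damp (b n) z th @[n --> \oo] --> limit_damp z th.
Proof.
have Cs := cvg_cos z.
have near_s : \forall n \near \oo, 1 - T0 < gnomonic_cos (tscale (Num.sqrt (b n))^-1 z).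
  by apply: (cvgr_gt (1 : R)) => //; rewrite gtrBl.
pose s n := gnomonic_cos (tscale (Num.sqrt (b n))^-1 z).
have CX k : s n ^+ k @[n --> \oo] --> (1 : R) ^+ k.
  elim: k => [|k IH]; first by under eq_fun do rewrite expr0; exact: cvg_cst.
  by under eq_fun do rewrite exprS; rewrite exprS; exact: cvgM.
pose y n := s n ^+ 2 * dotv z z / (1 + s n).
have Cy : y @ \oo --> half_sqr z.
  rewrite -[X in _ --> X](_ : 1 ^+ 2 * dotv z z / (1 + 1) = _); last by rewrite expr1n mul1r.
  apply: cvgM; first by apply: cvgMr_tmp; exact: CX.
  by apply: cvgV => //; apply: cvgD => //; exact: cvg_cst.
have -> : limit_damp z th = 1 ^+ m.+1 * damp s0 sw (half_sqr z)
    (- dotv q a * (0 * half_sqr z) + 1 * enorm z * dotv th a).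
  by rewrite expr1n mul0r mulr0 add0r !mul1r.
apply: cvg_trans (_ : (fun n => s n ^+ m.+1 * damp s0 sw (y n)
    (- dotv q a * ((Num.sqrt (b n))^-1 * y n) + s n * enorm z * dotv th a)) @ \oo --> _).
  apply: near_eq_cvg; near=> n; apply/esym/chart_dampE; first exact: b0.
  by near: n.
apply: cvgM; first exact: CX.
apply: cvg_damp => //; apply: cvgD.
  by apply: cvgMl_tmp; exact: cvgM.
by do 2 apply: cvgMr_tmp.
Unshelve. all: by end_near. Qed.

Let measurable_chart d (T : measurableType d) B (g : T -> R) (th : T -> m.+1.-tuple R) :
  measurable_fun setT g -> measurable_fun setT th -> measurable_fun setT
    (fun z => cap_damp B (g z, dotv q a * g z + Num.sqrt (1 - g z ^+ 2) * dotv (th z) a)).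
Proof.
have ms : measurable_fun setT (Num.sqrt : R -> R).
  by apply: continuous_measurable_fun; exact: sqrt_continuous.
move=> mg mth.
apply: (measurableT_comp (measurable_cap_damp B)); apply: measurable_fun_pair => //.
apply: measurable_funD; first exact: measurable_funM.
apply: measurable_funM; last exact: measurable_dotv.
by apply: (measurableT_comp ms); apply: measurable_funB => //; exact: measurable_funX.
Qed.

Lemma measurable_chart_damp n : measurable_fun setT
  (fun z : m.-tuple R * m.+1.-tuple R => chart_damp (b n) z.1 z.2).
Proof.
have mg : measurable_fun setT
    (fun z : m.-tuple R * m.+1.-tuple R => gnomonic_cos (tscale (Num.sqrt (b n))^-1 z.1)).
  by apply: (measurableT_comp (@measurable_gnomonic_cos R m)); exact: measurable_tscale.
apply: measurable_funM; first exact: measurable_funX.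
exact: measurable_chart.
Qed.

Lemma measurable_limit_damp : measurable_fun setT
  (fun z : m.-tuple R * m.+1.-tuple R => limit_damp z.1 z.2).
Proof.
apply: measurable_damp; first exact: (measurableT_comp (@measurable_half_sqr R m)).
apply: measurable_funM; first exact: measurable_enorm.
exact: measurable_dotv.
Qed.

Let C0 : 0 <= s0 + 2 * sw. Proof. by rewrite addr_ge0// mulr_ge0. Qed.

Let dom (z : m.-tuple R * m.+1.-tuple R) : \bar R := ((s0 + 2 * sw) * expR (- (dotv z.1 z.1 / 16)))%:E.

Let mdom1 : measurable_fun setT (fun z : m.-tuple R => (expR (- (dotv z z / 16)))%:E).
Proof.
apply/measurable_EFinP; apply: (measurableT_comp (@measurable_expR R)).
apply: measurable_funN; apply: measurable_funM => //; exact: measurable_dotv.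
Qed.

Let int_dom1 : (\int[lam m]_z (expR (- (dotv z z / 16)))%:E < +oo :> \bar R)%E.
Proof.
(* Dilation by 4 turns [|z|^2 / 16] into [|z|^2]. *)
rewrite (@lam_scale R m 4)//.
have E : (\int[lam m]_z (expR (- (dotv (tscale (4 : R) z) (tscale (4 : R) z) / 16)))%:E =
    \int[lam m]_z (expR (- dotv z z))%:E)%E.
  by apply: eq_integral => z _; congr (expR (- _))%:E; rewrite dotvZl dotvZr; field.
by rewrite E lam_gauss -EFinM ltry.
Qed.

Let mdom : measurable_fun setT dom.
Proof.
apply/measurable_EFinP; apply: measurable_funM => //.
have /measurable_EFinP h := mdom1; exact: (measurableT_comp h measurable_fst).
Qed.

Let integrable_dom : (lam m \x nu)%E.-integrable setT dom.
Proof.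
apply/integrable12ltyP => //.
rewrite [X in (X < _)%E](_ : _ = (\int[lam m]_z ((s0 + 2 * sw)%:E * (expR (- (dotv z z / 16)))%:E))%E); last first.
  apply: eq_integral => z _; apply: etrans _ (probability_integral_cst nu _).
  apply: eq_integral => th _; rewrite /dom/= ger0_norm ?EFinM//.
  by rewrite mulr_ge0// expR_ge0.
rewrite ge0_integralZl//.
by rewrite lte_mul_pinfty// lee_fin.
Qed.

Let cvg_product : ((\int[lam m \x nu]_z (chart_damp (b n) z.1 z.2)%:E @[n --> \oo] -->
   \int[lam m \x nu]_z (limit_damp z.1 z.2)%:E) /\
   (lam m \x nu).-integrable setT (fun z => (limit_damp z.1 z.2)%:E))%E.
Proof.
have [] := @dominated_convergence _ _ _ (lam m \x nu)%E setT measurableT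
  (fun n z => (chart_damp (b n) z.1 z.2)%:E) (fun z => (limit_damp z.1 z.2)%:E) dom.
- by move=> n; apply/measurable_EFinP; exact: measurable_chart_damp.
- by apply/measurable_EFinP; exact: measurable_limit_damp.
- apply: aeW => z _; apply: cvg_EFin; first exact: nearW.
  exact: chart_damp_cvg.
- exact: integrable_dom.
- apply: aeW => z n _; rewrite gee0_abs lee_fin ?chart_damp_ge0//.
  exact: chart_damp_le.
by [].
Qed.

Hypotheses (Sq : sphere m.+1 q) (nuq : uniform_tsphere q nu).

Definition limit_mass : \bar R := (\int[lam m]_z \int[nu]_th (limit_damp z th)%:E)%E.

Let limit_massE : limit_mass = (\int[lam m \x nu]_z (limit_damp z.1 z.2)%:E)%E.
Proof.
rewrite (fubini_tonelli1 (fun z => (limit_damp z.1 z.2)%:E))//.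
  by apply/measurable_EFinP; exact: measurable_limit_damp.
by move=> z; rewrite lee_fin damp_ge0.
Qed.

Lemma limit_mass_lty : (limit_mass < +oo)%E.
Proof.
rewrite limit_massE; have [_ /integrableP[_]] := cvg_product.
apply: le_lt_trans; apply: ge0_le_integral => //.
- by move=> z _; rewrite lee_fin damp_ge0.
- by apply/measurable_EFinP; exact: measurable_limit_damp.
- by apply: measurableT_comp => //; apply/measurable_EFinP; exact: measurable_limit_damp.
- by move=> z _; rewrite gee0_abs// lee_fin damp_ge0.
Qed.

Definition cap_mass (B : R) : \bar R :=
  (\int[lam m.+1]_u ((m.+1%:R * \1_(@punctured_ball R m.+1) u)%:E *
     (cap_damp B (dotv q (normalize u), dotv (normalize u) a))%:E))%E.

(** The substitution [v = z / sqrt b] in the chart has Jacobian [b^{-m/2}], which the prefactor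
    undoes. *)
Let cap_massE n : (((Num.sqrt (b n)) ^+ m)%:E * cap_mass (b n) =
   \int[lam m \x nu]_z (chart_damp (b n) z.1 z.2)%:E)%E.
Proof.
have mC := measurable_chart_damp n.
have c0 : 0 < (Num.sqrt (b n))^-1 by rewrite invr_gt0 sqrtr_gt0.
rewrite /cap_mass (sphere_chart Sq nuq a (Psi := fun z => (cap_damp (b n) z)%:E)); last 3 first.
- by apply/measurable_EFinP; exact: measurable_cap_damp.
- by move=> z; rewrite lee_fin cap_damp_ge0.
- by move=> t c t0; rewrite /cap_damp/= ltNge ifF//; apply/negbF; have := T02; lra.
rewrite (lam_scale c0); last 2 first.
- apply: emeasurable_funM.
    apply/measurable_EFinP; apply: measurable_funX; exact: measurable_gnomonic_cos.
  apply: (measurable_fun_fubini_tonelli_F (m2 := nu) (fun z : m.-tuple R * m.+1.-tuple R =>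
    (cap_damp (b n) (gnomonic_cos z.1, dotv q a * gnomonic_cos z.1 +
      Num.sqrt (1 - gnomonic_cos z.1 ^+ 2) * dotv z.2 a))%:E)).
    apply/measurable_EFinP; apply: measurable_chart => //.
    exact: (measurableT_comp (@measurable_gnomonic_cos R m)).
  by move=> z; rewrite lee_fin cap_damp_ge0.
- move=> v; rewrite mule_ge0 ?lee_fin ?exprn_ge0 ?(ltW (gnomonic_cos_gt0 _))//.
  by apply: integral_ge0 => th _; rewrite lee_fin cap_damp_ge0.
rewrite muleA -EFinM -exprMn divff ?gt_eqF ?sqrtr_gt0// expr1n mul1e.
rewrite (fubini_tonelli1 (fun z => (chart_damp (b n) z.1 z.2)%:E)); last 2 first.
- by apply/measurable_EFinP; exact: measurable_chart_damp.
- by move=> z; rewrite lee_fin chart_damp_ge0.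
apply: eq_integral => z _; rewrite /fubini_F/= /chart_damp.
under [RHS]eq_integral do rewrite EFinM.
rewrite ge0_integralZl//.
- by apply/measurable_EFinP; apply: measurable_chart.
- by move=> th _; rewrite lee_fin cap_damp_ge0.
- by rewrite lee_fin exprn_ge0// ltW// gnomonic_cos_gt0.
Qed.

Lemma cap_mass_cvg :
  (((Num.sqrt (b n)) ^+ m)%:E * cap_mass (b n) @[n --> \oo] --> limit_mass)%E.
Proof.
rewrite limit_massE; under eq_fun do rewrite cap_massE.
by have [] := cvg_product.
Qed.

End ChartLimit.

(** * Localisation: comparing the density with its value at q *)

Section LawLimit.
Context {R : realType}.

Lemma dotv_tsub_sphere n (q u : n.-tuple R) : sphere n q -> sphere n u ->
  dotv (tsub u q) (tsub u q) = 2 * (1 - dotv q u).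
Proof. by move=> Sq Su; rewrite !(dotvBl, dotvBr) Sq Su (dotvC u q); ring. Qed.

Lemma dotv_sphere_le1 n (q u : n.-tuple R) : sphere n q -> sphere n u -> dotv q u <= 1.
Proof.
by move=> Sq Su; have := dotv_ge0 (tsub u q); rewrite dotv_tsub_sphere// pmulr_rge0// subr_ge0.
Qed.

Lemma density_near n (rho : n.-tuple R -> R) q : C2_on_sphere rho -> sphere n q ->
  forall e, 0 < e -> exists T0, [/\ 0 < T0, T0 <= 1 / 2 &
    forall u, sphere n u -> 1 - T0 < dotv q u -> `|rho u - rho q| < e].
Proof.
move=> /C2_on_sphere_cont[g [gE cg]] Sq e e0.
have [del del0 H] := cg _ Sq _ e0.
(* On the cap [|u - q|^2 = 2 (1 - <q,u>) < 2 T0 <= del^2]; the bound 1/2 is the one that the chart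
   estimates require. *)
exists (Num.min (1 / 2) (del ^+ 2 / 2)); split.
- by rewrite lt_min !divr_gt0 ?exprn_gt0.
- by rewrite ge_min lexx.
move=> u Su; set T0 := Num.min _ _ => hu.
have TT : T0 <= del ^+ 2 / 2 by rewrite ge_min lexx orbT.
rewrite -!gE//; apply: H => i.
apply: (@le_lt_trans _ _ (enorm (tsub u q))).
  by have := coord_le_enorm (tsub u q) i; rewrite tnth_mktuple.
rewrite /enorm dotv_tsub_sphere// -(gtr0_norm del0) -sqrtr_sqr ltr_sqrt ?exprn_gt0//.
lra.
Qed.

(** For [b > 1], [sqrt(b)^m <= b^m], and [e^{cb} >= (cb)^{m+1} / (m+1)!] leaves a spare factor
    [1/b]. *)
Lemma exp_beats_power (m : nat) (c : R) (b : nat -> R) : 0 < c -> b @ \oo --> +oo ->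
  (Num.sqrt (b n)) ^+ m * expR (- (c * b n)) @[n --> \oo] --> (0 : R).
Proof.
move=> c0 boo.
pose K := (m.+1)`!%:R / c ^+ m.+1.
have K0 : 0 < K by rewrite divr_gt0 ?exprn_gt0// ltr0n fact_gt0.
have Cb : K / b n @[n --> \oo] --> (0 : R).
  rewrite -(mulr0 K); apply: cvgMl_tmp; apply/cvgrPdist_lt => e e0; near=> n.
  have bn : e^-1 < b n by near: n; move/cvgryPgt : boo; apply.
  have bp : 0 < b n by rewrite (lt_trans _ bn)// invr_gt0.
  by rewrite sub0r normrN ger0_norm ?invr_ge0 ?(ltW bp)// invf_plt ?posrE.
apply: (@squeeze_cvgr _ _ _ _ (fun=> 0) (fun n => K / b n)) => //; last exact: cvg_cst.
near=> n.
have b1 : 1 < b n by near: n; move/cvgryPgt : boo; apply.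
have bp : 0 < b n by rewrite (lt_trans _ b1).
rewrite mulr_ge0 ?exprn_ge0 ?sqrtr_ge0 ?expR_ge0//=.
have h1 : Num.sqrt (b n) ^+ m <= b n ^+ m.
  rewrite lerXn2r ?nnegrE ?sqrtr_ge0 ?(ltW bp)//.
  rewrite -[leRHS]ger0_norm ?(ltW bp)// -sqrtr_sqr ler_wsqrtr// expr2 ler_peMr ?(ltW bp)// ltW//.
have h2 : expR (- (c * b n)) <= (m.+1)`!%:R / (c * b n) ^+ m.+1.
  rewrite expRN invf_ple ?posrE ?expR_gt0 ?divr_gt0 ?exprn_gt0 ?mulr_gt0 ?ltr0n ?fact_gt0// invf_div.
  apply: le_trans (expR_ge1Dxn m _); last by rewrite mulr_ge0 ?(ltW c0) ?(ltW bp).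
  by rewrite lerDr.
apply: (@le_trans _ _ (b n ^+ m * ((m.+1)`!%:R / (c * b n) ^+ m.+1))).
  by rewrite ler_pM ?exprn_ge0 ?sqrtr_ge0 ?expR_ge0.
rewrite /K exprMn [b n ^+ m.+1]exprS le_eqVlt; apply/orP; left; apply/eqP.
by field; rewrite !gt_eqF// exprn_gt0.
Unshelve. all: by end_near. Qed.

Context d0 (Om : measurableType d0) (P : probability Om R) (m : nat)
  (rho : m.+1.-tuple R -> R) (X : Om -> m.+1.-tuple R) (q a : m.+1.-tuple R)
  (nu : probability (m.+1.-tuple R) R).
Hypothesis C2 : C2_on_sphere rho.
Hypothesis rho_ge0 : forall u, sphere m.+1 u -> 0 <= rho u.
Hypothesis rho1 : sphere_int rho (sphere m.+1) = 1%E.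
Hypothesis mX : measurable_fun setT X.
Hypothesis lawX : has_sphere_law P rho X.
Hypotheses (Sq : sphere m.+1 q) (nuq : uniform_tsphere q nu).
Variables (s0 sw : R).
Hypotheses (s00 : 0 <= s0) (sw0 : 0 <= sw).

Definition sample_damp (B : R) (u : m.+1.-tuple R) : R :=
  damp s0 sw (B * (1 - dotv q u)) (Num.sqrt B * (dotv u a - dotv q a)).

Lemma measurable_sample_damp B : measurable_fun setT (sample_damp B).
Proof.
apply: measurable_damp; apply: measurable_funM => //; apply: measurable_funB => //;
exact: measurable_dotv.
Qed.

Let mT0 T0 : measurable [set u : m.+1.-tuple R | 1 - T0 < dotv q u].
Proof.
rewrite (_ : mkset _ = (fun u : m.+1.-tuple R => dotv q u) @^-1` `]1 - T0, +oo[%classic).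
  by rewrite -[X in measurable X]setTI; apply: measurable_dotv.
by apply/seteqP; split => u; rewrite /= in_itv/= andbT.
Qed.

Let mcap B T0 : measurable_fun setT (fun u : m.+1.-tuple R =>
  (cap_damp q a s0 sw T0 B (dotv q u, dotv u a))%:E : \bar R).
Proof.
apply/measurable_EFinP; apply: (measurableT_comp (measurable_cap_damp q a s0 sw T0 B)).
by apply: measurable_fun_pair; exact: measurable_dotv.
Qed.

Let sample_mass B : \bar R := (\int[P]_w (sample_damp B (X w))%:E)%E.
Let near_mass T0 B : \bar R := (\int[P]_w (cap_damp q a s0 sw T0 B (dotv q (X w), dotv (X w) a))%:E)%E.

Let near_massE T0 B : (near_mass T0 B =
  \int[lam m.+1]_u ((cap_damp q a s0 sw T0 B (dotv q (normalize u), dotv (normalize u) a))%:E *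
    (m.+1%:R * ball_density rho u)%:E))%E.
Proof.
rewrite /near_mass (sphere_law_integral C2 rho_ge0 rho1 mX lawX (mcap B T0))// => u.
by rewrite lee_fin cap_damp_ge0.
Qed.

Let mcapN B T0 : measurable_fun setT (fun u : m.+1.-tuple R => 
  cap_damp q a s0 sw T0 B (dotv q (normalize u), dotv (normalize u) a)).
Proof.
have /measurable_EFinP h := mcap B T0.
exact: (measurableT_comp h (@measurable_normalize R m.+1)).
Qed.

(** On the cap the density is within [e] of [rho q], and elsewhere the integrand vanishes. The
    condition [e <= rho q] keeps the lower factor nonnegative, so that it passes through the
    integral. *)
Let near_mass_bounds T0 B e : 0 <= e -> e <= rho q ->
  (forall u, sphere m.+1 u -> 1 - T0 < dotv q u -> `|rho u - rho q| < e) ->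
  ((rho q - e)%:E * cap_mass q a s0 sw T0 B <= near_mass T0 B <=
   (rho q + e)%:E * cap_mass q a s0 sw T0 B)%E.
Proof.
move=> e0 eq Hrho; rewrite near_massE /cap_mass.
have mc : measurable_fun setT (fun u : m.+1.-tuple R =>
  ((m.+1%:R * \1_(@punctured_ball R m.+1) u)%:E *
     (cap_damp q a s0 sw T0 B (dotv q (normalize u), dotv (normalize u) a))%:E)%E).
  apply: emeasurable_funM; apply/measurable_EFinP; last exact: mcapN.
  apply: measurable_funM => //; apply: measurable_indic; exact: measurable_punctured_ball.
have c0 u : (0 <= (m.+1%:R * \1_(@punctured_ball R m.+1) u)%:E *
     (cap_damp q a s0 sw T0 B (dotv q (normalize u), dotv (normalize u) a))%:E)%E.
  by rewrite mule_ge0 ?lee_fin ?mulr_ge0 ?cap_damp_ge0.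
have md : measurable_fun setT (fun u : m.+1.-tuple R =>
  ((cap_damp q a s0 sw T0 B (dotv q (normalize u), dotv (normalize u) a))%:E *
    (m.+1%:R * ball_density rho u)%:E)%E).
  apply: emeasurable_funM; apply/measurable_EFinP; first exact: mcapN.
  by apply: measurable_funM => //; exact: measurable_ball_density.
have pw u : (rho q - e) * (m.+1%:R * \1_(@punctured_ball R m.+1) u * cap_damp q a s0 sw T0 B (dotv q (normalize u), dotv (normalize u) a))
    <= cap_damp q a s0 sw T0 B (dotv q (normalize u), dotv (normalize u) a) * (m.+1%:R * ball_density rho u)
    <= (rho q + e) * (m.+1%:R * \1_(@punctured_ball R m.+1) u * cap_damp q a s0 sw T0 B (dotv q (normalize u), dotv (normalize u) a)).
  have cd0 := cap_damp_ge0 q a sw T0 s00 B (dotv q (normalize u), dotv (normalize u) a).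
  move: cd0; rewrite /cap_damp/=; case: ifPn => [hT cd0|_ _]; last by rewrite !mulr0 mul0r lexx.
  rewrite /ball_density indicE; case: (boolP (u \in _)) => [|_]; last by rewrite !(mulr0, mul0r) lexx.
  rewrite inE => /andP[u0 _]; have := Hrho _ (normalize_sphere u0) hT.
  rewrite ltr_norml => /andP[h1 h2]; rewrite !mulr1 mul1r.
  move: cd0; set D := damp _ _ _ _ => D0.
  have mD : 0 <= m.+1%:R * D by rewrite mulr_ge0.
  rewrite [D * _](_ : _ = rho (normalize u) * (m.+1%:R * D)); last by ring.
  by apply/andP; split; rewrite ler_wpM2r//; lra.
have e1 : 0 <= rho q - e by rewrite subr_ge0.
have e2 : 0 <= rho q + e by rewrite addr_ge0 ?rho_ge0.
rewrite -!ge0_integralZl//.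
apply/andP; split; apply: ge0_le_integral => //.
- by move=> u _; rewrite mule_ge0.
- exact: measurable_funeM.
- by move=> u _; rewrite -!EFinM lee_fin; have /andP[] := pw u.
- by move=> u _; rewrite -EFinM lee_fin mulr_ge0 ?cap_damp_ge0// mulr_ge0// ball_density_ge0.
- exact: measurable_funeM.
- by move=> u _; rewrite -!EFinM lee_fin; have /andP[] := pw u.
Qed.

Let msample B : measurable_fun setT (fun u => (sample_damp B u)%:E).
Proof. by apply/measurable_EFinP; exact: measurable_sample_damp. Qed.

(** The law is carried by the sphere, so the comparison is checked there only; [far] relies on this,
    since it uses that heights are nonnegative on the sphere. *)
Let law_le (F G : m.+1.-tuple R -> \bar R) :
  measurable_fun setT F -> (forall u, 0 <= F u)%E ->
  measurable_fun setT G -> (forall u, 0 <= G u)%E ->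
  (forall u, sphere m.+1 u -> F u <= G u)%E -> (\int[P]_w F (X w) <= \int[P]_w G (X w))%E.
Proof.
move=> mF F0 mG G0 FG.
have w0 u : 0 <= m.+1%:R * ball_density rho u by rewrite mulr_ge0// ball_density_ge0.
have mw : measurable_fun setT (fun u => (m.+1%:R * ball_density rho u)%:E).
  by apply/measurable_EFinP; apply: measurable_funM => //; exact: measurable_ball_density.
have mN := @measurable_normalize R m.+1.
rewrite (sphere_law_integral C2 rho_ge0 rho1 mX lawX mF F0).
rewrite (sphere_law_integral C2 rho_ge0 rho1 mX lawX mG G0).
apply: ge0_le_integral.
- exact: measurableT.
- by move=> u _; rewrite mule_ge0 ?lee_fin.
- apply: emeasurable_funM; [exact: (measurableT_comp mF mN)|exact: mw].
- apply: emeasurable_funM; [exact: (measurableT_comp mG mN)|exact: mw].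
move=> u _; have [Bu|Bu] := boolP (u \in @punctured_ball R m.+1); last first.
  by rewrite /ball_density indicE (negbTE Bu) !(mul0r, mulr0, mule0).
apply: lee_wpmul2r; first by rewrite lee_fin.
move: Bu; rewrite inE => /andP[u0 _]; exact/FG/normalize_sphere.
Qed.

(** Outside the cap the rescaled height is at least [c B], so [damp_le] makes the discarded part
    exponentially small. *)
Let far c B : 0 <= B -> (near_mass c B <= sample_mass B <=
  near_mass c B + ((s0 + 2 * sw) * expR (- (c / 2 * B)))%:E)%E.
Proof.
move=> B0; have C0 : 0 <= s0 + 2 * sw by rewrite addr_ge0// mulr_ge0.
have cd u := cap_damp_ge0 q a sw c s00 B u.
have sd u : 0 <= sample_damp B u by exact: damp_ge0.
apply/andP; split.
  apply: (@law_le (fun u => (cap_damp q a s0 sw c B (dotv q u, dotv u a))%:E)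
    (fun u => (sample_damp B u)%:E)) => [|u||u|u _]; rewrite ?lee_fin//.
  by rewrite /cap_damp/=; case: ifP.
set t := expR _.
rewrite -(probability_integral_cst P ((s0 + 2 * sw) * t)%:E) -ge0_integralD//; last 3 first.
- by move=> w _; rewrite lee_fin.
- exact: (measurableT_comp (mcap B c) mX).
- by move=> w _; rewrite lee_fin mulr_ge0 ?expR_ge0.
apply: (@law_le (fun u => (sample_damp B u)%:E)
  (fun u => (cap_damp q a s0 sw c B (dotv q u, dotv u a))%:E + ((s0 + 2 * sw) * t)%:E)%E).
- exact: msample.
- by move=> u; rewrite lee_fin.
- exact: emeasurable_funD.
- by move=> u; rewrite adde_ge0 ?lee_fin// mulr_ge0 ?expR_ge0.
move=> u Su; rewrite -EFinD lee_fin /cap_damp/=; case: ifPn => [_|hT].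
  by rewrite lerDl mulr_ge0 ?expR_ge0.
have hq := dotv_sphere_le1 Sq Su.
rewrite add0r; apply: le_trans (damp_le s00 sw0 _ _) _; first by rewrite mulr_ge0// subr_ge0.
rewrite ler_wpM2l// ler_expR lerN2 mulrAC ler_pM2r// mulrC ler_wpM2l//.
by move: hT; rewrite -leNgt; lra.
Qed.

Let sample_mass_fin B : sample_mass B \is a fin_num.
Proof.
rewrite ge0_fin_numE; last by apply: integral_ge0 => w _; rewrite lee_fin damp_ge0.
apply: le_lt_trans (ltry 1); rewrite -(probability_integral_cst P 1%E).
apply: ge0_le_integral => //.
- by move=> w _; rewrite lee_fin damp_ge0.
- exact: (measurableT_comp (msample B) mX).
- by move=> w _; rewrite lee_fin damp_le1.
Qed.

(** The tolerance [e] fixes the cap height [T0] before [n] grows. On the cap the density is nearly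
    [rho q]; the part outside costs at most a constant times [N_n e^{-T0 b_n / 2}], which vanishes
    because [N_n] grows at most like [b_n^{m/2}]. *)
Lemma sample_mass_cvg (b N : nat -> R) (kappa : R) :
  0 < rho q -> (forall n, 0 < b n) -> b @ \oo --> +oo -> (forall n, 0 <= N n) ->
  N n / (Num.sqrt (b n)) ^+ m @[n --> \oo] --> kappa ->
  N n * fine (\int[P]_w (sample_damp (b n) (X w))%:E)%E @[n --> \oo] -->
    rho q * (kappa * fine (limit_mass a nu s0 sw)).
Proof.
move=> rq0 b0 boo N0 Nk.
set L := fine _.
have h12 : (0 : R) < 1 / 2 by rewrite divr_gt0.
have Lfin : limit_mass a nu s0 sw = L%:E.
  rewrite fineK// ge0_fin_numE; first exact: (limit_mass_lty q a nu s00 sw0 h12 (lexx _) b0 boo).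
  by do 2 (apply: integral_ge0 => ? _); rewrite lee_fin damp_ge0.
have L0 : 0 <= L.
  by rewrite fine_ge0//; do 2 (apply: integral_ge0 => ? _); rewrite lee_fin damp_ge0.
have k0 : 0 <= kappa.
  rewrite -(cvg_lim _ Nk)//; apply: limr_ge; first by apply/cvg_ex; exists kappa.
  by apply: nearW => n; rewrite divr_ge0 ?exprn_ge0 ?sqrtr_ge0.
have C0 : 0 <= s0 + 2 * sw by rewrite addr_ge0// mulr_ge0.
apply/cvgrPdist_lt => eta eta0.
(* Three errors share the budget, each at most [eta/4]: the oscillation of the density ([e M]), the
   convergence of the cap mass ([rho q * del]) and the tail. [M] bounds the normalised cap mass once
   it is within [del <= 1] of its limit. *)
pose M := kappa * L + 1.
have M0 : 0 < M by rewrite ltr_wpDl// mulr_ge0.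
pose e := Num.min (rho q) (eta / (4 * M)).
have e0 : 0 < e by rewrite lt_min rq0 divr_gt0// mulr_gt0.
have eq : e <= rho q by rewrite ge_min lexx.
have eM : e * M <= eta / 4.
  have : e <= eta / (4 * M) by rewrite ge_min lexx orbT.
  by rewrite ler_pdivlMr ?mulr_gt0// => h; rewrite ler_pdivlMr//; lra.
have [T0 [T00 T02 HT]] := density_near C2 Sq e0.
have := @cap_mass_cvg _ _ q a nu _ _ _ s00 sw0 T00 T02 b b0 boo Sq nuq.
rewrite Lfin => /fine_cvgP[fin cL].
pose c n := fine ((Num.sqrt (b n) ^+ m)%:E * cap_mass q a s0 sw T0 (b n))%E.
have kc : N n / Num.sqrt (b n) ^+ m * c n @[n --> \oo] --> kappa * L by exact: cvgM.
have tail : N n / Num.sqrt (b n) ^+ m * ((s0 + 2 * sw) *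
    (Num.sqrt (b n) ^+ m * expR (- (T0 / 2 * b n)))) @[n --> \oo] --> (0 : R).
  rewrite -(mulr0 kappa) -(mulr0 (s0 + 2 * sw)); apply: cvgM => //; apply: cvgMl_tmp.
  by apply: exp_beats_power => //; rewrite divr_gt0.
pose del := Num.min 1 (eta / (4 * rho q)).
have del0 : 0 < del by rewrite lt_min ltr01 divr_gt0// mulr_gt0.
have delr : rho q * del <= eta / 4.
  have : del <= eta / (4 * rho q) by rewrite ge_min lexx orbT.
  by rewrite ler_pdivlMr ?mulr_gt0// => h; rewrite ler_pdivlMr//; lra.
have del1 : del <= 1 by rewrite ge_min lexx.
have nkc : \forall n \near \oo, `|kappa * L - N n / Num.sqrt (b n) ^+ m * c n| < del.
  by move/cvgrPdist_lt : kc => /(_ _ del0).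
have ntl : \forall n \near \oo, `|0 - N n / Num.sqrt (b n) ^+ m * ((s0 + 2 * sw) *
    (Num.sqrt (b n) ^+ m * expR (- (T0 / 2 * b n))))| < eta / 4.
  by move/cvgrPdist_lt : tail => /(_ (eta / 4)); apply; rewrite divr_gt0.
near=> n.
have sb0 : 0 < Num.sqrt (b n) ^+ m by rewrite exprn_gt0// sqrtr_gt0.
have cE : (cap_mass q a s0 sw T0 (b n) = (c n / Num.sqrt (b n) ^+ m)%:E)%E.
  have finn : ((Num.sqrt (b n) ^+ m)%:E * cap_mass q a s0 sw T0 (b n))%E \is a fin_num.
    by near: n.
  rewrite EFinM /c fineK// muleC muleA -EFinM mulVf ?mul1e//.
  by rewrite gt_eqF.
have /andP[lo hi] := near_mass_bounds (b n) (ltW e0) eq HT.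
have /andP[flo fhi] := far T0 (ltW (b0 n)).
set x := fine _.
have xE : sample_mass (b n) = x%:E by rewrite fineK// sample_mass_fin.
have Xlo : (rho q - e) * (c n / Num.sqrt (b n) ^+ m) <= x.
  by rewrite -lee_fin -xE EFinM -cE (le_trans lo).
have Xhi : x <= (rho q + e) * (c n / Num.sqrt (b n) ^+ m) + (s0 + 2 * sw) * expR (- (T0 / 2 * b n)).
  by rewrite -lee_fin -xE EFinD EFinM -cE (le_trans fhi)// leeD2r.
pose K := N n / Num.sqrt (b n) ^+ m * c n.
have Nlo : (rho q - e) * K <= N n * x.
  rewrite (_ : _ * K = N n * ((rho q - e) * (c n / Num.sqrt (b n) ^+ m))); last by rewrite /K; ring.
  by rewrite ler_wpM2l.
pose tl := N n / Num.sqrt (b n) ^+ m * ((s0 + 2 * sw) *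
    (Num.sqrt (b n) ^+ m * expR (- (T0 / 2 * b n)))).
have Nhi : N n * x <= (rho q + e) * K + tl.
  rewrite (_ : _ + tl = N n * ((rho q + e) * (c n / Num.sqrt (b n) ^+ m) + (s0 + 2 * sw) * expR (- (T0 / 2 * b n)))).
    by rewrite ler_wpM2l.
  rewrite /K /tl; have : Num.sqrt (b n) ^+ m != 0 by rewrite gt_eqF.
  by set z := _ ^+ m => z0; field.
have Kd : `|kappa * L - K| < del.
  by rewrite /K; near: n.
have td : `|0 - tl| < eta / 4.
  by rewrite /tl; near: n.
have rKd : rho q * `|kappa * L - K| < eta / 4.
  by apply: lt_le_trans delr; rewrite ltr_pM2l.
have rK : `|rho q * (kappa * L) - rho q * K| < eta / 4 by rewrite -mulrBr normrM gtr0_norm.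
have KM : K <= M by move: Kd; rewrite ltr_norml /M => /andP[]; lra.
have eK : e * K <= eta / 4 by apply: le_trans eM; rewrite ler_wpM2l// ltW.
move: rK td; rewrite !ltr_norml => /andP[r1 r2] /andP[t1 t2].
by apply/andP; split; lra.
Unshelve. all: by end_near.
Qed.

End LawLimit.

(** * Independence *)

Section ProductRule.
Context {R : realType} d (Om : measurableType d) (P : probability Om R).

Definition unit_fun (f : Om -> R) := measurable_fun setT f /\ forall w, 0 <= f w <= 1.

Local Notation E f := (\int[P]_w (f w)%:E)%E.

Lemma unit_fun_prod k (f : 'I_k -> Om -> R) (p : pred 'I_k) : (forall i, p i -> unit_fun (f i)) ->
  unit_fun (fun w => \prod_(i < k | p i) f i w).
Proof.
move=> uf; split.
  under eq_fun do rewrite big_mkcond.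
  apply: (@measurable_prod _ _ _ _ _ _ (fun i w => if p i then f i w else 1)) => i _.
  by have [pi|//] := boolP (p i); have [] := uf i pi.
move=> w; rewrite prodr_ge0 ?prodr_ile1// => i pi; have [_ /(_ w)] := uf i pi => // /andP[].
by [].
Qed.

Lemma unit_fun_ge0 f : unit_fun f -> (0 <= E f)%E.
Proof. by move=> [_ f1]; apply: integral_ge0 => w _; rewrite lee_fin; have /andP[] := f1 w. Qed.

Lemma unit_fun_fin f : unit_fun f -> E f \is a fin_num.
Proof.
move=> uf; rewrite ge0_fin_numE ?unit_fun_ge0//; have [mf f1] := uf.
apply: le_lt_trans (ltry 1); rewrite -(probability_integral_cst P 1%E).
apply: ge0_le_integral => //.
- by move=> w _; rewrite lee_fin; have /andP[] := f1 w.
- exact/measurable_EFinP.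
- by move=> w _; rewrite lee_fin; have /andP[] := f1 w.
Qed.

(* Independence known for the functions in the classes [I i] propagates, one coordinate at
   a time, to larger classes [J i] to which linear identities extend. *)
Lemma product_rule (k : nat) (I J : nat -> set (Om -> R)) :
  (forall i f, I i f -> unit_fun f) -> (forall i f, J i f -> unit_fun f) ->
  (forall f : nat -> Om -> R, (forall i, (i < k)%N -> I i (f i)) ->
     E (fun w => \prod_(i < k) f i w) = (\prod_(i < k) E (f i))%E) ->
  (forall i G (c : R), unit_fun G -> 0 <= c ->
     (forall f, I i f -> E (fun w => f w * G w) = (c%:E * E f)%E) ->
     forall g, J i g -> E (fun w => g w * G w) = (c%:E * E g)%E) ->
  forall g : nat -> Om -> R, (forall i, (i < k)%N -> J i (g i)) ->
     E (fun w => \prod_(i < k) g i w) = (\prod_(i < k) E (g i))%E.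
Proof.
move=> uI uJ base ext g Jg.
(* Hybrid induction: the first [j] factors are already in the large classes, the others still among
   the generators. *)
suff H j : (j <= k)%N -> forall h : nat -> Om -> R,
    (forall i, (i < j)%N -> J i (h i)) -> (forall i, (j <= i < k)%N -> I i (h i)) ->
    E (fun w => \prod_(i < k) h i w) = (\prod_(i < k) E (h i))%E.
  by apply: (H k) => // i; rewrite leqNgt => /andP[/negP].
elim: j => [_|j IH jk] h hJ hI; first by apply: base => i ik; exact: hI.
pose oj := Ordinal jk.
pose G w := \prod_(i < k | i != oj) h i w.
have uh i : (i < k)%N -> unit_fun (h i).
  move=> ik; have [ij|ij] := ltnP i j.+1; first exact: uJ (hJ _ ij).
  by apply: (uI i); apply: hI; rewrite ij.
have uG : unit_fun G by apply: unit_fun_prod => i _; exact: uh.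
pose c := fine (\prod_(i < k | i != oj) E (h i))%E.
have cfin : (\prod_(i < k | i != oj) E (h i))%E \is a fin_num.
  elim/big_ind : _ => //; first by move=> x y; exact: fin_numM.
  by move=> i _; apply: unit_fun_fin; exact: uh.
have c0 : 0 <= c.
  apply: fine_ge0; elim/big_ind : _ => //; first by move=> x y; exact: mule_ge0.
  by move=> i _; apply: unit_fun_ge0; exact: uh.
have split_prod (f : nat -> Om -> R) : (forall i : 'I_k, i != oj -> f i = h i) ->
    (E (fun w => \prod_(i < k) f i w) = E (fun w => f j w * G w)) /\
    ((\prod_(i < k) E (f i))%E = (c%:E * E (f j))%E).
  move=> fh; split.
    apply: eq_integral => w _; rewrite (bigD1 oj)//=; congr (_ * _)%:E.
    by apply: eq_bigr => i /fh ->.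
  rewrite (bigD1 oj)//= muleC; congr (_ * _)%E; rewrite /c fineK//.
  by apply: eq_bigr => i /fh ->.
have [-> ->] := split_prod h (fun _ _ => erefl).
apply: (ext j) => //; last by apply: hJ.
(* With the factor [j] replaced by a generator, the induction hypothesis is exactly the linear
   identity that [ext] extends. *)
move=> f If; pose h' i := if i == j then f else h i.
have h'E (i : 'I_k) : i != oj -> h' i = h i.
  by rewrite /h' -val_eqE /= => /negbTE ->.
have [E1 E2] := split_prod h' h'E.
move: E1 E2; rewrite {2 4}/h' eqxx => <- <-.
apply: IH; first exact: ltnW.
  move=> i ij; rewrite /h' (ltn_eqF ij); apply: hJ; exact: ltnW.
move=> i /andP[ji ik]; rewrite /h'; case: eqVneq => [->//|ij].
by apply: hI; rewrite ik andbT ltn_neqAle eq_sym ij.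
Qed.

End ProductRule.

(** Squeezed by [e^{-a/(1-a)} <= 1 - a <= e^{-a}]; the left inequality is [1 + t <= e^t] at
    [t = a/(1-a)]. The two [n]-th powers have the same limit because [a_n] tends to 0. *)
Lemma cvg_one_sub_div_pow (R : realType) (a : nat -> R) (l : R) :
  (forall n, 0 <= a n <= 1) -> n.+1%:R * a n @[n --> \oo] --> l ->
  (1 - a n) ^+ n.+1 @[n --> \oo] --> expR (- l).
Proof.
move=> a01 al.
have a0 : a @ \oo --> (0 : R).
  have -> : a = (fun n => n.+1%:R^-1 * (n.+1%:R * a n)).
    by apply/funext => n; rewrite mulKf// pnatr_eq0.
  by rewrite -(mul0r l); apply: cvgM => //; exact: cvg_harmonic.
have CE (u : nat -> R) x : u @ \oo --> x -> expR (- u n) @[n --> \oo] --> expR (- x).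
  by move=> ux; apply: continuous_cvg; [exact: continuous_expR|exact: cvgN].
apply: (@squeeze_cvgr _ _ _ _ (fun n => expR (- (n.+1%:R * a n / (1 - a n))))
  (fun n => expR (- (n.+1%:R * a n)))); last 2 first.
- apply: CE; rewrite -[X in _ --> X](_ : l * (1 - 0)^-1 = _); last by rewrite subr0 invr1 mulr1.
  apply: cvgM => //; apply: cvgV; first by rewrite subr0 oner_neq0.
  by apply: cvgB => //; exact: cvg_cst.
- exact: CE.
near=> n.
have an : a n < 1 by near: n; apply: (cvgr_lt (0 : R)).
have /andP[an0 _] := a01 n.
have d0 : 0 < 1 - a n by rewrite subr_gt0.
rewrite -!mulrA -!mulrN !expRM_natl; apply/andP; split; rewrite lerXn2r ?nnegrE ?expR_ge0 ?(ltW d0)//.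
  rewrite mulrN expRN invf_ple ?posrE ?expR_gt0//.
  apply: le_trans (expR_ge1Dx _); rewrite -[leLHS]mul1r ler_pdivrMr// mulrDl mul1r divfK ?gt_eqF//.
  lra.
by have := expR_ge1Dx (- a n).
Unshelve. all: by end_near. Qed.

(** [product_rule] with indicators as generators. The linear identity extends because it says that
    [P] weighted by [G] and [P] weighted by [c] have the same image under [x i]. *)
Lemma sample_product (R : realType) n d (Om : measurableType d) (P : probability Om R)
  (x : nat -> Om -> n.-tuple R) (g : n.-tuple R -> R) k :
  (forall i, measurable_fun setT (x i)) -> mutually_indep P x ->
  measurable_fun setT g -> (forall u, 0 <= g u <= 1) ->
  (\int[P]_w (\prod_(i < k) g (x i w))%:E = \prod_(i < k) \int[P]_w (g (x i w))%:E)%E.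
Proof.
move=> mx indep mg g01.
pose I i : set (Om -> R) := [set f | exists2 A, measurable A & f = fun w => \1_A (x i w)].
pose J i : set (Om -> R) := [set f | exists h : n.-tuple R -> R,
  [/\ measurable_fun setT h, forall u, 0 <= h u <= 1 & f = h \o x i]].
have mxA i A : measurable A -> measurable (x i @^-1` A).
  by move=> mA; rewrite -[X in measurable X]setTI; exact: mx.
have IE i A : measurable A -> (\int[P]_w (\1_A (x i w))%:E = P (x i @^-1` A))%E.
  move=> mA; rewrite (_ : (fun w => _) = (fun w => (\1_(x i @^-1` A) w)%:E))//.
  by rewrite integral_indic ?setIT//; exact: mxA.
apply: (@product_rule _ _ _ P k I J _ _ _ _ (fun i => g \o x i)).
- move=> i _ [A mA ->]; split; last by move=> w; rewrite indicE; case: (_ \in _); rewrite ?lexx ?ler01.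
  exact: (measurableT_comp (measurable_indic mA) (mx i)).
- move=> i _ [h [mh h01 ->]]; split; last by move=> w; exact: h01.
  exact: (measurableT_comp mh (mx i)).
- move=> f If.
  have ex i : exists A, measurable A /\ ((i < k)%N -> f i = fun w => \1_A (x i w)).
    have [ik|ik] := ltnP i k; last by exists set0.
    by have [A mA ->] := If i ik; exists A.
  have [A HA] := choice ex.
  have mA i : measurable (A i) by have [] := HA i.
  have fE i : (i < k)%N -> f i = fun w => \1_(A i) (x i w) by have [] := HA i.
  transitivity (P (\bigcap_(i in `I_k) (x i @^-1` A i))).
    have -> : (fun w => (\prod_(i < k) f i w)%:E) =
        (fun w => (\1_(\bigcap_(i in `I_k) (x i @^-1` A i)) w)%:E).
      apply/funext => w; congr (_%:E).
      under eq_bigr => i _ do rewrite fE//.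
      have [H|H] := pselect (forall i : 'I_k, A i (x i w)).
        rewrite indicE mem_set ?big1// => [i _|i ik]; first by rewrite indicE mem_set.
        exact: (H (Ordinal ik)).
      rewrite indicE memNset; last by move=> h; apply: H => i; exact: (h i (ltn_ord i)).
      have [i Hi] : exists i : 'I_k, ~ A i (x i w) by apply: contrapT => h; apply: H => i; apply: contrapT => h2; apply: h; exists i.
      by rewrite (bigD1 i)//= indicE memNset// mul0r.
    rewrite integral_indic ?setIT//.
    apply: bigcap_measurableType => i _; exact: mxA.
  by rewrite indep//; apply: eq_bigr => i _; rewrite fE// IE.
- move=> i G c [mG G01] c0 H _ [h [mh h01 ->]].
  have -> : (c%:E * \int[P]_w ((h \o x i) w)%:E = \int[P]_w ((h (x i w))%:E * c%:E))%E.
    rewrite muleC ge0_integralZr//.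
      by apply/measurable_EFinP; exact: (measurableT_comp mh (mx i)).
    by move=> w _; rewrite lee_fin; have /andP[] := h01 (x i w).
  under eq_integral do rewrite EFinM.
  apply: (@integral_transfer _ _ _ _ _ _ _ P P (x i) (x i) G (fun=> c) (fun u => (h u)%:E)) => //.
  + by move=> s; have /andP[] := G01 s.
  + move=> A mA; under eq_integral do rewrite -EFinM.
    have -> := H (fun w => \1_A (x i w)); last by exists A.
    rewrite muleC ge0_integralZr//.
    by apply/measurable_EFinP; exact: (measurableT_comp (measurable_indic mA) (mx i)).
  + exact/measurable_EFinP.
  + by move=> u; rewrite lee_fin; have /andP[] := h01 u.
- by move=> i _; exists g.
Qed.

(** * Laplace functional of a Poisson process *)

Section NegExp.
Context {R : realType}.

(** The continuous extension of [e^{-x}] to [[0, +oo]]. Integrals against the process may be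
    infinite on some outcomes, and the value 0 keeps the associated coordinates in the closed
    cube. *)
Definition negexp (x : \bar R) : R := if x == +oo%E then 0 else expR (- fine x).

Lemma negexpy : negexp +oo%E = 0.
Proof. by rewrite /negexp eqxx. Qed.

Lemma negexp_fin r : negexp r%:E = expR (- r).
Proof. by []. Qed.

Lemma negexp01 x : (0 <= x)%E -> 0 <= negexp x <= 1.
Proof.
case: x => [r||//]; last by rewrite negexpy lexx ler01.
by rewrite lee_fin negexp_fin => r0; rewrite expR_ge0 -expR0 ler_expR oppr_le0.
Qed.

Lemma negexp0 : negexp 0%E = 1.
Proof. by rewrite negexp_fin oppr0 expR0. Qed.

Lemma negexpD x y : (0 <= x)%E -> (0 <= y)%E -> negexp (x + y)%E = negexp x * negexp y.
Proof.
case: x => [r||//]; case: y => [s||//] _ _; rewrite ?negexpy ?mulr0 ?mul0r//.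
by rewrite -EFinD !negexp_fin opprD expRD.
Qed.

Lemma negexp_sum k (f : 'I_k -> \bar R) : (forall i, 0 <= f i)%E ->
  negexp (\sum_(i < k) f i)%E = \prod_(i < k) negexp (f i).
Proof.
move=> f0; elim: k f f0 => [|k IH] f f0; first by rewrite !big_ord0 negexp0.
by rewrite !big_ord_recl negexpD// ?IH//; exact: sume_ge0.
Qed.

Lemma measurable_negexp : measurable_fun setT negexp.
Proof.
apply: measurable_fun_ifT => //.
  by apply: measurable_fun_eqe => //; exact: measurable_id.
apply: measurableT_comp; first exact: measurable_expR.
by apply: measurable_funN; exact: fine_measurable.
Qed.

Lemma cvg_negexp (u : nat -> \bar R) x : (0 <= x)%E -> (u @ \oo --> x)%E ->
  negexp (u n) @[n --> \oo] --> negexp x.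
Proof.
case: x => [r||//] x0 ux.
  have /fine_cvgP[fu cu] := ux.
  rewrite negexp_fin; apply: cvg_trans (_ : expR (- fine (u n)) @[n --> \oo] --> _); last first.
    by apply: continuous_cvg; [exact: continuous_expR|exact: cvgN].
  apply: near_eq_cvg; near=> n; rewrite /negexp.
  have : u n \is a fin_num by near: n.
  by case: (u n).
rewrite negexpy; apply/cvgrPdist_le => e e0; near=> n.
have un0 : (0 <= u n)%E by near: n; move/cvgeyPge : ux => /(_ 0).
rewrite sub0r normrN ger0_norm; last by have /andP[] := negexp01 un0.
have : ((- ln e)%:E <= u n)%E by near: n; move/cvgeyPge : ux => /(_ (- ln e)).
case: (u n) => [s||]//; rewrite ?negexpy ?(ltW e0)// lee_fin negexp_fin => h.
by rewrite -[leRHS](@lnK _ e) ?posrE// ler_expR lerNl.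
Unshelve. all: by end_near. Qed.

End NegExp.

Section CountIntegral.
Context {R : realType} d (Om : measurableType d) (P : probability Om R).

(** Enumerates all possible counts, with [+oo] at index 0 and the finite count [k] at index [k.+1],
    so that a sum over counts is an ordinary series. *)
Definition extnat (k : nat) : \bar R := if k is j.+1 then j%:R%:E else +oo%E.

Lemma extnat_inj : injective extnat.
Proof. by move=> [|i] [|j]//= [] /eqP; rewrite eqr_nat => /eqP ->. Qed.

Lemma count_integral (N : Om -> \bar R) (g : \bar R -> R) (G : Om -> R) :
  measurable_fun setT N -> (forall w, N w = +oo%E \/ exists k : nat, N w = k%:R%:E) ->
  measurable_fun setT g -> (forall x, (0 <= x)%E -> 0 <= g x) -> 
  measurable_fun setT G -> (forall w, 0 <= G w) ->
  (\int[P]_w (g (N w) * G w)%:E =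
   \sum_(0 <= k <oo) (g (extnat k))%:E *
     \int[P]_w ((\1_[set w | N w = extnat k] w) * G w)%:E)%E.
Proof.
move=> mN HN mg g0 mG G0.
have g0' k : 0 <= g (extnat k) by apply: g0; case: k => //= k; rewrite lee_fin.
have mS k : measurable [set w | N w = extnat k].
  rewrite -[X in measurable X]setTI; apply: (mN measurableT [set extnat k]).
  exact: emeasurable_set1.
have mI k : measurable_fun setT (fun w => (\1_[set w | N w = extnat k] w * G w)).
  by apply: measurable_funM => //; exact: measurable_indic.
have I0 k w : (0 <= (\1_[set w | N w = extnat k] w * G w)%:E)%E.
  by rewrite lee_fin mulr_ge0.
transitivity (\int[P]_w \sum_(0 <= k <oo)
    ((g (extnat k))%:E * (\1_[set w | N w = extnat k] w * G w)%:E))%E; last first.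
  rewrite integral_nneseries//.
  - apply: eq_eseriesr => k _; rewrite ge0_integralZl//; last by rewrite lee_fin.
    exact/measurable_EFinP.
  - by move=> k; apply: measurable_funeM; exact/measurable_EFinP.
  - by move=> k w _; rewrite mule_ge0// lee_fin.
apply: eq_integral => w _.
have [k Nk] : exists k, N w = extnat k.
  by have [->|[k ->]] := HN w; [exists 0%N|exists k.+1].
rewrite (@nneseriesD1 _ _ k xpredT) => [|i _|//]; last by rewrite mule_ge0// lee_fin.
rewrite eseries0 => [|i _ /= ik]; last first.
  rewrite indicE memNset ?mul0r ?mule0//= Nk => /extnat_inj ki.
  by rewrite ki eqxx in ik.
by rewrite adde0 indicE mem_set//= mul1r -EFinM Nk.
Qed.

End CountIntegral.

Section Poisson.
Context {R : realType}.

(** The exponential series at [m e^{-r}]: the Laplace transform of a Poisson variable of mean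
    [m]. *)
Lemma poisson_series (m r : R) :
  (\sum_(0 <= k <oo) (expR (- (r * k%:R)))%:E * (expR (- m) * m ^+ k / k`!%:R)%:E =
   (expR (- ((1 - expR (- r)) * m)))%:E)%E.
Proof.
apply: cvg_lim => //.
pose s k := expR (- m) * series (exp_coeff (m * expR (- r))) k.
have -> : (fun k => (\sum_(0 <= i < k) (expR (- (r * i%:R)))%:E *
    (expR (- m) * m ^+ i / i`!%:R)%:E)%E) = EFin \o s.
  apply/funext => k /=; rewrite /s /series/= mulr_sumr -sumEFin; apply: eq_bigr => i _.
  have -> : expR (- (r * i%:R)) = expR (- r) ^+ i by rewrite -expRM_natl mulrN [r * _]mulrC.
  by rewrite -EFinM /exp_coeff/= exprMn; congr (_%:E); ring.
apply: cvg_EFin; first exact: nearW.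
have -> : expR (- ((1 - expR (- r)) * m)) = expR (- m) * expR (m * expR (- r)).
  by rewrite -expRD; congr expR; ring.
apply: cvgMl_tmp; exact: is_cvg_series_exp_coeff.
Qed.

Context (n : nat) d (Om : measurableType d) (P : probability Om R).
Context (M : Om -> {measure set (R * n.-tuple R) -> \bar R}).
Context (mu : {measure set (R * n.-tuple R) -> \bar R}).
Hypothesis ppp : is_PPP P M mu.

Lemma laplace_count (B : set (R * n.-tuple R)) (r : R) : measurable B -> 0 <= r ->
  (\int[P]_w (negexp (r%:E * M w B))%:E = (negexp ((1 - expR (- r))%:E * mu B))%:E)%E.
Proof.
move=> mB; rewrite le_eqVlt => /orP[/eqP<-|r0].
  (* The case [r = 0] is separate because [0 * +oo = 0]: both sides are 1 even for an infinite
     count, whereas for [r > 0] an infinite count contributes 0. *)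
  rewrite oppr0 expR0 subrr mul0e negexp0.
  by under eq_integral do rewrite mul0e negexp0; exact: probability_integral_cst.
have [mM natM fin_case inf_case _] := ppp.
have e1 : 0 < 1 - expR (- r) by rewrite subr_gt0 -expR0 ltr_expR oppr_lt0.
have mg : measurable_fun setT (fun x => negexp (r%:E * x)%E).
  by apply: (measurableT_comp measurable_negexp); exact: measurable_funeM.
have g0 (x : \bar R) : (0 <= x)%E -> 0 <= negexp (r%:E * x)%E.
  by move=> x0; have /andP[] : 0 <= negexp (r%:E * x)%E <= 1 by apply: negexp01; rewrite mule_ge0// lee_fin ltW.
have ry : negexp (r%:E * +oo)%E = 0 by rewrite gt0_muley ?lte_fin// negexpy.
transitivity (\int[P]_w (negexp (r%:E * M w B) * 1)%:E)%E.
  by apply: eq_integral => w _; rewrite mulr1.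
have mS k : measurable [set w | M w B = extnat k].
  rewrite -[X in measurable X]setTI; apply: (mM B mB measurableT [set extnat k]).
  exact: emeasurable_set1.
rewrite (@count_integral _ _ _ P (fun w => M w B) (fun x => negexp (r%:E * x)%E) (fun=> 1))//;
  [|exact: mM|by move=> w; exact: natM].
under eq_eseriesr => k _.
  under eq_integral do rewrite mulr1.
  rewrite integral_indic// setIT.
over.
rewrite nneseries_recl//; last first.
  move=> k _; rewrite mule_ge0 ?lee_fin//; apply: g0; case: k => //= k; by rewrite lee_fin.
(* Index 0 of [extnat] is the count [+oo], whose Laplace factor is 0. *)
rewrite /= ry mul0e add0e.
rewrite -(@nneseries_addn _ _ 1)//; last first.
  move=> k; rewrite mule_ge0 ?lee_fin//; apply: g0; case: k => //= k; by rewrite lee_fin.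
under eq_eseriesr do rewrite addn1 /=.
(* For infinite intensity the count is almost surely infinite and both sides vanish. *)
have [muy|mufin] := eqVneq (mu B) +oo%E.
  rewrite muy gt0_muley ?lte_fin// negexpy eseries0// => k _ _.
  suff -> : P [set w | M w B = k%:R%:E] = 0%E by rewrite mule0.
  have compl0 : P (~` [set w | M w B = +oo%E]) = 0%E.
    rewrite probability_setC; last exact: mS 0%N.
    by rewrite inf_case// subee.
  apply/eqP; rewrite -measure_le0 -[leRHS]compl0; apply: le_measure; rewrite ?inE.
  - exact: mS k.+1.
  - exact: measurableC (mS 0%N).
  - by move=> w /= ->.
have mufin' : (mu B < +oo)%E by rewrite ltey.
have muE : mu B = (fine (mu B))%:E by rewrite fineK// ge0_fin_numE.
have -> : ((1 - expR (- r))%:E * mu B)%E = ((1 - expR (- r)) * fine (mu B))%:E.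
  by rewrite EFinM -muE.
apply: etrans (poisson_series (fine (mu B)) r); apply: eq_eseriesr => k _.
congr (_ * _)%E; exact: fin_case.
Qed.

End Poisson.

Section FiniteRange.
Context {R : realType} d (T : measurableType d) (f : T -> R) (rs : seq R).
Hypotheses (mf : measurable_fun setT f) (rs_uniq : uniq rs) (f_rs : forall z, f z \in rs).
Hypothesis rs_ge0 : forall r, r \in rs -> 0 <= r.

(** Indexed by all naturals because [is_PPP] takes sequences of sets; an index past the end reads
    the default value 0, and disjointness is claimed only below [size rs]. *)
Definition level i := f @^-1` [set rs`_i].

Lemma measurable_level i : measurable (level i).
Proof. by rewrite -[X in measurable X]setTI; exact: mf. Qed.

Lemma level_disjoint i j : (i < size rs)%N -> (j < size rs)%N -> i <> j ->
  level i `&` level j = set0.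
Proof.
move=> si sj ij; rewrite -subset0 => z [/= fi fj]; apply: ij; apply/eqP.
by rewrite -(nth_uniq 0 si sj rs_uniq) -fi -fj.
Qed.

Lemma finite_range_integral (m : {measure set T -> \bar R}) (h : R -> R) :
  (forall r, 0 <= r -> 0 <= h r) ->
  (\int[m]_z (h (f z))%:E = \sum_(i < size rs) (h rs`_i)%:E * m (level i))%E.
Proof.
move=> h0.
have h0' (i : 'I_(size rs)) : 0 <= h rs`_i by apply/h0/rs_ge0/mem_nth.
transitivity (\int[m]_z (\sum_(i < size rs) (h rs`_i)%:E * (\1_(level i) z)%:E))%E.
  apply: eq_integral => z _.
  have iz : (index (f z) rs < size rs)%N by rewrite index_mem.
  rewrite (bigD1 (Ordinal iz))//= big1 ?adde0 => [|i inz].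
    by rewrite indicE mem_set ?mule1 /level/= ?nth_index.
  rewrite indicE memNset ?mule0//= => fz; move: inz; rewrite -val_eqE/= fz index_uniq//.
  by rewrite eqxx.
rewrite ge0_integral_sum//.
- apply: eq_bigr => i _; rewrite ge0_integralZl//; last by rewrite lee_fin.
    by rewrite integral_indic ?setIT//; exact: measurable_level.
  by apply/measurable_EFinP/measurable_indic/measurable_level.
- move=> i; apply: measurable_funeM.
  by apply/measurable_EFinP/measurable_indic/measurable_level.
- by move=> i z _; rewrite mule_ge0// lee_fin.
Qed.

End FiniteRange.

Section Laplace.
Context {R : realType} (n : nat) d (Om : measurableType d) (P : probability Om R).
Context (M : Om -> {measure set (R * n.-tuple R) -> \bar R}).
Context (mu : {measure set (R * n.-tuple R) -> \bar R}).
Hypothesis ppp : is_PPP P M mu.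

(** The integral is a finite combination of counts of disjoint sets, so its Laplace transform
    factorises. In [product_rule] the generators are the events fixing one count; the identity
    extends to functions of a count because a count has countably many values. *)
Lemma laplace_simple (f : R * n.-tuple R -> R) (rs : seq R) :
  measurable_fun setT f -> uniq rs -> (forall z, f z \in rs) ->
  (forall r, r \in rs -> 0 <= r) ->
  (\int[P]_w (negexp (\int[M w]_z (f z)%:E))%:E =
   (negexp (\int[mu]_z (1 - expR (- f z))%:E))%:E)%E.
Proof.
move=> mf urs frs rs0; have [mM natM _ _ indep] := ppp.
pose k := size rs; pose N i w := M w (level f rs i).
have mN i : measurable_fun setT (N i) by apply: mM; exact: measurable_level.
have r0 i : 0 <= rs`_i.
  by have [ik|ik] := ltnP i (size rs); [apply: rs0; exact: mem_nth|rewrite nth_default].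
rewrite (finite_range_integral mf urs frs rs0 mu (h := fun x => 1 - expR (- x))); last first.
  by move=> r r0'; rewrite subr_ge0 -expR0 ler_expR oppr_le0.
rewrite negexp_sum; last first.
  by move=> i; rewrite mule_ge0// lee_fin subr_ge0 -expR0 ler_expR oppr_le0.
under eq_integral => w _.
  rewrite (finite_range_integral mf urs frs rs0 (M w) (h := id))//.
  rewrite negexp_sum; last by move=> i; rewrite mule_ge0 ?lee_fin.
over.
pose g i : Om -> R := fun w => negexp ((rs`_i)%:E * N i w)%E.
pose I i : set (Om -> R) := [set h | exists c, h = fun w => \1_[set w | N i w = c] w].
pose J i : set (Om -> R) := [set h | exists h' : \bar R -> R,
  [/\ measurable_fun setT h', forall x, (0 <= x)%E -> 0 <= h' x <= 1 & h = h' \o N i]].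
have mS i c : measurable [set w | N i w = c].
  rewrite -[X in measurable X]setTI; apply: (mN i measurableT [set c]).
  exact: emeasurable_set1.
have := @product_rule _ _ _ P k I J _ _ _ _ g.
move=> -> //.
- rewrite -prodEFin; apply: eq_bigr => i _; apply: (laplace_count ppp) => //.
  exact: measurable_level.
- move=> i _ [c ->]; split; last by move=> w; rewrite indicE; case: (_ \in _); rewrite ?lexx ?ler01.
  exact: measurable_indic.
- move=> i _ [h [mh h01 ->]]; split; last by move=> w; apply: h01; exact: measure_ge0.
  exact: (measurableT_comp mh (mN i)).
- move=> f' If.
  have ex i : exists c, (i < k)%N -> f' i = fun w => \1_[set w | N i w = c] w.
    by have [ik|ik] := ltnP i k; [have [c ->] := If i ik; exists c|exists 0%E].
  have [c fE] := choice ex.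
  transitivity (P (\bigcap_(i in `I_k) [set w | N i w = c i])).
    have -> : (fun w => (\prod_(i < k) f' i w)%:E) =
        (fun w => (\1_(\bigcap_(i in `I_k) [set w | N i w = c i]) w)%:E).
      apply/funext => w; congr (_%:E).
      under eq_bigr => i _ do rewrite fE//.
      have [H|H] := pselect (forall i : 'I_k, N i w = c i).
        rewrite indicE mem_set ?big1// => [i _|i ik]; first by rewrite indicE mem_set.
        exact: (H (Ordinal ik)).
      rewrite indicE memNset; last by move=> h; apply: H => i; exact: (h i (ltn_ord i)).
      have [i Hi] : exists i : 'I_k, ~ (N i w = c i).
        by apply: contrapT => h; apply: H => i; apply: contrapT => h2; apply: h; exists i.
      by rewrite (bigD1 i)//= indicE memNset// mul0r.
    rewrite integral_indic ?setIT//.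
    apply: bigcap_measurableType => i _; exact: mS.
  rewrite indep; last 2 first.
  - by move=> i; exact: measurable_level.
  - by move=> i j; exact: level_disjoint.
  by apply: eq_bigr => i _; rewrite fE// integral_indic ?setIT.
- move=> i G c [mG G01] c0 H _ [h [mh h01 ->]].
  have h0 x : (0 <= x)%E -> 0 <= h x by move=> /h01/andP[].
  have G0 w : 0 <= G w by have /andP[] := G01 w.
  have natN w : N i w = +oo%E \/ exists k : nat, N i w = k%:R%:E.
    by apply: natM; exact: measurable_level.
  rewrite (count_integral P (mN i) natN mh h0 mG G0).
  have -> : (\int[P]_w ((h \o N i) w)%:E = \int[P]_w (h (N i w) * 1)%:E)%E.
    by apply: eq_integral => w _; rewrite mulr1.
  rewrite (count_integral P (mN i) natN mh h0 (G := fun=> 1))//.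
  have e0 j : 0 <= h (extnat j) by apply: h0; case: j => //= j; rewrite lee_fin.
  rewrite -nneseriesZl//; last first.
    move=> j _; rewrite mule_ge0 ?lee_fin//; apply: integral_ge0 => w _.
    by rewrite lee_fin mulr1.
  apply: eq_eseriesr => j _; rewrite muleCA; congr (_ * _)%E.
  under [in RHS]eq_integral do rewrite mulr1.
  by apply: H; exists (extnat j).
- move=> i _; exists (fun x => negexp ((rs`_i)%:E * x)%E); split => //.
    by apply: (measurableT_comp measurable_negexp); exact: measurable_funeM.
  by move=> x x0; apply: negexp01; rewrite mule_ge0// lee_fin.
Qed.

End Laplace.

Lemma bounded_convergence {R : realType} d (Om : measurableType d) (P : probability Om R)
  (u : nat -> Om -> R) (f : Om -> R) (K : R) :
  (forall n, measurable_fun setT (u n)) -> (forall n w, `|u n w| <= K) ->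
  (forall w, u n w @[n --> \oo] --> f w) ->
  ((fun n => \int[P]_w (u n w)%:E) @ \oo --> \int[P]_w (f w)%:E)%E.
Proof.
move=> mu uK uf.
have mf : measurable_fun setT f by exact: (measurable_fun_cvg mu (fun w _ => uf w)).
have [] := @dominated_convergence _ _ _ P setT measurableT
  (fun n w => (u n w)%:E) (fun w => (f w)%:E) (fun=> K%:E).
- by move=> n; exact/measurable_EFinP.
- exact/measurable_EFinP.
- by apply: aeW => w _; apply: cvg_EFin; [exact: nearW|exact: uf].
- exact: finite_measure_integrable_cst.
- by apply: aeW => w n _; rewrite lee_fin.
by [].
Qed.

Section SimpleApproximation.
Context {R : realType} d (T : measurableType d) (f : T -> R).
Hypotheses (mf : measurable_fun setT f) (f0 : forall z, 0 <= f z).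
Import HBNNSimple.

Lemma simple_approximation : exists u : nat -> T -> R,
  [/\ forall n, measurable_fun setT (u n),
      forall n, exists rs : seq R, [/\ uniq rs, forall z, u n z \in rs & forall r, r \in rs -> 0 <= r],
      forall z, nondecreasing_seq (u ^~ z) &
      forall z, u n z @[n --> \oo] --> f z].
Proof.
have mEf : measurable_fun setT (EFin \o f) by exact/measurable_EFinP.
pose u := nnsfun_approx measurableT mEf.
exists (fun n => u n); split.
- by move=> n; exact: measurable_funPT.
- move=> n; exists (finmap.enum_fset (fset_set (range (u n)))); split; first exact: finmap.fset_uniq.
    by move=> z; rewrite in_fset_set//; apply/mem_set; exists z.
  by move=> r; rewrite in_fset_set// => /set_mem[z _ <-].
- by move=> z m n mn; exact/lefP/nd_nnsfun_approx.
- move=> z; have := @cvg_nnsfun_approx _ _ _ _ measurableT _ mEf (fun x _ => f0 x) z Logic.I.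
  by move/fine_cvgP => [].
Qed.

End SimpleApproximation.

Section Laplace.
Context {R : realType} (n : nat) d (Om : measurableType d) (P : probability Om R).
Context (M : Om -> {measure set (R * n.-tuple R) -> \bar R}).
Context (mu : {measure set (R * n.-tuple R) -> \bar R}).
Hypothesis ppp : is_PPP P M mu.

Let monotone_integral (m : {measure set (R * n.-tuple R) -> \bar R})
   (u : nat -> R * n.-tuple R -> R) (f : R * n.-tuple R -> R) :
  (forall k, measurable_fun setT (u k)) -> (forall k z, 0 <= u k z) ->
  (forall z, nondecreasing_seq (u ^~ z)) -> (forall z, u k z @[k --> \oo] --> f z) ->
  (\int[m]_z (u k z)%:E @[k --> \oo] --> \int[m]_z (f z)%:E)%E.
Proof.
move=> mu' u0 nd uf.
have := @cvg_monotone_convergence _ _ _ m setT measurableT (fun k z => (u k z)%:E).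
rewrite (_ : (fun x => _) = (fun z => (f z)%:E)); last first.
  by apply/funext => z; apply: cvg_lim => //; apply: cvg_EFin; [exact: nearW|exact: uf].
apply.
- by move=> k; exact/measurable_EFinP.
- by move=> k z _; rewrite lee_fin.
- by move=> z _ a b ab; rewrite lee_fin; exact: nd.
Qed.

(** The process comes with measurability of the counts of fixed sets; simple functions and monotone
    limits carry it to integrals. *)
Lemma measurable_random_integral (f : R * n.-tuple R -> R) :
  measurable_fun setT f -> (forall z, 0 <= f z) ->
  measurable_fun setT (fun w => \int[M w]_z (f z)%:E)%E.
Proof.
move=> mf f0; have [mM _ _ _ _] := ppp.
have [u [mu' ur nd uf]] := simple_approximation mf f0.
have u0 k z : 0 <= u k z by have [rs [_ h]] := ur k; apply.
apply: (@emeasurable_fun_cvg _ _ _ _ (fun k w => \int[M w]_z (u k z)%:E)%E).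
  move=> k; have [rs [urs frs rs0]] := ur k.
  under eq_fun do rewrite (finite_range_integral (mu' k) urs frs rs0 _ (h := id))//.
  apply: emeasurable_sum => i; apply: measurable_funeM; apply: mM.
  exact: measurable_level.
by move=> w _; exact: monotone_integral.
Qed.

(** Both sides pass to the limit along increasing simple functions: the left by bounded convergence,
    the right by monotone convergence, using the continuity of [negexp] up to [+oo]. *)
Lemma laplace_functional (f : R * n.-tuple R -> R) :
  measurable_fun setT f -> (forall z, 0 <= f z) ->
  (\int[P]_w (negexp (\int[M w]_z (f z)%:E))%:E =
   (negexp (\int[mu]_z (1 - expR (- f z))%:E))%:E)%E.
Proof.
move=> mf f0.
have [u [mu' ur nd uf]] := simple_approximation mf f0.
have u0 k z : 0 <= u k z by have [rs [_ h]] := ur k; apply.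
have ge0 (g : R * n.-tuple R -> R)
    (m : {measure set (R * n.-tuple R) -> \bar R}) : (forall z, 0 <= g z) -> (0 <= \int[m]_z (g z)%:E)%E.
  move=> g0; apply: integral_ge0 => z _; rewrite lee_fin; exact: g0.
have L : (\int[P]_w (negexp (\int[M w]_z (u k z)%:E))%:E @[k --> \oo] -->
    \int[P]_w (negexp (\int[M w]_z (f z)%:E))%:E)%E.
  apply: (@bounded_convergence _ _ _ _ _ _ 1).
  - move=> k; apply: (measurableT_comp measurable_negexp).
    by apply: measurable_random_integral.
  - move=> k w; have /andP[a b] := negexp01 (ge0 (u k) (M w) (u0 k)).
    by rewrite ger0_norm.
  - by move=> w; apply: cvg_negexp; [exact: ge0|exact: monotone_integral].
have E k : (\int[P]_w (negexp (\int[M w]_z (u k z)%:E))%:E =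
   (negexp (\int[mu]_z (1 - expR (- u k z))%:E))%:E)%E.
  by have [rs [urs frs rs0]] := ur k; exact: (laplace_simple ppp (mu' k) urs frs rs0).
rewrite (_ : (fun k => _) = (fun k => (negexp (\int[mu]_z (1 - expR (- u k z))%:E))%:E)) in L;
  last exact/funext.
have p0 (x : R) : 0 <= x -> 0 <= 1 - expR (- x).
  by move=> x0; rewrite subr_ge0 -expR0 ler_expR oppr_le0.
apply: (cvg_unique _ L) => //; apply: cvg_EFin; first exact: nearW.
apply: cvg_negexp; first by apply: ge0 => z; exact: p0.
apply: monotone_integral.
- move=> k; apply: measurable_funB => //; apply: (measurableT_comp (@measurable_expR R)).
  exact: measurable_funN.
- by move=> k z; exact: p0.
- by move=> z a b ab; rewrite lerB// ler_expR lerN2; exact: nd.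
- move=> z; apply: cvgB; first exact: cvg_cst.
  by apply: continuous_cvg; [exact: continuous_expR|apply: cvgN; exact: uf].
Qed.

End Laplace.

(** * The intensity as a measure *)

Section Intensity.
Context {R : realType} (n : nat) (nu : probability (n.-tuple R) R) (h : R -> R).
Hypotheses (mh : measurable_fun setT h) (h0 : forall y, 0 <= h y).

Definition weight (z : R * n.-tuple R) : R := if 0 <= z.1 then h z.1 else 0.

Lemma measurable_weight : measurable_fun setT weight.
Proof.
apply: measurable_fun_ifT => //.
- apply: (measurable_fun_ler (measurable_cst _)); exact: (@measurable_fst _ _ (measurableTypeR R)).
- apply: (measurableT_comp mh); exact: (@measurable_fst _ _ (measurableTypeR R)).
Qed.

Lemma weight_ge0 z : 0 <= weight z.
Proof. by rewrite /weight; case: ifP. Qed.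

Local Notation L := (@lebesgue_measure R \x nu)%E.

Let mweight := measurable_weight.

Let integral_weighted (I : {measure set (R * n.-tuple R) -> \bar R}) (F : R * n.-tuple R -> \bar R) :
  (forall B, measurable B -> I B = \int[L]_(z in B) (weight z)%:E)%E ->
  measurable_fun setT F -> (forall z, (0 <= F z)%E) ->
  (\int[I]_z F z = \int[@lebesgue_measure R]_(y in [set y : R | (0 <= y)%R])
     ((\int[nu]_th F (y, th)) * (h y)%:E))%E.
Proof.
move=> intensityE mF F0.
transitivity (\int[I]_z (F z * 1%:E))%E.
  by apply: eq_integral => z _; rewrite mule1.
rewrite (@integral_transfer _ _ _ _ _ _ _ I L id id (fun=> 1) weight F)//; last 2 first.
- by move=> z; exact: weight_ge0.
- move=> A mA.
  under eq_integral do rewrite mule1.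
  transitivity (I A); first by rewrite integral_indic// setIT.
  rewrite intensityE// [LHS]integral_mkcond.
  apply: eq_integral => z _; rewrite patchE indicE; case: (z \in A); by rewrite ?mul1e ?mul0e.
have mFw : measurable_fun setT (fun z : measurableTypeR R * n.-tuple R => F z * (weight z)%:E)%E.
  by apply: emeasurable_funM => //; apply/measurable_EFinP.
apply: (etrans (@fubini_tonelli1 _ _ _ _ _ (@lebesgue_measure R) nu _ mFw _)).
  by move=> z; rewrite mule_ge0// lee_fin weight_ge0.
rewrite [RHS]integral_mkcond; apply: eq_integral => y _; rewrite patchE.
have mFy : measurable_fun setT (fun th => F (y, th)) by exact: (measurableT_comp mF (pair1_measurable y)).
transitivity ((\int[nu]_th F (y, th)) * (if (0 <= y)%R then h y else 0)%:E)%E.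
  have w0 : (0 <= (weight (y, tzero n))%:E)%E by rewrite lee_fin weight_ge0.
  exact: (ge0_integralZr nu measurableT mFy (fun th _ => F0 (y, th)) w0).
case: ifPn => [y0|yn]; first by rewrite mem_set.
by rewrite memNset ?mule0//= ; apply/negP.
Qed.

(** [intensity] is a bare set function. Taking the proofs of measurability and nonnegativity as
    arguments lets a measure structure be attached to this head symbol, while the value remains
    convertible to [intensity nu h]. *)
Definition intensity_measure of measurable_fun setT h & (forall y, 0 <= h y) :=
  intensity nu h.

Local Notation I := (intensity_measure mh h0).
Let intensityE B : measurable B -> I B = (\int[L]_(z in B) (weight z)%:E)%E.
Proof.
move=> mB; rewrite [RHS]integral_mkcond /I /intensity [LHS]integral_mkcond.
have -> : ((fun z => (weight z)%:E) \_ B) = (fun z => (\1_B z)%:E * (weight z)%:E)%E.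
  apply/funext => z; rewrite patchE indicE; case: (z \in B); by rewrite ?mul1e ?mul0e.
have mFw : measurable_fun setT (fun z : measurableTypeR R * n.-tuple R => (\1_B z)%:E * (weight z)%:E)%E.
  by apply: emeasurable_funM; apply/measurable_EFinP => //; exact: measurable_indic.
apply: esym; apply: (etrans (@fubini_tonelli1 _ _ _ _ _ (@lebesgue_measure R) nu _ mFw _)).
  by move=> z; rewrite mule_ge0// lee_fin ?weight_ge0.
apply: eq_integral => y _; rewrite patchE /fubini_F.
have mFy : measurable_fun setT (fun th : n.-tuple R => (\1_B (y, th))%:E : \bar R).
  apply/measurable_EFinP; apply: (measurableT_comp _ (pair1_measurable y)).
  exact: measurable_indic.
case: ifPn => [/set_mem/= y0|yn].
  by apply: eq_integral => th _; rewrite -EFinM /weight/= y0.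
apply: integral0_eq => th _.
rewrite /weight/= ifF ?mule0//; apply/negP => y0; move/negP : yn; apply; exact: mem_set.
Qed.

Let intensity0 : I set0 = 0%E.
Proof. by rewrite intensityE// integral_set0. Qed.

Let intensity_ge0 B : (0 <= I B)%E.
Proof.
apply: integral_ge0 => y _; apply: integral_ge0 => th _; rewrite lee_fin mulr_ge0//.
Qed.

Let intensity_sigma_additive : semi_sigma_additive I.
Proof.
move=> F mF tF mUF; rewrite intensityE//.
under eq_fun do under eq_bigr do rewrite intensityE//.
rewrite ge0_integral_bigcup//.
- apply: is_cvg_ereal_nneg_natsum_cond => k _ _; apply: integral_ge0 => z _.
  by rewrite lee_fin weight_ge0.
- by apply/measurable_EFinP/measurable_funTS.
- by move=> z _; rewrite lee_fin weight_ge0.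
Qed.

HB.instance Definition _ := isMeasure.Build _ _ _ I intensity0 intensity_ge0 intensity_sigma_additive.

Lemma integral_intensity (F : R * n.-tuple R -> \bar R) :
  measurable_fun setT F -> (forall z, (0 <= F z)%E) ->
  (\int[I]_z F z = \int[@lebesgue_measure R]_(y in [set y : R | (0 <= y)%R])
     ((\int[nu]_th F (y, th)) * (h y)%:E))%E.
Proof. exact: (integral_weighted intensityE). Qed.

End Intensity.

Lemma measurable_section d1 d2 d3 (T1 : measurableType d1) (T2 : measurableType d2)
  (T3 : measurableType d3) (G : T1 * T2 -> T3) y :
  measurable_fun setT G -> measurable_fun setT (fun th => G (y, th)).
Proof. by move=> mG; exact: (measurableT_comp mG (pair1_measurable y)). Qed.

(** * The Poisson exponent in polar coordinates *)

Section PoissonExponents.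
Context {R : realType} (m : nat) (q : m.+1.-tuple R) (nu : probability (m.+1.-tuple R) R).
Hypotheses (m0 : (0 < m)%N) (Sq : sphere m.+1 q) (nuq : uniform_tsphere q nu).
Variables (s0 sw : R) (a : m.+1.-tuple R).
Hypotheses (s00 : 0 <= s0) (sw0 : 0 <= sw).

Local Notation leb := (@lebesgue_measure R).
Local Notation T := (R * m.+1.-tuple R)%type.

Definition point_expo (z : T) : R := expo s0 sw z.1 (Num.sqrt (2 * z.1) * dotv z.2 a).

Definition mark (z : T) : R := \1_(ppp_dom q) z * point_expo z.

Lemma measurable_ppp_dom : measurable (ppp_dom q).
Proof.
rewrite (_ : ppp_dom q = ((fun z : T => z.1) @^-1` `[0, +oo[) `&` ((fun z : T => z.2) @^-1` tsphere q)).
  apply: measurableI; rewrite -[X in measurable X]setTI.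
    by apply: (@measurable_fst _ _ (measurableTypeR R)).
  by apply: measurable_snd => //; exact: measurable_tsphere.
by apply/seteqP; split => z; rewrite /= in_itv/= andbT.
Qed.

Let measurable_fst_real : measurable_fun setT (fun z : T => z.1).
Proof. exact: (@measurable_fst _ _ (measurableTypeR R)). Qed.

Let measurable_pairing : measurable_fun setT
  (fun z : T => Num.sqrt (2 * z.1) * dotv z.2 a).
Proof.
apply: measurable_funM.
  have ms : measurable_fun setT (Num.sqrt : R -> R).
    by apply: continuous_measurable_fun; exact: sqrt_continuous.
  by apply: (measurableT_comp ms); exact: measurable_funM.
exact: measurable_dotv.
Qed.

Lemma measurable_mark : measurable_fun setT mark.
Proof.
apply: measurable_funM; first exact: (measurable_indic measurable_ppp_dom).
exact: measurable_expo.
Qed.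

Lemma mark_ge0 z : 0 <= mark z.
Proof. by rewrite mulr_ge0 ?expo_ge0. Qed.

Definition radial_weight (c y : R) : R := c * (@radial_const R m * y `^ (m%:R / 2 - 1)).

Lemma measurable_radial_weight c : measurable_fun setT (radial_weight c).
Proof.
by apply: measurable_funM => //; apply: measurable_funM => //; exact: measurable_powR.
Qed.

Lemma radial_weight_ge0 c : 0 <= c -> forall y, 0 <= radial_weight c y.
Proof.
by move=> c0 y; do 2 apply: mulr_ge0 => //; [exact: radial_const_ge0|exact: powR_ge0].
Qed.

Lemma limit_mass_fin : limit_mass a nu s0 sw \is a fin_num.
Proof.
rewrite ge0_fin_numE; last by do 2 (apply: integral_ge0 => ? _); rewrite lee_fin damp_ge0.
have h12 : (0 : R) < 1 / 2 by rewrite divr_gt0.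
(* Finiteness was derived from dominated convergence along a scaling sequence on a cap; [b_n = n+1]
   and [T0 = 1/2] are an admissible choice. *)
apply: (limit_mass_lty q a nu s00 sw0 h12 (lexx _) (b := fun n => n.+1%:R)) => //.
have := @cvgr_idn R; rewrite -cvg_shiftS; exact.
Qed.

Let radial_integral c (c0 : 0 <= c) (G g : T -> R) :
  measurable_fun setT G -> measurable_fun setT g -> (forall z, 0 <= G z) -> (forall z, 0 <= g z) ->
  (forall y th, 0 <= y -> tsphere q th -> G (y, th) = g (y, th)) ->
  (\int[intensity_measure nu (measurable_radial_weight c) (radial_weight_ge0 c0)]_z (G z)%:E =
   c%:E * \int[lam m]_z \int[nu]_th (g (half_sqr z, th))%:E)%E.
Proof.
move=> mG mg G0 g0 Gg.
have {}mG : measurable_fun setT (fun z => (G z)%:E) by exact/measurable_EFinP.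
have {}mg : measurable_fun setT (fun z => (g z)%:E) by exact/measurable_EFinP.
rewrite integral_intensity//.
have kP : exists k : R -> \bar R, [/\ measurable_fun setT k, forall y, (0 <= k y)%E &
    forall y, k y = \int[nu]_th (g (y, th))%:E]%E.
  exists (fun y => \int[nu]_th (g (y, th))%:E)%E; split => //.
    by apply: (measurable_fun_fubini_tonelli_F (fun z => (g z)%:E)) => // z; rewrite lee_fin.
  by move=> y; apply: integral_ge0 => th _; rewrite lee_fin.
have [k [mk k0 kE]] := kP.
transitivity (\int[leb]_(y in [set y : R | (0 <= y)%R])
   ((c%:E * k y) * (@radial_const R m * y `^ (m%:R / 2 - 1))%:E))%E.
  apply: eq_integral => y; rewrite inE/= => y0.
  rewrite /radial_weight EFinM muleA [(c%:E * _)%E]muleC kE; congr (_ * _ * _)%E.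
  apply: (integral_tsphere_eq nuq) => [||th Hth].
  - exact: (measurable_section y mG).
  - exact: (measurable_section y mg).
  - by rewrite Gg.
rewrite -lam_radial//; last 2 first.
- exact: measurable_funeM.
- by move=> y; rewrite mule_ge0// lee_fin.
rewrite ge0_integralZl//; last by apply: (measurableT_comp mk); exact: measurable_half_sqr.
by under eq_integral do rewrite kE.
Qed.

(** Here the two computations meet: with [y = |z|^2 / 2] one has [sqrt(2y) = |z|], and polar
    coordinates turn the intensity integral into the [limit_mass] found for the sample. *)
Lemma mark_mass c (c0 : 0 <= c) :
  (\int[intensity_measure nu (measurable_radial_weight c) (radial_weight_ge0 c0)]_z
     (1 - expR (- mark z))%:E)%E = (c * fine (limit_mass a nu s0 sw))%:E.
Proof.
rewrite EFinM (fineK limit_mass_fin).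
apply: etrans (radial_integral c0 (G := fun z => 1 - expR (- mark z)) (g := fun z => damp s0 sw z.1 (Num.sqrt (2 * z.1) * dotv z.2 a)) _ _ _ _ _) _.
- apply: measurable_funB => //; apply: (measurableT_comp (@measurable_expR R)).
  by apply: measurable_funN; exact: measurable_mark.
- exact: measurable_damp.
- by move=> z; rewrite subr_ge0 -expR0 ler_expR oppr_le0 mark_ge0.
- by move=> z; exact: damp_ge0.
- by move=> y th y0 Hth; rewrite /mark indicE mem_set ?mul1r.
have e (z : m.-tuple R) : Num.sqrt (2 * half_sqr z) = enorm z.
  by rewrite /half_sqr mulrC divfK.
rewrite /limit_mass; apply: (congr1 (fun v : \bar R => c%:E * v)%E).
apply: eq_integral => z _.
apply: eq_integral => th _.
by rewrite /limit_damp -e.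
Qed.

End PoissonExponents.

(** * Constants and scaling *)

Section Scaling.
Context {R : realType}.

(** Since [1/alpha = m/2] and [sphere_area m / m = |B^m|], the quotient [C(q) / alpha] is [rho q]
    times [2^{m/2} |B^m| m/2], that is [rho q * radial_const]. *)
Lemma intensity_weightE m (rho : m.+1.-tuple R -> R) q (gamma : R) : (0 < m)%N ->
  (fun y => Cq rho q / (alpha m.+1 * gamma `^ (alpha m.+1)^-1) * y `^ ((alpha m.+1)^-1 - 1)) =
  radial_weight m (rho q / gamma `^ (m%:R / 2)).
Proof.
move=> m0; apply/funext => y.
have m1 : (m%:R : R) != 0 by rewrite pnatr_eq0 -lt0n.
have aE : (alpha m.+1 : R)^-1 = m%:R / 2 by rewrite /alpha subSS subn0 invf_div.
have sE : sphere_area m = m%:R * fine (lebn (@unit_ball R m)).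
  rewrite /sphere_area fineM//= -lam_unit_ball ge0_fin_numE ?measure_ge0//.
  exact: lam_unit_ball_lty.
rewrite /radial_weight /radial_const aE /Cq aE /alpha subSS subn0 sE invfM invf_div.
set g := (gamma `^ _)^-1.
by field.
Qed.

Lemma cvg_powR (u : nat -> R) (g p : R) : 0 < g -> u @ \oo --> g ->
  u n `^ p @[n --> \oo] --> g `^ p.
Proof.
move=> g0 ug; rewrite /powR (gt_eqF g0).
apply: cvg_trans (_ : expR (p * ln (u n)) @[n --> \oo] --> _).
  apply: near_eq_cvg; near=> n; rewrite gt_eqF//.
  by near: n; exact: (cvgr_gt g).
apply: continuous_cvg; first exact: continuous_expR.
apply: cvgMl_tmp; apply: continuous_cvg => //; exact: continuous_ln.
Unshelve. all: by end_near. Qed.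

(** Because [alpha m/2 = 1], the quotient [n / beta_n^{m/2}] is [(beta_n n^{-alpha})^{-m/2}]. The
    shift of index avoids [beta 0], whose sign is not prescribed. *)
Lemma bandwidth_cvg m (beta : nat -> R) (gamma : R) : (0 < m)%N ->
  (forall k, (0 < k)%N -> 0 < beta k) -> 0 < gamma ->
  (fun k => beta k * k%:R `^ (- alpha m.+1)) @ \oo --> gamma ->
  (beta n.+1 @[n --> \oo] --> +oo) /\
  (n.+1%:R / Num.sqrt (beta n.+1) ^+ m @[n --> \oo] --> (gamma `^ (m%:R / 2))^-1).
Proof.
move=> m0 b0 g0; rewrite -cvg_shiftS /= => H.
have m1 : (0 : R) < m%:R by rewrite ltr0n.
have a0 : 0 < alpha m.+1 :> R by rewrite /alpha subSS subn0 divr_gt0.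
have aE : (alpha m.+1 : R) * (m%:R / 2) = 1.
  by rewrite /alpha subSS subn0; field; rewrite gt_eqF.
split.
  have B (n : nat) : beta n.+1 = (beta n.+1 * n.+1%:R `^ (- alpha m.+1)) * n.+1%:R `^ alpha m.+1.
    by rewrite -mulrA powRN mulVf ?mulr1// gt_eqF// powR_gt0.
  apply/cvgryPge => A; near=> n; rewrite B.
  have h1 : gamma / 2 <= beta n.+1 * n.+1%:R `^ (- alpha m.+1).
    by near: n; apply: (cvgr_ge gamma) => //; rewrite ltr_pdivrMr// ltr_pMr// ltr1n.
  (* From [n+1 >= K^{m/2}] follows [(n+1)^alpha >= K], and then [gamma/2 * K >= A]. The maximum with
     1 keeps [K] nonnegative when [A] is negative. *)
  set K := Num.max 1 (2 * A / gamma).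
  have h2 : K `^ (m%:R / 2) <= n.+1%:R.
    near: n; have := @cvgr_idn R; rewrite -cvg_shiftS => /cvgryPge; exact.
  have h3 : K <= n.+1%:R `^ alpha m.+1.
    have K0 : 0 <= K by rewrite le_max ler01.
    have KE : K = (K `^ (m%:R / 2)) `^ alpha m.+1 by rewrite -powRrM mulrC aE powRr1.
    by rewrite [leLHS]KE ge0_ler_powR// ?nnegrE ?powR_ge0 ?(ltW a0).
  apply: (@le_trans _ _ (gamma / 2 * K)); last by rewrite ler_pM// ?divr_ge0 ?(ltW g0)// le_max ler01.
  apply: (@le_trans _ _ (gamma / 2 * (2 * A / gamma))).
    by rewrite le_eqVlt; apply/orP; left; apply/eqP; field; rewrite gt_eqF.
  by rewrite ler_pM2l ?divr_gt0// le_max lexx orbT.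
have -> : (fun n => n.+1%:R / Num.sqrt (beta n.+1) ^+ m) =
    (fun n => ((beta n.+1 * n.+1%:R `^ (- alpha m.+1)) `^ (m%:R / 2))^-1).
  apply/funext => n; rewrite powRM ?powR_ge0 ?(ltW (b0 _ _))//.
  rewrite -powRrM mulNr aE powR_inv1// invfM invrK [RHS]mulrC; congr (_ * _^-1).
  by rewrite -powR12_sqrt ?(ltW (b0 _ _))// -powR_mulrn ?powR_ge0// -powRrM mulrC.
apply: cvgV; first by rewrite gt_eqF// powR_gt0.
exact: cvg_powR.
Unshelve. all: by end_near. Qed.

End Scaling.

(** * Bernstein polynomials and the moment method *)

Section Bernstein.
Context {R : realType} {k : nat}.
Implicit Types (u : 'I_k -> R) (c : 'I_k -> nat) (f g : ('I_k -> nat) -> R).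

Definition incr (j : 'I_k) c : 'I_k -> nat := fun i => if i == j then (c i).+1 else c i.

(* Expectation of [f] at the end of the random walk started at [c] whose successive steps
   increment each listed coordinate [j] with probability [u j]; with every coordinate listed
   [N] times it is the multivariate Bernstein operator. *)
Fixpoint walk (js : seq 'I_k) u f c : R :=
  if js is j :: js' then u j * walk js' u f (incr j c) + (1 - u j) * walk js' u f c else f c.

Lemma walkD js u f g c : walk js u (fun x => f x + g x) c = walk js u f c + walk js u g c.
Proof. by elim: js c => //= j js IH c; rewrite !IH; ring. Qed.

Lemma walkZ js u a f c : walk js u (fun x => a * f x) c = a * walk js u f c.
Proof. by elim: js c => //= j js IH c; rewrite !IH; ring. Qed.

Lemma walk_cst js u a c : walk js u (fun=> a) c = a.
Proof. by elim: js c => //= j js IH c; rewrite !IH; ring. Qed.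

Lemma walk_sum js u n (f : 'I_n -> ('I_k -> nat) -> R) c :
  walk js u (fun x => \sum_(i < n) f i x) c = \sum_(i < n) walk js u (f i) c.
Proof.
elim: n f => [|n IH] f.
  rewrite big_ord0 -[RHS](walk_cst js u 0 c); congr (walk _ _ _ _).
  by apply/funext => x; rewrite big_ord0.
rewrite big_ord_recl -IH -walkD; congr (walk _ _ _ _).
by apply/funext => x; rewrite big_ord_recl.
Qed.

Lemma walk_le js u f g c : (forall i, 0 <= u i <= 1) -> (forall x, f x <= g x) ->
  walk js u f c <= walk js u g c.
Proof.
move=> u01 fg; elim: js c => //= j js IH c; have /andP[u0 u1] := u01 j.
by rewrite lerD// ler_wpM2l// subr_ge0.
Qed.

Lemma walk_norm js u f c : (forall i, 0 <= u i <= 1) ->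
  `|walk js u f c| <= walk js u (fun x => `|f x|) c.
Proof.
move=> u01; elim: js c => //= j js IH c; have /andP[u0 u1] := u01 j.
apply: le_trans (ler_normD _ _) _; rewrite !normrM (ger0_norm u0) (@ger0_norm _ (1 - u j)) ?subr_ge0//.
by rewrite lerD// ler_wpM2l// subr_ge0.
Qed.

(** Squared bias plus binomial variance: only the steps listing [j] move the coordinate [j]. *)
Lemma walk_variance js u j y c :
  walk js u (fun x => ((x j)%:R - y) ^+ 2) c =
  ((c j)%:R + (count_mem j js)%:R * u j - y) ^+ 2 + (count_mem j js)%:R * u j * (1 - u j).
Proof.
elim: js c => [|i js IH] c /=; first by ring.
rewrite !IH /incr [j == i]eq_sym natrD; case: eqVneq => [->|_]; last by rewrite /=; ring.
by rewrite -natr1 /=; ring.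
Qed.

Definition steps N := flatten (nseq N (enum 'I_k)).

Lemma count_steps N j : count_mem j (steps N) = N.
Proof.
rewrite /steps count_flatten map_nseq sumn_nseq count_uniq_mem ?enum_uniq// mem_enum.
by rewrite mul1n.
Qed.

Definition cube : set ('I_k -> R) := [set u | forall i, 0 <= u i <= 1].

Definition bernstein N (Phi : ('I_k -> R) -> R) u : R :=
  walk (steps N.+1) u (fun x => Phi (fun i => (x i)%:R / N.+1%:R)) (fun=> 0%N).

(** Chebyshev's inequality in pointwise form: a node near [u] costs [e], and a node at distance at
    least [del] in some coordinate costs [2K], which is at most [2K / del^2] times the squared
    distance. The walk averages that distance to at most [k / (N+1)]. *)
Lemma bernstein_error N Phi u (K e del : R) : cube u -> 0 < del ->
  (forall v, `|Phi v| <= K) ->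
  (forall v, (forall i, `|v i - u i| < del) -> `|Phi v - Phi u| <= e) ->
  `|bernstein N Phi u - Phi u| <= e + 2 * K / del ^+ 2 * (k%:R / N.+1%:R).
Proof.
move=> u01 del0 PK Pe; have n0 : (0 : R) < N.+1%:R by [].
have K0 : 0 <= K by apply: le_trans (PK u).
have e0 : 0 <= e.
  apply: le_trans (Pe u _); first by rewrite normr_ge0.
  by move=> i; rewrite subrr normr0.
have -> : bernstein N Phi u - Phi u =
    walk (steps N.+1) u (fun x => Phi (fun i => (x i)%:R / N.+1%:R) + - Phi u) (fun=> 0%N).
  by rewrite walkD walk_cst.
apply: le_trans (walk_norm _ _ _ u01) _.
pose g (x : 'I_k -> nat) : R :=
  e + 2 * K / del ^+ 2 / N.+1%:R ^+ 2 * \sum_(i < k) ((x i)%:R - N.+1%:R * u i) ^+ 2.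
apply: (@le_trans _ _ (walk (steps N.+1) u g (fun=> 0%N))).
  apply: walk_le => // x; rewrite /g.
  have S0 i : 0 <= ((x i)%:R - N.+1%:R * u i) ^+ 2 :> R by rewrite sqr_ge0.
  have C0 : 0 <= 2 * K / del ^+ 2 / N.+1%:R ^+ 2.
    by rewrite !divr_ge0 ?sqr_ge0// mulr_ge0.
  have [near_u|/existsNP[i /negP]] := pselect (forall i, `|(x i)%:R / N.+1%:R - u i| < del).
    by apply: le_trans (Pe _ near_u) _; rewrite lerDl mulr_ge0// sumr_ge0.
  rewrite -leNgt => far.
  apply: (@le_trans _ _ (2 * K)).
    apply: le_trans (ler_normB _ _) _; have := PK u; have := PK (fun i => (x i)%:R / N.+1%:R).
    by lra.
  apply: ler_wpDl => //; rewrite (bigD1 i)//=.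
  have far2 : del ^+ 2 * N.+1%:R ^+ 2 <= ((x i)%:R - N.+1%:R * u i) ^+ 2.
    have -> : (x i)%:R - N.+1%:R * u i = ((x i)%:R / N.+1%:R - u i) * N.+1%:R.
      by field; rewrite gt_eqF.
    rewrite exprMn ler_wpM2r ?sqr_ge0// -[leRHS]real_normK ?num_real//.
    by rewrite lerXn2r ?nnegrE ?(ltW del0).
  apply: (@le_trans _ _ (2 * K / del ^+ 2 / N.+1%:R ^+ 2 * (del ^+ 2 * N.+1%:R ^+ 2))).
    by rewrite le_eqVlt; apply/orP; left; apply/eqP; field; rewrite !gt_eqF.
  by rewrite ler_wpM2l// ler_wpDr// sumr_ge0.
rewrite /g walkD walk_cst lerD2l walkZ walk_sum.
under eq_bigr do rewrite walk_variance count_steps.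
have sk : \sum_(i < k) ((0%:R + N.+1%:R * u i - N.+1%:R * u i) ^+ 2 + N.+1%:R * u i * (1 - u i)) <= k%:R * N.+1%:R :> R.
  apply: (@le_trans _ _ (\sum_(i < k) N.+1%:R)); last by rewrite sumr_const card_ord mulr_natl.
  apply: ler_sum => i _; have /andP[u0 u1] := u01 i.
  have h : u i * (1 - u i) <= 1 by nra.
  by rewrite add0r subrr expr0n/= add0r -mulrA ler_piMr.
have C0 : 0 <= 2 * K / del ^+ 2 / N.+1%:R ^+ 2 by rewrite !divr_ge0 ?sqr_ge0// mulr_ge0.
apply: le_trans (ler_wpM2l C0 sk) _.
by rewrite le_eqVlt; apply/orP; left; apply/eqP; field; rewrite !gt_eqF.
Qed.

End Bernstein.

Section Moments.
Context {R : realType} {k : nat}.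
Implicit Types (u v : 'I_k -> R) (Phi p : ('I_k -> R) -> R).

Definition cont_coord Phi := forall u e, 0 < e -> exists2 del, 0 < del &
  forall v, (forall i, `|v i - u i| < del) -> `|Phi v - Phi u| < e.

(** Heine's theorem with only the base point [u] in the compact cube, since [bernstein_error]
    compares it with an arbitrary [v]. Row vectors carry the compactness of a product of
    segments. *)
Lemma uniform_on_cube Phi e : cont_coord Phi -> 0 < e -> exists2 del, 0 < del &
  forall u v, cube u -> (forall i, `|v i - u i| < del) -> `|Phi v - Phi u| <= e.
Proof.
move=> cPhi e0.
have /compact_near_coveringP/(_ R 0^'+ (fun del (x : 'rV[R]_k) => forall v,
    (forall i, `|v i - x 0 i| < del) -> `|Phi v - Phi (fun i => x 0 i)| <= e)) :=
  @rV_compact R k (fun=> `[0, 1]%classic) (fun=> @segment_compact R 0 1).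
move=> /(_ _) H.
have {}H : \forall del \near 0^'+, forall x : 'rV[R]_k, (forall i, `[0, 1]%classic (x 0 i)) ->
    forall v, (forall i, `|v i - x 0 i| < del) -> `|Phi v - Phi (fun i => x 0 i)| <= e.
  apply: H => x _.
  have [del del0 Hdel] := cPhi (fun i => x 0 i) (e / 2) (divr_gt0 e0 (ltr0n _ 2)).
  exists (ball x (del / 2), [set d | d < del / 2]).
    split; first by apply: nbhsx_ballx; exact: divr_gt0.
    by apply: nbhs_right_lt; exact: divr_gt0.
  move=> [y d] [/= yx dd] v vy.
  have yx' i : `|y 0 i - x 0 i| < del / 2 by rewrite distrC; exact: (yx.2 0 i).
  have h1 : `|Phi (fun i => y 0 i) - Phi (fun i => x 0 i)| < e / 2.
    by apply: Hdel => i; apply: lt_trans (yx' i) _; lra.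
  have h2 : `|Phi v - Phi (fun i => x 0 i)| < e / 2.
    apply: Hdel => i; rewrite -(subrKA (y 0 i)); apply: le_lt_trans (ler_normD _ _) _.
    by have := vy i; have := yx' i; lra.
  rewrite -(subrKA (Phi (fun i => x 0 i))); apply: le_trans (ler_normD _ _) _.
  by rewrite [X in _ + X]distrC; lra.
near (0 : R)^'+ => del; exists del => // u v u01 vu.
have Hd : forall x : 'rV[R]_k, (forall i, `[0, 1]%classic (x 0 i)) ->
    forall v, (forall i, `|v i - x 0 i| < del) -> `|Phi v - Phi (fun i => x 0 i)| <= e.
  by near: del; exact: H.
have uE : (fun i => (\row_i u i) 0 i) = u by apply/funext => i; rewrite mxE.
rewrite -uE; apply: Hd => i; rewrite mxE; last exact: vu.
by rewrite /= in_itv/=; exact: u01.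
Unshelve. all: by end_near. Qed.

End Moments.

Lemma integrable_bounded (R : realType) d (Om : measurableType d) (P : probability Om R) (f : Om -> R) K :
  measurable_fun setT f -> (forall w, `|f w| <= K) -> P.-integrable setT (EFin \o f).
Proof.
move=> mf fK; apply: measurable_bounded_integrable => //.
  by apply: le_lt_trans (probability_le1 P measurableT) _; exact: ltry.
by exists K; split; [exact: num_real|move=> x Kx w _ /=; exact: le_trans (fK w) (ltW Kx)].
Qed.

Section MomentConvergence.
Context {R : realType} {k : nat}.
Implicit Types (u v : 'I_k -> R) (Phi p : ('I_k -> R) -> R).

Lemma bernstein_cvg Phi K : cont_coord Phi -> (forall v, `|Phi v| <= K) ->
  forall e, 0 < e -> exists N0, forall N, (N0 <= N)%N -> forall u, cube u ->
    `|bernstein N Phi u - Phi u| <= e.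
Proof.
move=> cPhi PK e e0.
have [del del0 H] := uniform_on_cube cPhi (divr_gt0 e0 (ltr0n _ 2)).
pose C := 2 * K / del ^+ 2 * k%:R.
have Cc : C * N.+1%:R^-1 @[N --> \oo] --> (0 : R).
  by rewrite -(mulr0 C); apply: cvgMl_tmp; exact: cvg_harmonic.
have [N0 _ HN] : \forall N \near \oo, C * N.+1%:R^-1 < e / 2.
  by apply: (cvgr_lt (0 : R)) => //; exact: divr_gt0.
exists N0 => N NN u u01.
apply: le_trans (bernstein_error N u01 del0 PK (fun v vu => H u v u01 vu)) _.
have := HN N NN; rewrite /C /= -!mulrA => h.
by rewrite [leRHS](splitr e) lerD2l ltW.
Qed.

Context d (Om : measurableType d) (P : probability Om R) (U : nat -> Om -> 'I_k -> R).
Context d' (Om' : measurableType d') (P' : probability Om' R) (U' : Om' -> 'I_k -> R).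
Hypotheses (mU : forall n i, measurable_fun setT (fun w => U n w i))
  (mU' : forall i, measurable_fun setT (fun w => U' w i)).
Hypotheses (U01 : forall n w, cube (U n w)) (U'01 : forall w, cube (U' w)).

Lemma measurable_bernstein d0 (T : measurableType d0) (W : T -> 'I_k -> R) js f c :
  (forall i, measurable_fun setT (fun w => W w i)) ->
  measurable_fun setT (fun w => walk js (W w) f c).
Proof.
move=> mW; elim: js c => [|j js IH] c /=; first exact: measurable_cst.
apply: measurable_funD; apply: measurable_funM => //.
by apply: measurable_funB.
Qed.

(** [W] is known to be measurable coordinate by coordinate, which suffices for polynomials; [Phi] is
    their pointwise limit on the cube. *)
Lemma measurable_cont_coord d0 (T : measurableType d0) (W : T -> 'I_k -> R) Phi K :
  cont_coord Phi -> (forall v, `|Phi v| <= K) ->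
  (forall i, measurable_fun setT (fun w => W w i)) -> (forall w, cube (W w)) ->
  measurable_fun setT (fun w => Phi (W w)).
Proof.
move=> cPhi PK mW W01.
apply: (@measurable_fun_cvg _ _ _ _ (fun N w => bernstein N Phi (W w))).
  by move=> N; exact: measurable_bernstein.
move=> w _; apply/cvgrPdist_le => e e0; have [N0 HN] := bernstein_cvg cPhi PK e0.
by exists N0 => // N /= NN; rewrite distrC; exact: HN.
Qed.

Let conv p := [/\ forall n, measurable_fun setT (fun w => p (U n w)),
  measurable_fun setT (fun w => p (U' w)), (exists K, forall u, cube u -> `|p u| <= K) &
  \int[P]_w p (U n w) @[n --> \oo] --> \int[P']_w p (U' w)].

Let conv_lin (x : R) p1 p2 : conv p1 -> conv p2 -> conv (fun u => p1 u + x * p2 u).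
Proof.
move=> [m1 m1' [K1 k1] c1] [m2 m2' [K2 k2] c2].
have i1 n : P.-integrable setT (EFin \o (fun w => p1 (U n w))).
  by apply: (@integrable_bounded _ _ _ _ _ K1) => // w; exact: k1.
have i2 n : P.-integrable setT (EFin \o (fun w => p2 (U n w))).
  by apply: (@integrable_bounded _ _ _ _ _ K2) => // w; exact: k2.
have i1' : P'.-integrable setT (EFin \o (fun w => p1 (U' w))).
  by apply: (@integrable_bounded _ _ _ _ _ K1) => // w; exact: k1.
have i2' : P'.-integrable setT (EFin \o (fun w => p2 (U' w))).
  by apply: (@integrable_bounded _ _ _ _ _ K2) => // w; exact: k2.
have xp2 u : cube u -> `|x * p2 u| <= `|x| * K2.
  by move=> u01; rewrite normrM ler_wpM2l// k2.
have i3 n : P.-integrable setT (EFin \o (fun w => x * p2 (U n w))).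
  apply: (@integrable_bounded _ _ _ _ _ (`|x| * K2)) => [|w]; first exact: measurable_funM.
  exact: xp2.
have i3' : P'.-integrable setT (EFin \o (fun w => x * p2 (U' w))).
  apply: (@integrable_bounded _ _ _ _ _ (`|x| * K2)) => [|w]; first exact: measurable_funM.
  exact: xp2.
split.
- by move=> n; apply: measurable_funD => //; exact: measurable_funM.
- by apply: measurable_funD => //; exact: measurable_funM.
- exists (K1 + `|x| * K2) => u u01; apply: le_trans (ler_normD _ _) _.
  by rewrite lerD ?k1// xp2.
rewrite RintegralD// RintegralZl//.
under eq_fun do rewrite RintegralD// RintegralZl//.
by apply: cvgD => //; exact: cvgMl_tmp.
Qed.

Definition monomial (s : 'I_k -> nat) u : R := \prod_(i < k) u i ^+ s i.

Hypothesis moments : forall s : 'I_k -> nat,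
  \int[P]_w monomial s (U n w) @[n --> \oo] --> \int[P']_w monomial s (U' w).

(** Quantifying over a monomial factor makes the class stable under multiplication by a coordinate,
    which the recursion of [walk] performs. *)
Let good p := forall s, conv (fun u => monomial s u * p u).

Let good_ext p1 p2 : (forall u, p1 u = p2 u) -> good p1 -> good p2.
Proof. by move=> /funext ->. Qed.

Let good1 : good (fun=> 1).
Proof.
move=> s; rewrite (_ : (fun u => _) = monomial s); last by apply/funext => u; rewrite mulr1.
split => //.
- by move=> n; apply: measurable_prod => i _; exact: measurable_funX.
- by apply: measurable_prod => i _; exact: measurable_funX.
- exists 1 => u u01; rewrite /monomial ger0_norm.
    by apply: prodr_ile1 => i _; have /andP[h1 h2] := u01 i; rewrite exprn_ge0 ?exprn_ile1.
  by apply: prodr_ge0 => i _; have /andP[h1 h2] := u01 i; rewrite exprn_ge0.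
Qed.

Let good_lin x p1 p2 : good p1 -> good p2 -> good (fun u => p1 u + x * p2 u).
Proof.
move=> g1 g2 s; rewrite (_ : (fun u => _) = (fun u => monomial s u * p1 u + x * (monomial s u * p2 u))).
  exact: conv_lin.
by apply/funext => u; ring.
Qed.

Let good_mul j p : good p -> good (fun u => u j * p u).
Proof.
move=> g s; rewrite (_ : (fun u => _) = (fun u => monomial (incr j s) u * p u)); first exact: g.
apply/funext => u; rewrite mulrA; congr (_ * _); rewrite /monomial mulrC.
rewrite (bigD1 j)//= [RHS](bigD1 j)//= mulrA /incr eqxx exprS; congr (_ * _).
by apply: eq_bigr => i /negbTE ->.
Qed.

Let good_walk js f c : good (fun u => walk js u f c).
Proof.
elim: js c => [|j js IH] c /=.
  apply: good_ext (good_lin (f c - 1) good1 good1) => u; ring.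
have := good_lin (-1) (good_lin 1 (good_mul j (IH (incr j c))) (IH c)) (good_mul j (IH c)).
by apply: good_ext => u; ring.
Qed.

(** An [e/3] argument: a Bernstein polynomial is uniformly close to [Phi] on the cube, where all
    variables live, and its expectation converges by the moment hypothesis. *)
Theorem moment_convergence Phi K : cont_coord Phi -> (forall v, `|Phi v| <= K) ->
  ((fun n => \int[P]_w (Phi (U n w))%:E) @ \oo --> \int[P']_w (Phi (U' w))%:E)%E.
Proof.
move=> cPhi PK.
have mP d0 (T : measurableType d0) (W : T -> 'I_k -> R) :
  (forall i, measurable_fun setT (fun w => W w i)) -> (forall w, cube (W w)) ->
  measurable_fun setT (fun w => Phi (W w)) := fun mW => measurable_cont_coord cPhi PK mW.
have approx N e d0 (T : measurableType d0) (Q : probability T R) (W : T -> 'I_k -> R) :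
    (forall i, measurable_fun setT (fun w => W w i)) -> (forall w, cube (W w)) ->
    (forall u, cube u -> `|bernstein N Phi u - Phi u| <= e) ->
    `|\int[Q]_w bernstein N Phi (W w) - \int[Q]_w Phi (W w)| <= e.
  move=> mW W01 H.
  have mB : measurable_fun setT (fun w => bernstein N Phi (W w)) by exact: measurable_bernstein.
  have iP : Q.-integrable setT (EFin \o (fun w => Phi (W w))).
    by apply: (@integrable_bounded _ _ _ _ _ K) => //; exact: mP.
  have iB : Q.-integrable setT (EFin \o (fun w => bernstein N Phi (W w))).
    apply: (@integrable_bounded _ _ _ _ _ (K + e)) => // w.
    rewrite -(subrK (Phi (W w)) (bernstein N Phi (W w))).
    by apply: le_trans (ler_normD _ _) _; rewrite addrC lerD// H.
  rewrite -RintegralB//; apply: le_trans (le_normr_Rintegral _ _) _ => //.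
    apply: (@integrable_bounded _ _ _ _ _ e) => [|w]; last exact: H.
    by apply: measurable_funB => //; exact: mP.
  have iD : Q.-integrable setT (EFin \o (fun w => `|bernstein N Phi (W w) - Phi (W w)|)).
    by apply: (@integrable_bounded _ _ _ _ _ e) => [|w]; [apply: measurableT_comp => //; apply: measurable_funB => //; exact: mP|rewrite normr_id H].
  have ic : Q.-integrable setT (EFin \o (fun=> e)) by apply: (@integrable_bounded _ _ _ _ _ (`|e|)).
  apply: le_trans (le_Rintegral _ iD ic _) _ => //; first by move=> w _; exact: H.
  by rewrite /Rintegral (_ : integral Q setT (EFin \o (fun=> e)) = e%:E)//; exact: probability_integral_cst.
have fin d0 (T : measurableType d0) (Q : probability T R) (W : T -> 'I_k -> R) :
    (forall i, measurable_fun setT (fun w => W w i)) -> (forall w, cube (W w)) ->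
    (\int[Q]_w (Phi (W w))%:E)%E = (\int[Q]_w Phi (W w))%:E.
  move=> mW W01; rewrite /Rintegral fineK//; apply: integrable_fin_num => //.
  by apply: (@integrable_bounded _ _ _ _ _ K) => //; exact: mP.
have triangle (a b c x y : R) : `|b - a| <= y / 3 -> `|x - c| <= y / 3 -> `|x - b| <= y / 3 ->
    `|c - a| <= y.
  rewrite !ler_norml => /andP[? ?] /andP[? ?] /andP[? ?]; apply/andP; split; lra.
rewrite fin//; under eq_fun do rewrite fin//.
apply: cvg_EFin; first exact: nearW.
apply/cvgrPdist_le => e e0; have e3 : 0 < e / 3 by rewrite divr_gt0.
have [N HN] := bernstein_cvg cPhi PK e3.
have {}HN := HN N (leqnn N).
have [_ _ _] : conv (bernstein N Phi).
  rewrite (_ : bernstein N Phi = (fun u => monomial (fun=> 0%N) u * bernstein N Phi u)).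
    exact: good_walk.
  by apply/funext => u; rewrite /monomial big1 ?mul1r// => i _; rewrite expr0.
move=> /cvgrPdist_le/(_ _ e3) cB; near=> n.
have h1 := approx N (e / 3) _ _ P (U n) (mU n) (U01 n) HN.
have h2 := approx N (e / 3) _ _ P' U' mU' U'01 HN.
have h3 : `|\int[P']_w bernstein N Phi (U' w) - \int[P]_w bernstein N Phi (U n w)| <= e / 3.
  by near: n.
exact: (triangle _ _ _ _ _ h1 h2 h3).
Unshelve. all: by end_near. Qed.

End MomentConvergence.

(** * Convergence of the attention average *)

Section Coordinates.
Context {R : realType} {d : nat}.
Implicit Types (y : R) (g : 'I_d -> R) (s : 'I_d.+2 -> nat).

Definition iD : 'I_d.+2 := ord0.
Definition iW : 'I_d.+2 := lift ord0 ord0.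
Definition iN (j : 'I_d) : 'I_d.+2 := lift ord0 (lift ord0 j).

Definition pack (D W : R) (N : 'I_d -> R) (i : 'I_d.+2) : R :=
  if unlift ord0 i is Some i' then if unlift ord0 i' is Some j then N j else W else D.

Lemma packD D W N : pack D W N iD = D.
Proof. by rewrite /pack unlift_none. Qed.

Lemma packW D W N : pack D W N iW = W.
Proof. by rewrite /pack liftK unlift_none. Qed.

Lemma packN D W N j : pack D W N (iN j) = N j.
Proof. by rewrite /pack !liftK. Qed.

Lemma pack_ind (Q : 'I_d.+2 -> Prop) : Q iD -> Q iW -> (forall j, Q (iN j)) -> forall i, Q i.
Proof.
move=> QD QW QN i; case: (unliftP ord0 i) => [i'|] ->; last exact: QD.
by case: (unliftP ord0 i') => [j|] ->; [exact: QN|exact: QW].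
Qed.

(* Besides the denominator summand [e^{-y}] and the numerator summands [e^{-y} g_j] we keep
   track of [e^{-y/2}]; adding it to the signed [e^{-y} g_j] makes all coordinates
   nonnegative, so that their exponentials live in the cube. *)
Definition coords y g : 'I_d.+2 -> R :=
  pack (expo 1 0 y 0) (expo 0 1 y 0) (fun j => expo 0 1 y (g j)).

Lemma coords_ge0 y g i : 0 <= coords y g i.
Proof.
by move: i; apply: pack_ind => [||j]; rewrite /coords ?packD ?packW ?packN; exact: expo_ge0.
Qed.

Lemma coordsD y g : coords y g iD = expR (- y).
Proof.
by rewrite /coords packD /expo mul1r !mul0r /clip oppr0 addr0 mulr0 minxx maxxx addr0.
Qed.

Lemma coordsW y g : coords y g iW = expR (- (y / 2)).
Proof.
rewrite /coords packW /expo mul1r mul0r mulr0 add0r clip_id ?addr0//.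
by rewrite normr0 expR_ge0.
Qed.

(** Amounts to [2y <= e^y], which follows from [e^y = e * e^{y-1}] with [e >= 2] and
    [e^{y-1} >= y]. *)
Lemma sqrt_expR_le y : 0 <= y -> Num.sqrt (2 * y) * expR (- y) <= expR (- (y / 2)).
Proof.
move=> y0; have -> : expR (- y) = expR (- (y / 2)) * expR (- (y / 2)).
  by rewrite -expRD; congr expR; field.
rewrite mulrA ler_piMl ?expR_ge0//.
rewrite -(ler_pM2r (expR_gt0 (y / 2))) -mulrA -expRD addNr expR0 mulr1 mul1r.
have -> : expR (y / 2) = Num.sqrt (expR y).
  rewrite -[LHS]ger0_norm ?expR_ge0// -sqrtr_sqr -expRM_natl; congr (Num.sqrt (expR _)).
  by field.
rewrite ler_sqrt ?expR_gt0//.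
rewrite -[expR y](_ : expR (y - 1) * expR 1 = _); last by rewrite -expRD subrK.
rewrite [leLHS]mulrC ler_pM//; last by have := expR_ge1Dx (1 : R).
by have := expR_ge1Dx (y - 1); rewrite addrC subrK.
Qed.

Lemma clip_radius (sw y r : R) : 0 <= y -> 0 <= sw -> `|r| <= Num.sqrt (2 * y) * sw ->
  clip (sw * expR (- (y / 2))) (expR (- y) * r) = expR (- y) * r.
Proof.
move=> y0 sw0 gs; apply: clip_id; rewrite normrM ger0_norm ?expR_ge0//.
apply: (@le_trans _ _ (expR (- y) * (Num.sqrt (2 * y) * sw))); first by rewrite ler_wpM2l ?expR_ge0.
by rewrite mulrA mulrC ler_wpM2l// mulrC sqrt_expR_le.
Qed.

Lemma coordsN y g j : 0 <= y -> `|g j| <= Num.sqrt (2 * y) ->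
  coords y g (iN j) = expR (- (y / 2)) + expR (- y) * g j.
Proof.
by move=> y0 gy; rewrite /coords packN /expo mul0r add0r mul1r -{2}[expR (- (y / 2))]mul1r clip_radius ?mulr1.
Qed.

(** The total coefficient of [e^{-y/2}] in a combination: every numerator coordinate contains this
    term once. *)
Definition weightW s : R := (s iW)%:R + \sum_(j < d) (s (iN j))%:R.

Lemma weightW_ge0 s : 0 <= weightW s.
Proof. by rewrite addr_ge0// sumr_ge0. Qed.

(* Linear combinations of the coordinates are exponents again: this is why the moments
   of the limit law are Laplace transforms. *)
Lemma coords_sum s y g : 0 <= y -> (forall j, `|g j| <= Num.sqrt (2 * y)) ->
  \sum_i (s i)%:R * coords y g i =
  expo (s iD)%:R (weightW s) y (\sum_(j < d) (s (iN j))%:R * g j).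
Proof.
move=> y0 gy; rewrite !big_ord_recl /= -/iD -/iW coordsD coordsW /expo clip_radius//; last 2 first.
- exact: weightW_ge0.
- apply: le_trans (ler_norm_sum _ _ _) _; rewrite mulrDr mulr_sumr.
  apply: ler_wpDl; first by rewrite mulr_ge0 ?sqrtr_ge0.
  by apply: ler_sum => j _; rewrite normrM ger0_norm// mulrC ler_wpM2r.
rewrite -addrA; congr (_ + _); rewrite /weightW mulrDl -addrA; congr (_ + _).
rewrite mulr_suml mulr_sumr -big_split/=; apply: eq_bigr => j _.
by rewrite -/(iN j) coordsN//; ring.
Qed.

End Coordinates.

(** * Moments of the sample coordinates *)

Section SampleCoordinates.
Context {R : realType} (m : nat) (q : m.+1.-tuple R).
Hypothesis Sq : sphere m.+1 q.
Implicit Types (B : R) (u : m.+1.-tuple R).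

Definition sample_coords B u : 'I_m.+3 -> R :=
  coords (B * (1 - dotv q u)) (fun j => Num.sqrt B * (tnth u j - tnth q j)).

Definition sampleU B k (xs : nat -> m.+1.-tuple R) (i : 'I_m.+3) : R :=
  expR (- \sum_(l < k) sample_coords B (xs l) i).

Lemma sampleU_cube B k xs : cube (sampleU B k xs).
Proof.
move=> i; rewrite expR_ge0 -expR0 ler_expR oppr_le0 sumr_ge0// => l _.
exact: coords_ge0.
Qed.

Lemma measurable_tnth_comp d0 (T : measurableType d0) n (X : T -> n.-tuple R) j :
  measurable_fun setT X -> measurable_fun setT (fun w => tnth (X w) j).
Proof. by move=> mX; exact: (measurableT_comp (measurable_tnth j) mX). Qed.

Lemma measurable_coords d0 (T : measurableType d0) (y : T -> R) (g : T -> 'I_m.+1 -> R) i :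
  measurable_fun setT y -> (forall j, measurable_fun setT (fun z => g z j)) ->
  measurable_fun setT (fun z => coords (y z) (g z) i).
Proof.
move=> my mg; move: i; apply: pack_ind => [||j]; rewrite /coords.
- by under eq_fun do rewrite packD; exact: measurable_expo.
- by under eq_fun do rewrite packW; exact: measurable_expo.
- by under eq_fun do rewrite packN; exact: measurable_expo.
Qed.

Lemma measurable_sample_coords B i : measurable_fun setT (fun u => sample_coords B u i).
Proof.
apply: measurable_coords => [|j]; apply: measurable_funM => //; apply: measurable_funB => //.
  exact: measurable_dotv.
exact: measurable_tnth_comp.
Qed.

Lemma sample_radius B u : 0 <= B -> sphere m.+1 u ->
  0 <= B * (1 - dotv q u) /\
  (forall j, `|Num.sqrt B * (tnth u j - tnth q j)| <= Num.sqrt (2 * (B * (1 - dotv q u)))).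
Proof.
move=> B0 Su; split; first by rewrite mulr_ge0// subr_ge0 dotv_sphere_le1.
move=> j; rewrite normrM (ger0_norm (sqrtr_ge0 _)) mulrCA sqrtrM//.
rewrite ler_wpM2l ?sqrtr_ge0// -dotv_tsub_sphere//.
by have := coord_le_enorm (tsub u q) j; rewrite tnth_mktuple.
Qed.

Context d0 (Om : measurableType d0) (P : probability Om R) (rho : m.+1.-tuple R -> R)
  (x : nat -> Om -> m.+1.-tuple R) (nu : probability (m.+1.-tuple R) R).
Hypothesis C2 : C2_on_sphere rho.
Hypothesis rho_ge0 : forall u, sphere m.+1 u -> 0 <= rho u.
Hypothesis rho1 : sphere_int rho (sphere m.+1) = 1%E.
Hypothesis mx : forall i, measurable_fun setT (x i).
Hypothesis lawx : forall i, has_sphere_law P rho (x i).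
Hypothesis indep : mutually_indep P x.
Hypothesis nuq : uniform_tsphere q nu.

Lemma sample_ae l : {ae P, forall w, sphere m.+1 (x l w)}.
Proof.
exists (~` (x l @^-1` sphere m.+1)); split => //.
- by apply: measurableC; rewrite -[X in measurable X]setTI; apply: mx => //; exact: measurable_sphere.
- apply: etrans (probability_setC P _) _.
    by rewrite -[X in measurable X]setTI; apply: mx => //; exact: measurable_sphere.
  by rewrite (sphere_law_as rho1 (lawx l)) subee.
Qed.

Lemma measurable_sampleU B k i : measurable_fun setT (fun w => sampleU B k (x^~ w) i).
Proof.
apply: (measurableT_comp (@measurable_expR R)); apply: measurable_funN.
apply: measurable_sum => l.
exact: (measurableT_comp (measurable_sample_coords B i) (mx l)).
Qed.

(** The direction [a] for which the combination of numerators with coefficients [s] becomes the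
    single scalar product [<u - q, a>]. *)
Definition multiplicities (s : 'I_m.+3 -> nat) : m.+1.-tuple R := [tuple (s (iN j))%:R | j < m.+1].

Lemma sample_moments (b : nat -> R) (kappa : R) (s : 'I_m.+3 -> nat) :
  0 < rho q -> (forall n, 0 < b n) -> b @ \oo --> +oo ->
  n.+1%:R / (Num.sqrt (b n)) ^+ m @[n --> \oo] --> kappa ->
  \int[P]_w monomial s (sampleU (b n) n.+1 (x^~ w)) @[n --> \oo] -->
  expR (- (rho q * kappa * fine (limit_mass (multiplicities s) nu (s iD)%:R (weightW s)))).
Proof.
move=> rq0 b0 boo Nk.
pose D n (u : m.+1.-tuple R) := sample_damp q (multiplicities s) (s iD)%:R (weightW s) (b n) u.
have mD n : measurable_fun setT (D n) by exact: measurable_sample_damp.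
have D0 n u : 0 <= D n u by apply: damp_ge0 => //; exact: weightW_ge0.
have D1 n u : D n u <= 1 by exact: damp_le1.
pose a n := fine (\int[P]_w (D n (x 0%N w))%:E)%E.
(* All sample points have the same law, so the value at index 0 serves for each [l]. *)
have aE n l : (\int[P]_w (D n (x l w))%:E = (a n)%:E)%E.
  have -> : (\int[P]_w (D n (x l w))%:E = \int[P]_w (D n (x 0%N w))%:E)%E.
    have mDE : measurable_fun setT (fun u => (D n u)%:E) by exact/measurable_EFinP.
    have DE0 u : (0 <= (D n u)%:E)%E by rewrite lee_fin.
    rewrite (sphere_law_integral C2 rho_ge0 rho1 (mx l) (lawx l) mDE DE0).
    by rewrite (sphere_law_integral C2 rho_ge0 rho1 (mx 0%N) (lawx 0%N) mDE DE0).
  rewrite /a fineK//; apply: integrable_fin_num => //.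
  apply: (@integrable_bounded _ _ _ _ _ 1) => [|w]; first exact: (measurableT_comp (mD n) (mx 0%N)).
  by rewrite ger0_norm.
have a01 n : 0 <= a n <= 1.
  rewrite -!lee_fin -(aE n 0%N); apply/andP; split.
    by apply: integral_ge0 => w _; rewrite lee_fin.
  rewrite -(probability_integral_cst P 1%E); apply: ge0_le_integral => //.
  - by move=> w _; rewrite lee_fin.
  - by apply/measurable_EFinP; exact: (measurableT_comp (mD n) (mx 0%N)).
  - by move=> w _; rewrite lee_fin.
pose g n u : R := expR (- \sum_i (s i)%:R * sample_coords (b n) u i).
have mg n : measurable_fun setT (g n).
  apply: (measurableT_comp (@measurable_expR R)); apply: measurable_funN.
  apply: measurable_sum => i; apply: measurable_funM => //; exact: measurable_sample_coords.
have g01 n u : 0 <= g n u <= 1.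
  rewrite expR_ge0 -expR0 ler_expR oppr_le0 sumr_ge0// => i _.
  by rewrite mulr_ge0//; exact: coords_ge0.
(* On the sphere the clippings are inactive and the combination is a single exponent; this identity
   therefore enters the expectations almost surely. *)
have gE n u : sphere m.+1 u -> g n u = 1 - D n u.
  move=> Su; have [y0 gy] := sample_radius (ltW (b0 n)) Su.
  rewrite /g /sample_coords coords_sum// /D /sample_damp /damp subKr; congr (expR (- expo _ _ _ _)).
  rewrite /dotv mulrBr mulr_sumr [in RHS]mulr_sumr -sumrB; apply: eq_bigr => j _.
  by rewrite !tnth_mktuple; ring.
have Eg n l : (\int[P]_w (g n (x l w))%:E = (1 - a n)%:E)%E.
  have iD : P.-integrable setT (EFin \o (fun w => D n (x l w))).
    apply: (@integrable_bounded _ _ _ _ _ 1) => [|w]; first exact: (measurableT_comp (mD n) (mx l)).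
    by rewrite ger0_norm.
  have i1 : P.-integrable setT (EFin \o (fun=> 1 : R)).
    by apply: (@integrable_bounded _ _ _ _ _ 1) => // w; rewrite normr1.
  rewrite EFinB -(aE n l) -(probability_integral_cst P 1%E).
  apply: etrans _ (integralB_EFin measurableT i1 iD).
  apply: ae_eq_integral => //.
  - by apply/measurable_EFinP; exact: (measurableT_comp (mg n) (mx l)).
  - apply/measurable_EFinP; apply: measurable_funB => //; exact: (measurableT_comp (mD n) (mx l)).
  - by apply: filterS (sample_ae l) => w Sw _; rewrite gE.
have mono n w : monomial s (sampleU (b n) n.+1 (x^~ w)) = \prod_(l < n.+1) g n (x l w).
  transitivity (expR (- \sum_i \sum_(l < n.+1) (s i)%:R * sample_coords (b n) (x l w) i)).
    rewrite -sumrN expR_sum; apply: eq_bigr => i _.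
    by rewrite /sampleU -expRM_natl mulrN mulr_sumr.
  by rewrite exchange_big -sumrN expR_sum.
rewrite (_ : (fun n => _) = (fun n => (1 - a n) ^+ n.+1)); last first.
  apply/funext => n; under eq_Rintegral do rewrite mono.
  rewrite /Rintegral sample_product//.
  under eq_bigr do rewrite Eg.
  by rewrite prodEFin prodr_const card_ord.
apply: cvg_one_sub_div_pow => //.
rewrite -mulrA.
by apply: (sample_mass_cvg C2 rho_ge0 rho1 (mx 0%N) (lawx 0%N) Sq nuq _ _ (N := fun n => n.+1%:R)) => //;
  exact: weightW_ge0.
Qed.

End SampleCoordinates.

Lemma negexpX (R : realType) (x : \bar R) n : (0 <= x)%E -> negexp x ^+ n = negexp (n%:R%:E * x)%E.
Proof.
case: x => [r||//] _; first by rewrite -EFinM !negexp_fin -expRM_natl mulrN.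
case: n => [|n]; first by rewrite expr0 mul0e negexp0.
by rewrite gt0_muley ?lte_fin// !negexpy expr0n.
Qed.

(** * The coordinates of the Poisson process *)

Section PointCoordinates.
Context {R : realType} (m : nat) (q : m.+1.-tuple R) (nu : probability (m.+1.-tuple R) R).
Hypotheses (m0 : (0 < m)%N) (nuq : uniform_tsphere q nu).
Local Notation T := (R * m.+1.-tuple R)%type.

Definition point_coords (z : T) (i : 'I_m.+3) : R :=
  \1_(ppp_dom q) z * coords z.1 (fun j => Num.sqrt (2 * z.1) * tnth z.2 j) i.

Lemma point_coords_ge0 z i : 0 <= point_coords z i.
Proof. by rewrite mulr_ge0//; exact: coords_ge0. Qed.

Let measurable_fst_real : measurable_fun setT (fun z : T => z.1).
Proof. exact: (@measurable_fst _ _ (measurableTypeR R)). Qed.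

Lemma measurable_indic_dom : measurable_fun setT (\1_(ppp_dom q) : T -> R).
Proof. by apply: measurable_indic; exact: measurable_ppp_dom. Qed.

Lemma measurable_point_radius j :
  measurable_fun setT (fun z : T => Num.sqrt (2 * z.1) * tnth z.2 j).
Proof.
have ms : measurable_fun setT (Num.sqrt : R -> R).
  by apply: continuous_measurable_fun; exact: sqrt_continuous.
apply: measurable_funM; last by apply: measurable_tnth_comp; exact: measurable_snd.
by apply: (measurableT_comp ms); exact: measurable_funM.
Qed.

Lemma measurable_point_coords i : measurable_fun setT (fun z => point_coords z i).
Proof.
apply: measurable_funM; first exact: measurable_indic_dom.
by apply: measurable_coords => // j; exact: measurable_point_radius.
Qed.

Lemma point_radius (z : T) : ppp_dom q z ->
  forall j, `|Num.sqrt (2 * z.1) * tnth z.2 j| <= Num.sqrt (2 * z.1).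
Proof.
move=> [z0 [_ z1]] j; rewrite normrM (ger0_norm (sqrtr_ge0 _)) ler_piMr ?sqrtr_ge0//.
by have := coord_le_enorm z.2 j; rewrite /enorm z1 sqrtr1.
Qed.

Lemma point_coords_sum s z :
  \sum_i (s i)%:R * point_coords z i =
  mark q (s iD)%:R (weightW s) (multiplicities s) z.
Proof.
rewrite /mark /point_expo; have [dz|dz] := boolP (z \in ppp_dom q); last first.
  rewrite indicE (negbTE dz) mul0r big1// => i _.
  by rewrite /point_coords indicE (negbTE dz) mul0r mulr0.
rewrite indicE dz mul1r; move/set_mem : dz => dz.
rewrite [in LHS](eq_bigr (fun i => (s i)%:R * coords z.1 (fun j => Num.sqrt (2 * z.1) * tnth z.2 j) i)); last first.
  by move=> i _; rewrite /point_coords indicE mem_set// mul1r.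
rewrite coords_sum; [|by case: dz|exact: point_radius].
congr expo; rewrite /dotv mulr_sumr; apply: eq_bigr => j _.
by rewrite !tnth_mktuple; ring.
Qed.

Definition pointU (M : {measure set T -> \bar R}) (i : 'I_m.+3) : R :=
  negexp (\int[M]_z (point_coords z i)%:E)%E.

Lemma integral_point_ge0 (M : {measure set T -> \bar R}) i : (0 <= \int[M]_z (point_coords z i)%:E)%E.
Proof. by apply: integral_ge0 => z _; rewrite lee_fin; exact: point_coords_ge0. Qed.

Lemma pointU_cube M : cube (pointU M).
Proof. by move=> i; apply: negexp01; exact: integral_point_ge0. Qed.

(** By [point_coords_sum] a product of powers of exponentials is one exponential of the integral of
    a [mark]; with [0 * +oo = 0] this also covers exponent 0 on a coordinate whose integral is
    infinite. *)
Lemma monomial_pointU M s : monomial s (pointU M) =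
  negexp (\int[M]_z (mark q (s iD)%:R (weightW s) (multiplicities s) z)%:E)%E.
Proof.
under eq_integral do rewrite -point_coords_sum -sumEFin.
rewrite ge0_integral_sum//; last 2 first.
- move=> i; apply/measurable_EFinP; apply: measurable_funM => //; exact: measurable_point_coords.
- by move=> i z _; rewrite lee_fin mulr_ge0//; exact: point_coords_ge0.
rewrite negexp_sum; last first.
  by move=> i; apply: integral_ge0 => z _; rewrite lee_fin mulr_ge0//; exact: point_coords_ge0.
apply: eq_bigr => i _; rewrite /pointU negexpX; last exact: integral_point_ge0.
congr negexp; rewrite -ge0_integralZl//; last 2 first.
- by apply/measurable_EFinP; exact: measurable_point_coords.
- by move=> z _; rewrite lee_fin; exact: point_coords_ge0.
Qed.

Context d (Om : measurableType d) (P : probability Om R) (M : Om -> {measure set T -> \bar R}).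
Variable c : R.
Hypothesis c0 : 0 < c.
Hypothesis ppp : is_PPP P M (intensity nu (radial_weight m c)).

Let mu : {measure set T -> \bar R} :=
  intensity_measure nu (measurable_radial_weight m c) (radial_weight_ge0 m0 (ltW c0)).

Let pppmu : is_PPP P M mu := ppp.

Lemma measurable_pointU i : measurable_fun setT (fun w => pointU (M w) i).
Proof.
apply: (measurableT_comp measurable_negexp); apply: (measurable_random_integral pppmu).
  exact: measurable_point_coords.
by move=> z; exact: point_coords_ge0.
Qed.

Lemma mark_laplace s0 sw a : 0 <= s0 -> 0 <= sw ->
  (\int[P]_w (negexp (\int[M w]_z (mark q s0 sw a z)%:E))%:E =
  (expR (- (c * fine (limit_mass a nu s0 sw))))%:E)%E.
Proof.
move=> s00 sw0; rewrite (laplace_functional pppmu); last 2 first.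
- exact: measurable_mark.
- by move=> z; exact: mark_ge0.
by rewrite (mark_mass m0 nuq) ?negexp_fin.
Qed.

Lemma point_moments s : \int[P]_w monomial s (pointU (M w)) =
  expR (- (c * fine (limit_mass (multiplicities s) nu (s iD)%:R (weightW s)))).
Proof.
rewrite /Rintegral; under eq_integral do rewrite monomial_pointU.
by rewrite mark_laplace//; exact: weightW_ge0.
Qed.

Lemma point_coordsW z : point_coords z iW = mark q 0 1 (tzero m.+1) z.
Proof.
rewrite /mark /point_expo /point_coords (_ : dotv z.2 (tzero m.+1) = 0); last first.
  by rewrite /dotv big1// => i _; rewrite tnth_mktuple mulr0.
by rewrite mulr0 /coords packW.
Qed.

Let mass_fin : exists2 C : R, 0 <= C &
  (\int[mu]_z (1 - expR (- point_coords z iW))%:E = C%:E)%E.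
Proof.
exists (c * fine (limit_mass (tzero m.+1) nu 0 1)).
  by rewrite mulr_ge0 ?(ltW c0)// fine_ge0//; do 2 (apply: integral_ge0 => ? _); rewrite lee_fin damp_ge0.
under eq_integral do rewrite point_coordsW.
exact: (mark_mass m0 nuq).
Qed.

Lemma point_coordsW_le1 z : point_coords z iW <= 1.
Proof.
rewrite /point_coords coordsW; have [dz|dz] := boolP (z \in ppp_dom q); last first.
  by rewrite indicE (negbTE dz) mul0r ler01.
rewrite indicE dz mul1r -expR0 ler_expR oppr_le0 divr_ge0//.
by move/set_mem : dz => [].
Qed.

(** For every [e > 0], [P(W = +oo) <= 1 - E e^{-eW}], and the Laplace functional bounds this by the
    intensity integral of [1 - e^{-ep}], where [p] is the coordinate [iW]. This integral is at most
    [2 e C] with the finite mass [C] already known at [e = 1]; then [e] tends to 0. *)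
Lemma point_total_lty :
  {ae P, forall w, (\int[M w]_z (point_coords z iW)%:E < +oo)%E}.
Proof.
pose W w := (\int[M w]_z (point_coords z iW)%:E)%E.
have mW : measurable_fun setT W.
  apply: (measurable_random_integral pppmu); first exact: measurable_point_coords.
  by move=> z; exact: point_coords_ge0.
have W0 w : (0 <= W w)%E by exact: integral_point_ge0.
have mS : measurable [set w | W w = +oo%E].
  rewrite -[X in measurable X]setTI; apply: (mW measurableT [set +oo%E]).
  exact: emeasurable_set1.
have [C C0 CE] := mass_fin.
have bound (e : R) : 0 < e -> (P [set w | W w = +oo%E] <= (2 * e * C)%:E)%E.
  move=> e0.
  have f0 z : 0 <= e * point_coords z iW by rewrite mulr_ge0 ?(ltW e0)//; exact: point_coords_ge0.
  have mf : measurable_fun setT (fun z => e * point_coords z iW).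
    by apply: measurable_funM => //; exact: measurable_point_coords.
  have L := laplace_functional pppmu mf f0.
  have WE w : (\int[M w]_z (e * point_coords z iW)%:E = e%:E * W w)%E.
    rewrite /W -ge0_integralZl//; last 3 first.
    - by apply/measurable_EFinP; exact: measurable_point_coords.
    - by move=> z _; rewrite lee_fin; exact: point_coords_ge0.
    - by rewrite lee_fin ltW.
  have m1e : measurable_fun setT (fun z => 1 - expR (- (e * point_coords z iW))).
    apply: measurable_funB => //; apply: (measurableT_comp (@measurable_expR R)).
    exact: measurable_funN.
  have massle : (\int[mu]_z (1 - expR (- (e * point_coords z iW)))%:E <= (2 * e * C)%:E)%E.
    rewrite EFinM -CE -ge0_integralZl//; last 3 first.
    - apply/measurable_EFinP; apply: measurable_funB => //; apply: (measurableT_comp (@measurable_expR R)).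
      by apply: measurable_funN; exact: measurable_point_coords.
    - move=> z _; rewrite lee_fin subr_ge0 -expR0 ler_expR oppr_le0; exact: point_coords_ge0.
    - by rewrite lee_fin mulr_ge0// ltW.
    apply: ge0_le_integral => //.
    - by move=> z _; rewrite lee_fin subr_ge0 -expR0 ler_expR oppr_le0.
    - exact/measurable_EFinP.
    - apply/measurable_EFinP; apply: measurable_funM => //; apply: measurable_funB => //.
      apply: (measurableT_comp (@measurable_expR R)).
      by apply: measurable_funN; exact: measurable_point_coords.
    - move=> z _; rewrite -EFinM lee_fin.
      have p0 := point_coords_ge0 z iW; have p1 := point_coordsW_le1 z.
      set p := point_coords z iW in p0 p1 *.
      have h1 : 1 - expR (- (e * p)) <= e * p by have := expR_ge1Dx (- (e * p)); lra.
      apply: (le_trans h1); rewrite [2 * e]mulrC -mulrA ler_wpM2l ?(ltW e0)//.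
      (* Gives [1 - e^{-p} >= p/(1+p) >= p/2], because [p <= 1]. *)
      have h2 : expR (- p) * (1 + p) <= 1.
        by rewrite expRN mulrC ler_pdivrMr ?expR_gt0// mul1r expR_ge1Dx.
      by have h3 := expR_gt0 (- p); nra.
  pose N w := negexp (\int[M w]_z (e * point_coords z iW)%:E)%E.
  have mN : measurable_fun setT N.
    by apply: (measurableT_comp measurable_negexp); exact: (measurable_random_integral pppmu).
  have N01 w : 0 <= N w <= 1 by apply: negexp01; rewrite WE mule_ge0// lee_fin ltW.
  have iN : P.-integrable setT (EFin \o N).
    by apply: (@integrable_bounded _ _ _ _ _ 1) => // w; have /andP[? ?] := N01 w; rewrite ger0_norm.
  have i1 : P.-integrable setT (EFin \o (fun=> 1 : R)).
    by apply: (@integrable_bounded _ _ _ _ _ 1) => // w; rewrite normr1.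
  have mass0 : (0 <= \int[mu]_z (1 - expR (- (e * point_coords z iW)))%:E)%E.
    by apply: integral_ge0 => z _; rewrite lee_fin subr_ge0 -expR0 ler_expR oppr_le0.
  apply: (@le_trans _ _ (\int[P]_w (1 - N w)%:E)%E).
    rewrite -(setIT [set w | _]) -integral_indic//; apply: ge0_le_integral => //.
    - exact/measurable_EFinP/measurable_indic.
    - by apply/measurable_EFinP; exact: measurable_funB.
    - move=> w _; rewrite lee_fin indicE; have /andP[n0 n1] := N01 w.
      have [|_] := boolP (w \in _); last by rewrite subr_ge0.
      by move/set_mem => /= Wy; rewrite /N WE Wy gt0_muley ?lte_fin// negexpy subr0.
  rewrite (eq_integral (fun w => 1%:E - (N w)%:E)%E)//.
  rewrite (integralB_EFin measurableT i1 iN) L probability_integral_cst.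
  apply: le_trans _ massle; move: mass0; case: (integral _ _ _) => [r||//] r0.
    rewrite negexp_fin -EFinB lee_fin; have := expR_ge1Dx (- r); lra.
  by rewrite leey.
exists [set w | W w = +oo%E]; split => //.
  apply/eqP; rewrite -measure_le0; apply/lee_addgt0Pr => eps eps0; rewrite add0e.
  (* [C] may vanish, so [eps] is divided by [2C + 1] instead of [2C]. *)
  have C1 : 0 < 2 * C + 1 by lra.
  apply: le_trans (bound (eps / (2 * C + 1)) _) _; first exact: divr_gt0.
  rewrite lee_fin (_ : 2 * (eps / (2 * C + 1)) * C = eps * (2 * C / (2 * C + 1))); last by ring.
  by rewrite ler_piMr ?(ltW eps0)// ler_pdivrMr//; lra.
by move=> w /= /negP; rewrite -leNgt leye_eq => /eqP.
Qed.

(** Dilation by 2 preserves the space and multiplies its mass by [2^m > 1], so a finite mass would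
    be 0; the Gaussian integral shows that it is positive. *)
Lemma lam_setT_infinite : lam m [set: m.-tuple R] = +oo%E.
Proof.
have E : lam m [set: m.-tuple R] = ((2 ^+ m)%:E * lam m [set: m.-tuple R])%E.
  have one : (\int[lam m]_u (cst 1%E u) = lam m [set: m.-tuple R])%E by rewrite integral_cst ?mul1e.
  by rewrite -one [LHS](@lam_scale R m 2).
have pos : (0 < lam m [set: m.-tuple R])%E.
  have g0 : (0 < ((Num.sqrt pi) ^+ m)%:E :> \bar R)%E by rewrite lte_fin exprn_gt0// sqrtr_gt0 pi_gt0.
  apply: lt_le_trans g0 _; rewrite -lam_gauss.
  apply: (@le_trans _ _ (\int[lam m]_u (cst 1%E u))%E); last by rewrite integral_cst ?mul1e.
  apply: ge0_le_integral => //.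
  - exact: measurable_expNdotv.
  - by move=> u _; rewrite lee_fin -expR0 ler_expR oppr_le0 dotv_ge0.
move: E pos; case: (lam m setT) => [r||//]; last by move=> _ /ltW.
rewrite -EFinM => -[rE]; rewrite lte_fin => r0; exfalso.
have : (2 : R) ^+ m = 1 by apply: (mulIf (lt0r_neq0 r0)); rewrite mul1r -rE.
by move/eqP; rewrite gt_eqF// exprn_egt1// ?ltr1n// -lt0n.
Qed.

(** Polar coordinates read backwards: the intensity of the whole domain is [c] times the total
    Lebesgue measure of [R^m]. *)
Lemma intensity_dom : intensity nu (radial_weight m c) (ppp_dom q) = +oo%E.
Proof.
have kc : measurable_fun setT (cst c%:E : R -> \bar R) by exact: measurable_cst.
have k0 (y : R) : (0 <= cst c%:E y)%E by rewrite lee_fin ltW.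
transitivity (\int[lam m]_z (cst c%:E (half_sqr z)))%E; last first.
  apply: (etrans (integral_cst (lam m) measurableT c%:E)).
  apply: (etrans (congr1 (fun v : \bar R => (c%:E * v)%E) lam_setT_infinite)).
  by rewrite gt0_muley ?lte_fin.
rewrite (lam_radial m0 kc k0); apply: eq_integral => y; rewrite inE/= => y0.
apply: etrans _ (probability_integral_cst nu _).
have mI : measurable_fun setT (fun z : T => (\1_(ppp_dom q) z * radial_weight m c y)%:E).
  by apply/measurable_EFinP; apply: measurable_funM => //; exact: measurable_indic_dom.
apply: (integral_tsphere_eq nuq) => [||th Hth].
- exact: (measurable_section y mI).
- exact: measurable_cst.
- by rewrite indicE mem_set// mul1r -EFinM.
Qed.

(** Almost surely the domain contains infinitely many points, and [e^{-y}] is positive on it; a zero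
    integral would make the domain null for the realisation. *)
Lemma point_mass_gt0 :
  {ae P, forall w, (0 < \int[M w]_z (point_coords z iD)%:E)%E}.
Proof.
have [_ _ _ inf _] := ppp.
have mS : measurable (ppp_dom q) by exact: measurable_ppp_dom.
have P1 := inf _ mS intensity_dom.
have [mM _ _ _ _] := ppp.
have mE : measurable [set w | M w (ppp_dom q) = +oo%E].
  rewrite -[X in measurable X]setTI; apply: (mM _ mS measurableT [set +oo%E]).
  exact: emeasurable_set1.
exists (~` [set w | M w (ppp_dom q) = +oo%E]); split; first exact: measurableC.
  by apply: etrans (probability_setC P mE) _; rewrite P1 subee.
move=> w /= /negP; rewrite -leNgt => int0; rewrite /= => Mw.
have mp : measurable_fun setT (fun z => (point_coords z iD)%:E).
  by apply/measurable_EFinP; exact: measurable_point_coords.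
have /(ae_eq_integral_abs (M w) measurableT mp) : (\int[M w]_z `|(point_coords z iD)%:E| = 0)%E.
  apply/eqP; rewrite eq_le; apply/andP; split; last exact: integral_ge0.
  apply: le_trans int0; rewrite le_eqVlt; apply/orP; left; apply/eqP; apply: eq_integral => z _.
  by rewrite gee0_abs// lee_fin; exact: point_coords_ge0.
move=> [N [mN N0 sub]].
have : (M w (ppp_dom q) <= M w N)%E.
  apply: le_measure; rewrite ?inE// => z dz; apply: sub => /= /(_ Logic.I) [].
  rewrite /point_coords indicE mem_set// mul1r coordsD; apply/eqP.
  by rewrite gt_eqF// expR_gt0.
by rewrite [X in (X <= _)%E]Mw [X in (_ <= X)%E]N0.
Qed.

Lemma Xi_denE (N : {measure set T -> \bar R}) :
  Xi_den q N = (\int[N]_z (point_coords z iD)%:E)%E.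
Proof.
rewrite /Xi_den integral_mkcond; apply: eq_integral => z _.
rewrite patchE /point_coords coordsD indicE; case: (z \in _); by rewrite ?mul1r ?mul0r.
Qed.

(** Subtracting the coordinate [iW] undoes the shift by [e^{-y/2}] and leaves the signed summand of
    the numerator. *)
Let num_part j (z : T) : R := point_coords z (iN j) - point_coords z iW.

Lemma Xi_numE (N : {measure set T -> \bar R}) j :
  Xi_num q N j = (\int[N]_z (num_part j z)%:E)%E.
Proof.
rewrite /Xi_num integral_mkcond; apply: eq_integral => z _.
rewrite patchE /num_part /point_coords indicE; case: ifPn => [/set_mem dz|_]; last by rewrite !mul0r subrr.
have [z0 _] := dz.
by rewrite !mul1r coordsN ?coordsW; [congr (_%:E); ring|..|exact: point_radius].
Qed.

Let num_part_le j z : `|num_part j z| <= point_coords z iW.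
Proof.
rewrite /num_part /point_coords indicE; have [/set_mem dz|_] := boolP (z \in ppp_dom q); last first.
  by rewrite !mul0r subrr normr0.
have [z0 _] := dz; rewrite !mul1r coordsN ?coordsW//; last exact: point_radius.
rewrite [X in `|X|]addrC addKr normrM ger0_norm ?expR_ge0//.
apply: le_trans (sqrt_expR_le z0); rewrite mulrC ler_wpM2r ?expR_ge0//.
exact: point_radius.
Qed.

Let measurable_num_part j : measurable_fun setT (num_part j).
Proof. by apply: measurable_funB; exact: measurable_point_coords. Qed.

(** Finiteness of the total [W] makes the signed numerator integrable, since it is dominated by
    [e^{-y/2}]; the shifted integral then splits as [W + r j]. *)
Lemma pointU_readout (N : {measure set T -> \bar R}) :
  (\int[N]_z (point_coords z iW)%:E < +oo)%E ->
  let D := fine (Xi_den q N) in let W := fine (\int[N]_z (point_coords z iW)%:E)%E in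
  let r j := fine (Xi_num q N j) in
  [/\ pointU N = pack (expR (- D)) (expR (- W)) (fun j => expR (- (W + r j))),
      0 <= D <= W, forall j, `|r j| <= W & (Xi_den q N < +oo)%E].
Proof.
move=> Wfin D W r.
have WE : (\int[N]_z (point_coords z iW)%:E = W%:E)%E.
  by rewrite /W fineK// ge0_fin_numE//; exact: integral_point_ge0.
have mW : measurable_fun setT (fun z => (point_coords z iW)%:E).
  by apply/measurable_EFinP; exact: measurable_point_coords.
have iW' : N.-integrable setT (EFin \o (fun z => point_coords z iW)).
  apply/integrableP; split => //; under eq_integral do rewrite gee0_abs ?lee_fin ?point_coords_ge0//.
  exact: Wfin.
have inum j : N.-integrable setT (EFin \o num_part j).
  apply: le_integrable iW' => //; first by apply/measurable_EFinP.
  move=> z _ /=; rewrite lee_fin; apply: le_trans (num_part_le j z) _; exact: ler_norm.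
have rE j : Xi_num q N j = (r j)%:E.
  by rewrite /r fineK// Xi_numE; exact: (integrable_fin_num measurableT (inum j)).
have DW : (Xi_den q N <= W%:E)%E.
  rewrite Xi_denE -WE; apply: ge0_le_integral => //.
  - by move=> z _; rewrite lee_fin; exact: point_coords_ge0.
  - by apply/measurable_EFinP; exact: measurable_point_coords.
  - move=> z _; rewrite lee_fin /point_coords coordsD coordsW indicE.
    have [/set_mem [z0 _]|_] := boolP (z \in ppp_dom q); last by rewrite !mul0r.
    by rewrite !mul1r ler_expR lerN2 ler_pdivrMr// ler_peMr ?ler1n.
have D0 : (0 <= Xi_den q N)%E by rewrite Xi_denE; exact: integral_point_ge0.
have Dfin : (Xi_den q N < +oo)%E by apply: le_lt_trans DW _; rewrite ltry.
have DE : Xi_den q N = D%:E by rewrite /D fineK// ge0_fin_numE.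
split => //.
- apply/funext; apply: pack_ind => [||j]; rewrite ?packD ?packW ?packN /pointU.
  + by rewrite -Xi_denE DE.
  + by rewrite WE.
  + rewrite (eq_integral (fun z => (point_coords z iW)%:E + (num_part j z)%:E)%E); last first.
      by move=> z _; rewrite -EFinD /num_part addrC subrK.
    by rewrite (integralD_EFin measurableT iW' (inum j)) WE -Xi_numE rE.
- by move: D0 DW; rewrite DE !lee_fin => -> ->.
- move=> j; rewrite -lee_fin -WE; apply: (@le_trans _ _ (\int[N]_z `|(num_part j z)%:E|)%E).
    rewrite -abse_EFin -rE Xi_numE; apply: le_abse_integral => //.
    exact/measurable_EFinP.
  apply: ge0_le_integral => //.
    by apply: measurableT_comp => //; exact/measurable_EFinP.
  by move=> z _; rewrite lee_fin; exact: num_part_le.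
Qed.

Lemma measurable_Xi_den : measurable_fun setT (fun w => Xi_den q (M w)).
Proof.
under eq_fun do rewrite Xi_denE.
apply: (measurable_random_integral pppmu); first exact: measurable_point_coords.
by move=> z; exact: point_coords_ge0.
Qed.

Lemma measurable_Xi_num j : measurable_fun setT (fun w => Xi_num q (M w) j).
Proof.
under eq_fun do rewrite Xi_numE integralE.
have E (f : T -> R) : measurable_fun setT f ->
    measurable_fun setT (fun w => \int[M w]_z ((fun z => (f z)%:E)^\+ z))%E.
  move=> mf; rewrite (_ : (fun w => _) = (fun w => \int[M w]_z (Num.max (f z) 0)%:E)%E).
    apply: (measurable_random_integral pppmu); first exact: measurable_maxr.
    by move=> z; rewrite le_max lexx orbT.
  by apply/funext => w; apply: eq_integral => z _; rewrite funeposE EFin_max.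
apply: emeasurable_funB; first exact: E.
rewrite (_ : (fun w => _) = (fun w => \int[M w]_z ((fun z => (- num_part j z)%:E)^\+ z))%E).
  by apply: E; exact: measurable_funN.
by apply/funext => w; apply: eq_integral => z _; rewrite funenegE funeposE EFinN.
Qed.

Lemma measurable_Xi : measurable_fun setT (fun w => Xi q (M w)).
Proof.
apply/measurable_fun_tnthP => j.
rewrite (_ : _ \o _ = (fun w => fine (Xi_num q (M w) j) * (fine (Xi_den q (M w)))^-1)); last first.
  by apply/funext => w; rewrite /= tnth_mktuple.
have mfine (f : Om -> \bar R) : measurable_fun setT f -> measurable_fun setT (fun w => fine (f w)).
  by move=> mf; exact: (measurableT_comp (fine_measurable measurableT) mf).
apply: measurable_funM; first exact/mfine/measurable_Xi_num.
apply: measurable_inv_ge0; last exact/mfine/measurable_Xi_den.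
by move=> w; rewrite fine_ge0// Xi_denE; exact: integral_point_ge0.
Qed.

End PointCoordinates.

(** * Continuity tools *)

Section ContinuityTools.
Context {R : realType}.

Lemma cvg_maxr (T : Type) (F : set_system T) {FF : Filter F} (f g : T -> R) a b :
  f @ F --> a -> g @ F --> b -> (Num.max (f x) (g x)) @[x --> F] --> Num.max a b.
Proof.
move=> fa gb; under eq_fun do rewrite maxr_absE; rewrite maxr_absE.
by apply: cvgMr_tmp; apply: cvgD; [exact: cvgD|apply: cvg_norm; exact: cvgB].
Qed.

Lemma cvg_minr (T : Type) (F : set_system T) {FF : Filter F} (f g : T -> R) a b :
  f @ F --> a -> g @ F --> b -> (Num.min (f x) (g x)) @[x --> F] --> Num.min a b.
Proof.
move=> fa gb; under eq_fun do rewrite minr_absE; rewrite minr_absE.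
by apply: cvgMr_tmp; apply: cvgB; [exact: cvgD|apply: cvg_norm; exact: cvgB].
Qed.

Lemma tcont_cvg n (F : n.-tuple R -> R) (T : Type) (G : set_system T) {FG : Filter G}
  (g : T -> n.-tuple R) (l : n.-tuple R) : tcont F ->
  (forall j, (fun x => tnth (g x) j) @ G --> tnth l j) -> (fun x => F (g x)) @ G --> F l.
Proof.
move=> cF gl; apply/cvgrPdist_lt => e e0; have [del del0 H] := cF l e e0.
have : \forall x \near G, forall j, `|tnth l j - tnth (g x) j| < del.
  by apply: filter_forall => j; move/cvgrPdist_lt : (gl j); apply.
by apply: filterS => x h; rewrite distrC; apply: H => i; rewrite distrC.
Qed.

Lemma cont_coordP k (Phi : ('I_k -> R) -> R) :
  (forall v0 : 'rV[R]_k,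
    (fun v : 'rV[R]_k => Phi (fun i => v 0 i)) @ v0 --> Phi (fun i => v0 0 i)) ->
  cont_coord Phi.
Proof.
move=> H u e e0; have := H (\row_i u i) => /cvgrPdist_lt/(_ e e0)/nbhs_ballP[del /= del0 Hdel].
exists del => // v uv.
have rowE (w : 'I_k -> R) : (fun i => (\row_i w i) 0 i) = w by apply/funext => i; rewrite mxE.
have := Hdel (\row_i v i); rewrite /= !rowE distrC; apply.
by split => // i j; rewrite !mxE /ball/= distrC.
Qed.

Lemma tcont_mxv n (V : 'M[R]_n) (f : n.-tuple R -> R) : tcont f -> tcont (fun r => f (mxv V r)).
Proof.
move=> cf u e e0; have [del del0 H] := cf (mxv V u) e e0.
pose K : R := 1 + \sum_i \sum_j `|V i j|.
have K0 : 0 < K by rewrite ltr_wpDr// sumr_ge0// => i _; rewrite sumr_ge0.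
exists (del / K); first exact: divr_gt0.
move=> v uv; apply: H => i; rewrite !tnth_mktuple -sumrB.
apply: (@le_lt_trans _ _ (\sum_j `|V i j| * (del / K))).
  apply: le_trans (ler_norm_sum _ _ _) _; apply: ler_sum => j _.
  by rewrite -mulrBr normrM ler_wpM2l// ltW// uv.
rewrite -mulr_suml mulrA ltr_pdivrMr// mulrC ltr_pM2l//.
apply: (@le_lt_trans _ _ (\sum_i \sum_j `|V i j|)); last by rewrite /K ltrDr.
by rewrite [leRHS](bigD1 i)//= lerDl sumr_ge0// => l _; rewrite sumr_ge0.
Qed.

End ContinuityTools.

Section Clamp.
Context {R : realType}.

Definition clamp01 (x : R) : R := Num.max 0 (Num.min 1 x).

Lemma cvg_clamp01 (T : Type) (F : set_system T) {FF : Filter F} (f : T -> R) a :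
  f @ F --> a -> (fun x => clamp01 (f x)) @ F --> clamp01 a.
Proof.
move=> fa; apply: (cvg_maxr (f := fun=> 0)); first exact: cvg_cst.
by apply: (cvg_minr (f := fun=> 1)) => //; exact: cvg_cst.
Qed.

Lemma clamp01_bounds (x : R) : 0 <= clamp01 x <= 1.
Proof. by rewrite /clamp01 le_max lexx ge_max ler01 ge_min lexx. Qed.

Lemma clamp01_eq0 (x : R) : x <= 0 -> clamp01 x = 0.
Proof. by move=> x0; rewrite /clamp01 min_r ?max_l// (le_trans x0). Qed.

Lemma clamp01_eq1 (x : R) : 1 <= x -> clamp01 x = 1.
Proof. by move=> x1; rewrite /clamp01 min_l ?max_r. Qed.

End Clamp.

(** * Reading the ratio off the exponentials *)

Section Readout.
Context {R : realType} {d : nat} (F : d.-tuple R -> R) (K : R).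
Hypotheses (cF : tcont F) (FK : forall u, `|F u| <= K).
Variable L : R.
Hypothesis L2 : 2 < L.
Implicit Types (u : 'I_d.+2 -> R).

(** Zero if [u iW <= 1/L] or [1 - u iD <= 1/L], and one as soon as both exceed [2/L]: it discards
    large totals and small denominators continuously. *)
Definition cutoff u : R := clamp01 (L * u iW - 1) * clamp01 (L * (1 - u iD) - 1).

Lemma cutoff_bounds u : 0 <= cutoff u <= 1.
Proof.
have /andP[? ?] := clamp01_bounds (L * u iW - 1).
have /andP[? ?] := clamp01_bounds (L * (1 - u iD) - 1).
by rewrite mulr_ge0 ?mulr_ile1.
Qed.

(** At [u = (e^{-D}, e^{-W}, e^{-(W + r_j)})] without the clamps this is [r_j / D]. The bound
    [L^{-2}] suits the numerators because [|r_j| <= W] gives [e^{-(W + r_j)} >= e^{-2W}]; the upper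
    clamp [1 - 1/L] keeps the logarithm in the denominator away from 0. *)
Definition decode u : d.-tuple R :=
  [tuple (ln (Num.max (u iW) L^-1) - ln (Num.max (u (iN j)) (L^-1 ^+ 2))) /
         - ln (Num.min (Num.max (u iD) L^-1) (1 - L^-1)) | j < d].

Definition readout u : R := cutoff u * F (decode u).

Let Linv : 0 < L^-1 < 1 / 2.
Proof.
have Lp : 0 < L by apply: lt_trans L2.
by rewrite invr_gt0 Lp mul1r ltf_pV2 ?posrE.
Qed.

Lemma readout_bound u : `|readout u| <= K.
Proof.
have /andP[c0 c1] := cutoff_bounds u.
by rewrite normrM (ger0_norm c0); apply: le_trans (FK (decode u)); rewrite ler_piMl.
Qed.

Let cvg_cutoff (T : Type) (G : set_system T) (FG : Filter G) (a : T -> 'I_d.+2 -> R) l :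
  (forall i, (fun x => a x i) @ G --> l i) -> (fun x => cutoff (a x)) @ G --> cutoff l.
Proof.
move=> cc; apply: cvgM; apply: cvg_clamp01.
  by apply: cvgB; [exact: cvgMl_tmp|exact: cvg_cst].
apply: cvgB; last exact: cvg_cst.
by apply: cvgMl_tmp; apply: cvgB; [exact: cvg_cst|].
Qed.

Lemma cont_cutoff : cont_coord cutoff.
Proof.
apply: cont_coordP => v0; apply: (cvg_cutoff (nbhs_filter v0)) => i.
exact: coord_continuous.
Qed.

Let cvg_readout (T : Type) (G : set_system T) (FG : Filter G) (a : T -> 'I_d.+2 -> R) l :
  (forall i, (fun x => a x i) @ G --> l i) -> (fun x => readout (a x)) @ G --> readout l.
Proof.
have /andP[L0 L1] := Linv.
have clog (f : T -> R) (x : R) : 0 < x -> f @ G --> x -> (fun v => ln (f v)) @ G --> ln x.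
  by move=> x0 fx; apply: continuous_cvg => //; exact: continuous_ln.
move=> cc; apply: cvgM; first exact: cvg_cutoff.
apply: tcont_cvg => // j; rewrite tnth_mktuple; under eq_fun do rewrite tnth_mktuple.
have cdv : Num.min (Num.max (l iD) L^-1) (1 - L^-1) < 1 by rewrite gt_min; apply/orP; right; lra.
have cdp : 0 < Num.min (Num.max (l iD) L^-1) (1 - L^-1).
  rewrite lt_min lt_max L0 orbT/=; lra.
apply: cvgM.
  apply: cvgB; apply: clog.
  - by rewrite lt_max L0 orbT.
  - by apply: (cvg_maxr (g := fun=> _)) => //; exact: cvg_cst.
  - by rewrite lt_max exprn_gt0 ?orbT.
  - by apply: (cvg_maxr (g := fun=> _)) => //; exact: cvg_cst.
apply: cvgV; first by rewrite oppr_eq0 lt_eqF// ln_lt0// cdp.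
apply: cvgN; apply: clog => //; apply: (cvg_minr (g := fun=> _)); last exact: cvg_cst.
by apply: (cvg_maxr (g := fun=> _)) => //; exact: cvg_cst.
Qed.

Lemma cont_readout : cont_coord readout.
Proof.
apply: cont_coordP => v0; apply: (cvg_readout (nbhs_filter v0)) => i.
exact: coord_continuous.
Qed.

(* Where the cut-off does not vanish, all the clamps in [decode] are inactive. *)
Lemma readout_error (D W : R) (r : 'I_d -> R) u : 0 <= D <= W -> (forall j, `|r j| <= W) ->
  u = pack (expR (- D)) (expR (- W)) (fun j => expR (- (W + r j))) ->
  `|F [tuple r j / D | j < d] - readout u| <= K * (1 - cutoff u).
Proof.
move=> /andP[D0 DW] rW uE; have /andP[L0 L1] := Linv.
have K0 : 0 <= K by apply: le_trans (FK (decode u)).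
have /andP[c0 c1] := cutoff_bounds u.
have Lp : 0 < L by rewrite -invr_gt0.
have [cu|cu] := eqVneq (cutoff u) 0.
  by rewrite /readout cu mul0r !subr0 mulr1.
rewrite /readout; suff -> : decode u = [tuple r j / D | j < d].
  rewrite -{1}[F _]mul1r -mulrBl normrM ger0_norm ?subr_ge0// mulrC.
  by rewrite ler_wpM2r ?subr_ge0.
have hW : L^-1 <= expR (- W).
  rewrite leNgt; apply/negP => h; move/eqP : cu; apply.
  rewrite /cutoff uE packW clamp01_eq0 ?mul0r// subr_le0 -ler_pdivlMl// mulr1; exact: ltW.
have hD : expR (- D) <= 1 - L^-1.
  rewrite leNgt; apply/negP => h; move/eqP : cu; apply.
  rewrite /cutoff uE packD [X in _ * X]clamp01_eq0 ?mulr0// subr_le0 -ler_pdivlMl// mulr1.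
  by rewrite lerBlDl; lra.
have hD2 : L^-1 <= expR (- D) by apply: (le_trans hW); rewrite ler_expR lerN2.
apply: eq_from_tnth => j; rewrite !tnth_mktuple uE packD packW packN.
have hN : L^-1 ^+ 2 <= expR (- (W + r j)).
  apply: (@le_trans _ _ (expR (- W) ^+ 2)); first by rewrite lerXn2r ?nnegrE ?expR_ge0 ?(ltW L0).
  rewrite -expRM_natl ler_expR; have := rW j; rewrite ler_norml => /andP[_]; lra.
rewrite !max_l// min_l// !expRK opprK; congr (_ / _); ring.
Qed.

End Readout.

Lemma Rintegral_ae_error (R : realType) d (Om : measurableType d) (P : probability Om R)
  (h r g : Om -> R) (B : R) :
  measurable_fun setT h -> measurable_fun setT r -> measurable_fun setT g ->
  (forall w, `|h w| <= B) -> (forall w, `|r w| <= B) -> (forall w, 0 <= g w <= B) ->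
  {ae P, forall w, `|h w - r w| <= g w} ->
  `|\int[P]_w h w - \int[P]_w r w| <= \int[P]_w g w.
Proof.
move=> mh mr mg hB rB gB err.
have ih := integrable_bounded P mh hB; have ir := integrable_bounded P mr rB.
have ig : P.-integrable setT (EFin \o g).
  by apply: (@integrable_bounded _ _ _ _ _ B) => // w; have /andP[g0 g1] := gB w; rewrite ger0_norm.
have mhr : measurable_fun setT (fun w => h w - r w) by exact: measurable_funB.
have ihr : P.-integrable setT (EFin \o (fun w => h w - r w)).
  apply: (@integrable_bounded _ _ _ _ _ (B + B)) => // w.
  by apply: le_trans (ler_normB _ _) _; rewrite lerD.
rewrite -RintegralB//; apply: le_trans (le_normr_Rintegral measurableT ihr) _.
rewrite /Rintegral; apply: fine_le.
- apply: integrable_fin_num => //; apply: (@integrable_bounded _ _ _ _ _ (B + B)) => [|w].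
    exact: measurableT_comp.
  by rewrite normr_id; apply: le_trans (ler_normB _ _) _; rewrite lerD.
- exact: (integrable_fin_num measurableT ig).
- apply: ae_ge0_le_integral => //.
  + by apply/measurable_EFinP; exact: measurableT_comp.
  + by move=> w _; rewrite lee_fin; have /andP[] := gB w.
  + exact/measurable_EFinP.
  + by apply: filterS err => w ew _; rewrite lee_fin.
Qed.

(** * From moments to the ratio *)

Section ReadoutConvergence.
Context {R : realType} {k : nat} (F : k.-tuple R -> R) (K : R).
Hypotheses (cF : tcont F) (FK : forall u, `|F u| <= K).
Context d (Om : measurableType d) (P : probability Om R) (U : nat -> Om -> 'I_k.+2 -> R).
Context d' (Om' : measurableType d') (P' : probability Om' R) (U' : Om' -> 'I_k.+2 -> R).
Hypotheses (mU : forall n i, measurable_fun setT (fun w => U n w i))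
  (mU' : forall i, measurable_fun setT (fun w => U' w i)).
Hypotheses (U01 : forall n w, cube (U n w)) (U'01 : forall w, cube (U' w)).
Hypothesis moments : forall s : 'I_k.+2 -> nat,
  \int[P]_w monomial s (U n w) @[n --> \oo] --> \int[P']_w monomial s (U' w).
Context (H : nat -> Om -> R) (H' : Om' -> R).
Hypotheses (mH : forall n, measurable_fun setT (H n)) (mH' : measurable_fun setT H').
Hypotheses (HK : forall n w, `|H n w| <= K) (HK' : forall w, `|H' w| <= K).
Hypothesis errH : forall n L, 2 < L ->
  {ae P, forall w, `|H n w - readout F L (U n w)| <= K * (1 - cutoff L (U n w))}.
Hypothesis errH' : forall L, 2 < L ->
  {ae P', forall w, `|H' w - readout F L (U' w)| <= K * (1 - cutoff L (U' w))}.
Hypothesis pos' : {ae P', forall w, 0 < U' w iW /\ U' w iD < 1}.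

Let K0 : 0 <= K.
Proof. by apply: le_trans (FK (tzero k)). Qed.

(** Shifted by 3 so that [2 < level l] for every [l]. *)
Let level (l : nat) : R := l.+3%:R.

Let level2 l : 2 < level l.
Proof. by rewrite /level ltr_nat. Qed.

Let cut01 l (u : 'I_k.+2 -> R) : `|cutoff (level l) u| <= 1.
Proof. by have /andP[c0 c1] := cutoff_bounds (level l) u; rewrite ger0_norm. Qed.

Let mcut d0 (T : measurableType d0) (W : T -> 'I_k.+2 -> R) l :
  (forall i, measurable_fun setT (fun w => W w i)) -> (forall w, cube (W w)) ->
  measurable_fun setT (fun w => cutoff (level l) (W w)).
Proof. exact: (measurable_cont_coord (cont_cutoff (level l)) (cut01 l)). Qed.

Let mread d0 (T : measurableType d0) (W : T -> 'I_k.+2 -> R) l :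
  (forall i, measurable_fun setT (fun w => W w i)) -> (forall w, cube (W w)) ->
  measurable_fun setT (fun w => readout F (level l) (W w)).
Proof. exact: (measurable_cont_coord (cont_readout cF (level2 l)) (readout_bound FK (level l))). Qed.

(** The cost of replacing [h] by its readout is bounded through the expectation of [cutoff], a
    continuous function of the coordinates to which [moment_convergence] applies. *)
Let gap d0 (T : measurableType d0) (Q : probability T R) (W : T -> 'I_k.+2 -> R) (h : T -> R) l :
  (forall i, measurable_fun setT (fun w => W w i)) -> (forall w, cube (W w)) ->
  measurable_fun setT h -> (forall w, `|h w| <= K) ->
  {ae Q, forall w, `|h w - readout F (level l) (W w)| <= K * (1 - cutoff (level l) (W w))} ->
  `|\int[Q]_w h w - \int[Q]_w readout F (level l) (W w)| <=
  K * (1 - \int[Q]_w cutoff (level l) (W w)).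
Proof.
move=> mW W01 mh hK err.
have mc := mcut l mW W01.
have ic : Q.-integrable setT (EFin \o (fun w => cutoff (level l) (W w))).
  by apply: (@integrable_bounded _ _ _ _ _ 1) => // w; exact: cut01.
have i1 : Q.-integrable setT (EFin \o (fun=> 1 : R)).
  by apply: (@integrable_bounded _ _ _ _ _ 1) => // w; rewrite normr1.
have m1c : measurable_fun setT (fun w => 1 - cutoff (level l) (W w)) by exact: measurable_funB.
have i1c : Q.-integrable setT (EFin \o (fun w => 1 - cutoff (level l) (W w))).
  apply: (@integrable_bounded _ _ _ _ _ 1) => // w.
  by have /andP[c0 c1] := cutoff_bounds (level l) (W w); rewrite ger0_norm ?subr_ge0// lerBlDr lerDl.
have -> : K * (1 - \int[Q]_w cutoff (level l) (W w)) = \int[Q]_w (K * (1 - cutoff (level l) (W w))).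
  rewrite RintegralZl// RintegralB//; congr (_ * (_ - _)).
  by rewrite /Rintegral (_ : integral Q setT (EFin \o (fun=> 1)) = 1%:E)//; exact: probability_integral_cst.
apply: (@Rintegral_ae_error _ _ _ _ _ _ _ K) => //.
- exact: mread.
- exact: measurable_funM.
- by move=> w; exact: readout_bound.
- move=> w; have /andP[c0 c1] := cutoff_bounds (level l) (W w).
  by rewrite mulr_ge0 ?subr_ge0// ler_piMr// lerBlDr lerDl.
Qed.

(** Almost surely [U' iW] and [1 - U' iD] are positive, so both clamps equal 1 at all large levels;
    bounded convergence does the rest. *)
Let cutoff_limit : \int[P']_w cutoff (level l) (U' w) @[l --> \oo] --> (1 : R).
Proof.
have [] := @dominated_convergence _ _ _ P' setT measurableT
  (fun l w => (cutoff (level l) (U' w))%:E) (cst 1%E) (cst 1%E).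
- by move=> l; apply/measurable_EFinP; exact: mcut.
- exact: measurable_cst.
- apply: filterS pos' => w [u0 u1] _; apply: cvg_near_cst.
  have large (x : R) : 0 < x -> \forall l \near \oo, 2 <= level l * x.
    move=> x0; have /cvgryPge/(_ (2 / x)) := @cvgr_idn R; apply: filterS => l lx.
    by rewrite -ler_pdivrMr//; apply: (le_trans lx); rewrite /level ler_nat -addn3 leq_addr.
  have u1' : 0 < 1 - U' w iD by rewrite subr_gt0.
  apply: filterS2 (large _ u0) (large _ u1') => l h1 h2.
  by rewrite /cutoff !clamp01_eq1 ?mulr1//; lra.
- exact: finite_measure_integrable_cst.
- by apply: aeW => w l _; rewrite lee_fin; exact: cut01.
move=> _ _; rewrite probability_integral_cst => h.
exact: (fine_cvg h).
Qed.

(** The level is chosen from the limit law alone; the convergence of the expected cut-off at that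
    level then makes the discarded mass small for the sample as well. *)
Lemma readout_convergence : \int[P]_w H n w @[n --> \oo] --> \int[P']_w H' w.
Proof.
apply/cvgrPdist_le => e e0.
have K1 : 0 < 4 * (K + 1) by rewrite mulr_gt0// ltr_wpDl.
(* Budget: [2 K del] on the sample side, [K del] on the limit side and [e/4] between the readouts,
   with [K del <= e/4]. The [K + 1] covers [K = 0]. *)
pose del := e / (4 * (K + 1)).
have del0 : 0 < del by exact: divr_gt0.
have Kdel : K * del <= e / 4.
  rewrite /del invfM mulrCA mulrA [e * K]mulrC -mulrA; apply: (@le_trans _ _ (e / 4 * (K / (K + 1)))).
    by rewrite le_eqVlt; apply/orP; left; apply/eqP; ring.
  rewrite ler_piMr ?divr_ge0 ?(ltW e0)// ler_pdivrMr ?mul1r ?lerDl//.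
  by rewrite ltr_wpDl.
have [l _ /(_ l (leqnn l)) cl] : \forall l \near \oo, `|1 - \int[P']_w cutoff (level l) (U' w)| <= del.
  by move/cvgrPdist_le : cutoff_limit; apply.
have real (f : ('I_k.+2 -> R) -> R) B : cont_coord f -> (forall u, `|f u| <= B) ->
    \int[P]_w f (U n w) @[n --> \oo] --> \int[P']_w f (U' w).
  move=> cf fB; have := moment_convergence mU mU' U01 U'01 moments cf fB.
  have iff' : P'.-integrable setT (EFin \o (fun w => f (U' w))).
    apply: (@integrable_bounded _ _ _ _ _ B) => //; exact: (measurable_cont_coord cf fB).
  have /fineK <- := integrable_fin_num measurableT iff'.
  by move/fine_cvg.
have /cvgrPdist_le/(_ _ del0) c1 := real _ _ (cont_cutoff (level l)) (cut01 l).
have e4 : 0 < e / 4 by rewrite divr_gt0.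
have /cvgrPdist_le/(_ _ e4) c2 := real _ _ (cont_readout cF (level2 l)) (readout_bound FK (level l)).
near=> n.
have g1 := gap (mU n) (U01 n) (mH n) (HK n) (errH n (level2 l)).
have g2 := gap mU' U'01 mH' HK' (errH' (level2 l)).
have h1 : `|\int[P']_w cutoff (level l) (U' w) - \int[P]_w cutoff (level l) (U n w)| <= del by near: n.
have h2 : `|\int[P']_w readout F (level l) (U' w) - \int[P]_w readout F (level l) (U n w)| <= e / 4.
  by near: n.
have comb (a b c0 a' b' c' y : R) : `|a - b| <= K * (1 - c0) -> `|a' - b'| <= K * (1 - c') ->
    `|1 - c'| <= del -> `|c' - c0| <= del -> `|b' - b| <= y / 4 -> K * del <= y / 4 ->
    `|a' - a| <= y.
  move=> q1 q2 q3 q4 q5 q6.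
  have q7 : K * (1 - c') <= K * del by rewrite ler_wpM2l//; apply: le_trans q3; exact: ler_norm.
  have q8 : K * (1 - c0) <= 2 * (K * del).
    rewrite mulrCA ler_wpM2l//; move: q3 q4; rewrite !ler_norml => /andP[? ?] /andP[? ?]; lra.
  move: q1 q2 q5; rewrite !ler_norml => /andP[? ?] /andP[? ?] /andP[? ?]; apply/andP; split; lra.
exact: (comb _ _ _ _ _ _ _ g1 g2 cl h1 h2 Kdel).
Unshelve. all: by end_near. Qed.

End ReadoutConvergence.

(** * The attention average *)

Section SampleReadout.
Context {R : realType} (m : nat) (q : m.+1.-tuple R).
Hypothesis Sq : sphere m.+1 q.

(** The counterpart of [pointU_readout], in the same shape, so that [readout_error] serves both the
    sample and the limit. *)
Lemma sampleU_readout (B : R) k (xs : nat -> m.+1.-tuple R) : 0 <= B ->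
  (forall l, (l < k)%N -> sphere m.+1 (xs l)) ->
  let y l := B * (1 - dotv q (xs l)) in
  let D := \sum_(l < k) expR (- y l) in let W := \sum_(l < k) expR (- (y l / 2)) in
  let r j := \sum_(l < k) expR (- y l) * (Num.sqrt B * (tnth (xs l) j - tnth q j)) in
  [/\ sampleU q B k xs = pack (expR (- D)) (expR (- W)) (fun j => expR (- (W + r j))),
      0 <= D <= W & forall j, `|r j| <= W].
Proof.
move=> B0 Sx y D W r.
have y0 (l : 'I_k) : 0 <= y l by have [] := sample_radius Sq B0 (Sx l (ltn_ord l)).
have gy (l : 'I_k) j : `|Num.sqrt B * (tnth (xs l) j - tnth q j)| <= Num.sqrt (2 * y l).
  by have [_] := sample_radius Sq B0 (Sx l (ltn_ord l)); exact.
split.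
- apply/funext; apply: pack_ind => [||j]; rewrite ?packD ?packW ?packN /sampleU; congr (expR (- _)).
  + by apply: eq_bigr => l _; rewrite /sample_coords coordsD.
  + by apply: eq_bigr => l _; rewrite /sample_coords coordsW.
  + rewrite -big_split/=; apply: eq_bigr => l _; rewrite /sample_coords coordsN//.
  exact: y0.
- rewrite sumr_ge0 => [/=|l _]; last exact: expR_ge0.
  apply: ler_sum => l _; rewrite ler_expR lerN2 ler_pdivrMr// ler_peMr ?ler1n//.
- move=> j; apply: le_trans (ler_norm_sum _ _ _) _; apply: ler_sum => l _.
  rewrite normrM ger0_norm ?expR_ge0//; apply: le_trans (sqrt_expR_le (y0 l)).
  by rewrite mulrC ler_wpM2r ?expR_ge0.
Qed.

Lemma scaled_YcalE (V : 'M[R]_m.+1) (beta : nat -> R) xs k :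
  tscale (Num.sqrt (beta k)) (Ycal V beta q xs k) =
  mxv V [tuple (\sum_(l < k) expR (- (beta k * (1 - dotv q (xs l)))) *
      (Num.sqrt (beta k) * (tnth (xs l) j - tnth q j))) /
    \sum_(l < k) expR (- (beta k * (1 - dotv q (xs l)))) | j < m.+1].
Proof.
apply: eq_from_tnth => i; rewrite !tnth_mktuple mulr_sumr; apply: eq_bigr => j _.
rewrite !tnth_mktuple mulrCA; congr (_ * _); rewrite mulr_sumr mulr_suml; apply: eq_bigr => l _.
rewrite /Aw /Zn /Tq (eq_bigr (fun l : 'I_k => expR (- (beta k * (1 - dotv q (xs l)))))); last first.
  by move=> l' _; rewrite mulNr.
by rewrite mulNr; ring.
Qed.

End SampleReadout.

Section AttentionLimit.
Context {R : realType} (m : nat) (q : m.+1.-tuple R) (rho : m.+1.-tuple R -> R).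
Context dO (Om : measurableType dO) (P : probability Om R) (x : nat -> Om -> m.+1.-tuple R).
Context (beta : nat -> R) (V : 'M[R]_m.+1) (gamma : R).
Hypotheses (m0 : (0 < m)%N) (Sq : sphere m.+1 q) (C2 : C2_on_sphere rho).
Hypothesis rho_ge0 : forall u, sphere m.+1 u -> 0 <= rho u.
Hypothesis rho1 : sphere_int rho (sphere m.+1) = 1%E.
Hypothesis rq0 : 0 < rho q.
Hypothesis mx : forall i, measurable_fun setT (x i).
Hypothesis lawx : forall i, has_sphere_law P rho (x i).
Hypothesis indep : mutually_indep P x.
Hypothesis beta0 : forall k, (0 < k)%N -> 0 < beta k.
Hypothesis gamma0 : 0 < gamma.
Hypothesis beta_gamma : (fun k => beta k * k%:R `^ (- alpha m.+1)) @ \oo --> gamma.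

Context dO' (Om' : measurableType dO') (P' : probability Om' R) (nu : probability (m.+1.-tuple R) R)
  (M : Om' -> {measure set (R * m.+1.-tuple R) -> \bar R}).
Hypothesis nuq : uniform_tsphere q nu.

Let c : R := rho q / gamma `^ (m%:R / 2).
Hypothesis ppp : is_PPP P' M (intensity nu (radial_weight m c)).

Let c0 : 0 < c. Proof. by rewrite divr_gt0// powR_gt0. Qed.

Let scaled k w := tscale (Num.sqrt (beta k)) (Ycal V beta q (x ^~ w) k).

Lemma measurable_tcont n (f : n.-tuple R -> R) : tcont f -> measurable_fun setT f.
Proof. by move=> cf; apply: measurable_cont_at => // u _; exact: cf. Qed.

Lemma measurable_mxv d (T : measurableType d) n (A : 'M[R]_n) (X : T -> n.-tuple R) :
  measurable_fun setT X -> measurable_fun setT (fun w => mxv A (X w)).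
Proof.
move=> mX; apply/measurable_fun_tnthP => i.
rewrite (_ : _ \o _ = (fun w => \sum_j A i j * tnth (X w) j)); last first.
  by apply/funext => w; rewrite /= tnth_mktuple.
apply: measurable_sum => j; apply: measurable_funM => //; exact: measurable_tnth_comp.
Qed.

Let Y0 k w i : R := \sum_(j < k) Aw beta q (x ^~ w) k j * (tnth (x j w) i - tnth q i).

Lemma measurable_Ycal k : measurable_fun setT (fun w => Ycal V beta q (x ^~ w) k).
Proof.
apply: measurable_mxv; apply/measurable_fun_tnthP => i.
rewrite (_ : _ \o _ = (fun w => Y0 k w i)); last first.
  by apply/funext => w; rewrite /= tnth_mktuple.
have me l : measurable_fun setT (fun w => expR (- beta k * Tq q (x l w))).
  apply: (measurableT_comp (@measurable_expR R)); apply: measurable_funM => //.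
  by apply: measurable_funB => //; exact: measurable_dotv.
apply: measurable_sum => j; apply: measurable_funM.
  apply: measurable_funM => //; apply: measurable_inv_ge0.
    by move=> w; rewrite sumr_ge0// => l _; exact: expR_ge0.
  by apply: measurable_sum => l.
by apply: measurable_funB => //; exact: measurable_tnth_comp.
Qed.

Let measurable_scaled k : measurable_fun setT (scaled k).
Proof.
by apply: measurable_tscale => //; exact: measurable_Ycal.
Qed.

Lemma Xi_den_ae : {ae P', forall w, (0 < Xi_den q (M w) < +oo)%E}.
Proof.
apply: filterS2 (point_mass_gt0 m0 nuq c0 ppp) (point_total_lty m0 nuq c0 ppp) => w pos fin.
have [_ _ _ Dfin] := pointU_readout fin.
by rewrite Dfin andbT Xi_denE.
Qed.

Lemma attention_conv_dist : conv_dist P scaled P' (fun w => mxv V (Xi q (M w))).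
Proof.
move=> f cf [K fK]; rewrite -cvg_shiftS.
have [boo Nk] := bandwidth_cvg m0 beta0 gamma0 beta_gamma.
(* The matrix is absorbed into the test function, so the ratio is treated before [V] is applied. *)
pose F r := f (mxv V r).
have cF : tcont F by exact: tcont_mxv.
have FK u : `|F u| <= K by exact: fK.
pose U n w := sampleU q (beta n.+1) n.+1 (x ^~ w).
pose U' w := pointU q (M w).
pose H n w := f (scaled n.+1 w).
pose H' w := F (Xi q (M w)).
have mf := measurable_tcont cf.
have mH n : measurable_fun setT (H n) by exact: (measurableT_comp mf (measurable_scaled n.+1)).
have mH' : measurable_fun setT H'.
  exact: (measurableT_comp (measurable_tcont cF) (measurable_Xi q m0 c0 ppp)).
have main : \int[P]_w H n w @[n --> \oo] --> \int[P']_w H' w.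
  apply: (@readout_convergence R m.+1 F K cF FK _ _ P U _ _ P' U') => //.
  - by move=> n i; exact: (measurable_sampleU q mx).
  - by move=> i; exact: (measurable_pointU q m0 c0 ppp).
  - by move=> n w; exact: sampleU_cube.
  - by move=> w; exact: pointU_cube.
  - move=> s; rewrite (point_moments m0 nuq c0 ppp).
    apply: (sample_moments Sq C2 rho_ge0 rho1 mx lawx indep nuq) => // n; exact: beta0.
  - by move=> n w; exact: fK.
  - by move=> w; exact: FK.
  - move=> n L L2.
    (* Countably many null events are discarded at once; on the remaining outcomes the whole sample
       lies on the sphere. *)
    have all_sphere : {ae P, forall w, forall l, sphere m.+1 (x l w)}.
      by apply: ae_foralln => l; exact: (sample_ae rho1 mx lawx).
    apply: filterS all_sphere => w Sx.
    have [UE DW rW] := @sampleU_readout R m q Sq (beta n.+1) n.+1 (x ^~ w) (ltW (beta0 (ltn0Sn n)))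
      (fun l _ => Sx l).
    rewrite /H /scaled scaled_YcalE.
    exact: (readout_error FK L2 DW rW UE).
  - move=> L L2; apply: filterS (point_total_lty m0 nuq c0 ppp) => w fin.
    have [UE DW rW _] := pointU_readout fin.
    exact: (readout_error FK L2 DW rW UE).
  - apply: filterS2 (point_total_lty m0 nuq c0 ppp) Xi_den_ae => w fin /andP[pos Dfin].
    have [UE DW rW _] := pointU_readout fin.
    rewrite /U' UE packW packD; split; first exact: expR_gt0.
    by rewrite -expR0 ltr_expR oppr_lt0 fine_gt0// pos Dfin.
have E d (T : measurableType d) (Q : probability T R) (h : T -> R) :
    measurable_fun setT h -> (forall w, `|h w| <= K) -> (\int[Q]_w (h w)%:E = (\int[Q]_w h w)%:E)%E.
  by move=> mh hK; rewrite /Rintegral fineK//; exact: (integrable_fin_num measurableT (integrable_bounded Q mh hK)).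
rewrite (E _ _ P' H')//; last by move=> w; exact: FK.
rewrite (_ : (fun n => _) = (fun n => (\int[P]_w H n w)%:E)); last first.
  by apply/funext => n; apply: E => [|w]; [exact: mH|exact: fK].
by apply: cvg_EFin; first exact: nearW.
Qed.

(** A bounded continuous majorant of the indicator that the coordinate sum reaches [L], so that
    convergence in law bounds tail probabilities. *)
Let test (L : R) (u : m.+1.-tuple R) : R := Num.min 1 ((\sum_i `|tnth u i|) / L).

Let test01 L u : 0 < L -> 0 <= test L u <= 1.
Proof.
move=> L0; rewrite /test le_min ler01 ge_min lexx/= andbT.
by rewrite divr_ge0 ?(ltW L0)// sumr_ge0.
Qed.

Let tcont_test L : 0 < L -> tcont (test L).
Proof.
move=> L0 u e e0; pose N : R := m.+1%:R.
have N0 : 0 < N by rewrite ltr0n.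
exists (e * L / N); first by rewrite divr_gt0 ?mulr_gt0.
move=> v uv.
have lip (a b : R) : `|Num.min 1 a - Num.min 1 b| <= `|a - b|.
  have := ler_norm (a - b); have := ler_norm (b - a); rewrite (distrC b a) => h1 h2.
  rewrite ler_norml /Num.min; case: ltP => ha; case: ltP => hb; apply/andP; split; lra.
apply: le_lt_trans (lip _ _) _; rewrite -mulrBl normrM (gtr0_norm (_ : 0 < L^-1)) ?invr_gt0//.
rewrite ltr_pdivrMr// -sumrB; apply: le_lt_trans (ler_norm_sum _ _ _) _.
have -> : e * L = \sum_(i < m.+1) (e * L / N).
  by rewrite sumr_const card_ord -[RHS]mulr_natr divfK// gt_eqF.
apply: ltr_sum => [|i _]; first by apply/hasP; exists ord0; rewrite ?mem_index_enum.
exact: le_lt_trans (ler_dist_dist _ _) (uv i).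
Qed.

Let enorm_le_sum (u : m.+1.-tuple R) : enorm u <= \sum_i `|tnth u i|.
Proof.
have S0 : 0 <= \sum_i `|tnth u i| by exact: sumr_ge0.
rewrite -[leRHS]ger0_norm// -sqrtr_sqr ler_sqrt ?sqr_ge0// expr2 mulr_suml; apply: ler_sum => i _.
rewrite -expr2 -real_normK ?num_real// expr2 ler_wpM2l//.
by rewrite (bigD1 i)//= lerDl sumr_ge0.
Qed.

Let tsub0 (u : m.+1.-tuple R) : tsub u (tzero m.+1) = u.
Proof. by apply: eq_from_tnth => i; rewrite !tnth_mktuple subr0. Qed.

(** Once [sqrt(beta_k) e >= L], the event [|Y_k| >= e] forces the rescaled vector to have norm at
    least [L], so its probability is at most the expectation of [test L]. That expectation converges
    in [k] to the one under the limit law, which tends to 0 as [L] grows. *)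
Lemma Ycal_conv_prob : conv_prob P (fun k w => Ycal V beta q (x ^~ w) k) (tzero m.+1).
Proof.
move=> e e0; pose A k := [set w | e <= enorm (tsub (Ycal V beta q (x ^~ w) k) (tzero m.+1))].
have mA k : measurable (A k).
  rewrite (_ : A k = (fun w => enorm (Ycal V beta q (x ^~ w) k)) @^-1` `[e, +oo[); last first.
    by apply/seteqP; split => w; rewrite /A /= in_itv/= andbT tsub0.
  by rewrite -[X in measurable X]setTI; apply: (measurable_enorm (measurable_Ycal k)).
have [boo _] := bandwidth_cvg m0 beta0 gamma0 beta_gamma.
pose l L := (\int[P']_w (test L (mxv V (Xi q (M w))))%:E)%E.
have lim0 : ((fun n : nat => l n.+1%:R) @ \oo --> 0%E)%E.
  rewrite (_ : 0%E = \int[P']_w (0 : R)%:E)%E; last by rewrite probability_integral_cst.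
  apply: (@bounded_convergence _ _ _ _ _ _ 1).
  - move=> n; apply: (measurableT_comp (measurable_tcont (tcont_test (ltr0Sn _ n)))).
    by apply: measurable_mxv; exact: (measurable_Xi q m0 c0 ppp).
  - by move=> n w; have /andP[h0 h1] := test01 (mxv V (Xi q (M w))) (ltr0Sn R n); rewrite ger0_norm.
  - move=> w; set S := \sum_i `|tnth (mxv V (Xi q (M w))) i|.
    apply: (@squeeze_cvgr _ _ _ _ (fun=> 0) (fun n => S / n.+1%:R)); last 2 first.
    + exact: cvg_cst.
    + by rewrite -(mulr0 S); apply: cvgMl_tmp; exact: cvg_harmonic.
    by apply: nearW => n; have /andP[-> _] := test01 (mxv V (Xi q (M w))) (ltr0Sn R n); rewrite ge_min lexx orbT.
apply/fine_cvgP; split; first by apply: nearW => k; exact: (fin_num_measure P (A k) (mA k)).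
apply/cvgrPdist_le => eps eps0.
have e2 : 0 < eps / 2 by rewrite divr_gt0.
have /fine_cvgP[fl /cvgrPdist_lt/(_ _ e2)[N _ /(_ N (leqnn N)) lN]] := lim0.
have L0 : (0 : R) < N.+1%:R by [].
have tK u : `|test N.+1%:R u| <= 1 by have /andP[h0 h1] := test01 u L0; rewrite ger0_norm.
have cv := attention_conv_dist (tcont_test L0) (ex_intro _ 1 tK).
have lfin : l N.+1%:R \is a fin_num.
  apply: (integrable_fin_num measurableT); apply: (integrable_bounded P' _ (fun w => tK _)).
  apply: (measurableT_comp (measurable_tcont (tcont_test L0))).
  by apply: measurable_mxv; exact: (measurable_Xi q m0 c0 ppp).
move: cv; rewrite -/(l N.+1%:R) -(fineK lfin) => /fine_cvgP[_ /cvgrPdist_lt/(_ _ e2) cv].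
have boo' : beta @ \oo --> +oo by rewrite -cvg_shiftS.
near=> k.
have cvk : `|fine (l N.+1%:R) - fine (\int[P]_w (test N.+1%:R (scaled k w))%:E)%E| < eps / 2 by near: k.
have bk : (N.+1%:R / e) ^+ 2 <= beta k by near: k; move/cvgryPge : boo'; apply.
have sk : N.+1%:R <= Num.sqrt (beta k) * e.
  rewrite -ler_pdivrMr// -[leLHS]ger0_norm ?divr_ge0 ?(ltW e0)// -sqrtr_sqr ler_wsqrtr//.
have PA : (P (A k) <= \int[P]_w (test N.+1%:R (scaled k w))%:E)%E.
  rewrite -(setIT (A k)) -integral_indic//; apply: ge0_le_integral => //.
  - exact/measurable_EFinP/measurable_indic.
  - apply/measurable_EFinP.
    exact: (measurableT_comp (measurable_tcont (tcont_test L0)) (measurable_scaled k)).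
  - move=> w _; rewrite lee_fin indicE; have /andP[t0 _] := test01 (scaled k w) L0.
    have [/set_mem|//] := boolP (w \in A k); rewrite /A /= tsub0 => Yw.
    rewrite /test le_min lexx/= ler_pdivlMr// mul1r; apply: le_trans (enorm_le_sum _).
    apply: (le_trans sk); rewrite /scaled /enorm dotvZl dotvZr mulrA -expr2 sqrtrM ?sqr_ge0//.
    by rewrite sqrtr_sqr ger0_norm ?sqrtr_ge0// ler_wpM2l ?sqrtr_ge0.
have tfin : (\int[P]_w (test N.+1%:R (scaled k w))%:E)%E \is a fin_num.
  apply: (integrable_fin_num measurableT); apply: (integrable_bounded P _ (fun w => tK _)).
  exact: (measurableT_comp (measurable_tcont (tcont_test L0)) (measurable_scaled k)).
have PA' : fine (P (A k)) <= fine (\int[P]_w (test N.+1%:R (scaled k w))%:E)%E.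
  by apply: fine_le => //; exact: (fin_num_measure P (A k) (mA k)).
have PA0 : 0 <= fine (P (A k)) by exact: fine_ge0.
have comb (p t s y : R) : 0 <= p -> p <= t -> `|s - t| < y / 2 -> `|0 - s| < y / 2 -> `|0 - p| <= y.
  rewrite !ltr_norml ler_norml => ? ? /andP[? ?] /andP[? ?]; apply/andP; split; lra.
exact: (comb _ _ _ _ PA0 PA' cvk lN).
Unshelve. all: by end_near. Qed.

(** The weights sum to 1, which requires a nonempty sample: for [k = 0] the normaliser is 0. *)
Lemma ATT_sub k w : (0 < k)%N ->
  tsub (ATT V beta q (x ^~ w) k) (mxv V q) = Ycal V beta q (x ^~ w) k.
Proof.
move=> k0; have Z0 : 0 < Zn beta q (x ^~ w) k.
  case: k k0 => // k _; rewrite /Zn big_ord_recl.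
  by apply: ltr_pwDl; [exact: expR_gt0|apply: sumr_ge0 => l _; exact: expR_ge0].
have A1 : \sum_(j < k) Aw beta q (x ^~ w) k j = 1.
  by rewrite /Aw -mulr_suml divff// gt_eqF.
apply: eq_from_tnth => i; rewrite !tnth_mktuple -sumrB; apply: eq_bigr => j _.
rewrite !tnth_mktuple -mulrBr; congr (_ * _).
under [RHS]eq_bigr do rewrite mulrBr.
by rewrite sumrB -mulr_suml A1 mul1r.
Qed.

Lemma ATT_conv_prob : conv_prob P (fun k w => ATT V beta q (x ^~ w) k) (mxv V q).
Proof.
move=> e e0; apply: cvg_trans _ (Ycal_conv_prob e0); apply: near_eq_cvg; near=> k.
have k0 : (0 < k)%N by near: k; exists 1%N.
by congr (P _); apply/seteqP; split => w /=; rewrite tsub0 ATT_sub.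
Unshelve. all: by end_near. Qed.

End AttentionLimit.

Theorem mainTheorem5 (R : realType) (d : nat)
  (dO : measure_display) (Om : measurableType dO) (P : probability Om R)
  (q : d.-tuple R) (rho : d.-tuple R -> R) (x : nat -> Om -> d.-tuple R)
  (beta : nat -> R) (V : 'M[R]_d) (gamma : R) :
  (2 <= d)%N ->
  sphere d q ->
  C2_on_sphere rho ->
  (forall u, sphere d u -> 0 <= rho u) ->
  sphere_int rho (sphere d) = 1%E ->
  0 < rho q ->
  (forall i, measurable_fun setT (x i)) ->
  (forall i, has_sphere_law P rho (x i)) ->
  mutually_indep P x ->
  (forall k, (0 < k)%N -> 0 < beta k) ->
  0 < gamma ->
  (fun k => beta k * k%:R `^ (- alpha d)) @ \oo --> gamma ->
  forall (dO' : measure_display) (Om' : measurableType dO') (P' : probability Om' R)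
    (nu : probability (d.-tuple R) R)
    (M : Om' -> {measure set (R * d.-tuple R) -> \bar R}),
  uniform_tsphere q nu ->
  is_PPP P' M (intensity nu (fun y => Cq rho q / (alpha d * gamma `^ (alpha d)^-1)
                                      * y `^ ((alpha d)^-1 - 1))) ->
  [/\ {ae P', forall w, (0 < Xi_den q (M w) < +oo)%E},
      conv_dist P (fun k w => tscale (Num.sqrt (beta k)) (Ycal V beta q (x ^~ w) k))
                P' (fun w => mxv V (Xi q (M w))),
      conv_prob P (fun k w => Ycal V beta q (x ^~ w) k) (tzero d) &
      conv_prob P (fun k w => ATT V beta q (x ^~ w) k) (mxv V q)].
Proof.
(* Here [d = m.+2], so the preceding results are applied with [m.+1] as the dimension [d - 1] of the
   sphere. *)
case: d q rho x V => [|[|m]]// q rho x V _ Sq C2 rho_ge0 rho1 rq0 mx lawx indep beta0 gamma0 bg.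
move=> dO' Om' P' nu M nuq; rewrite (intensity_weightE _ _ _ (ltn0Sn m)) => ppp.
split.
- exact: (Xi_den_ae (ltn0Sn m) rq0 gamma0 nuq ppp).
- exact: (attention_conv_dist (ltn0Sn m) Sq C2 rho_ge0 rho1 rq0 mx lawx indep beta0 gamma0 bg nuq ppp).
- exact: (Ycal_conv_prob V (ltn0Sn m) Sq C2 rho_ge0 rho1 rq0 mx lawx indep beta0 gamma0 bg nuq ppp).
- exact: (ATT_conv_prob V (ltn0Sn m) Sq C2 rho_ge0 rho1 rq0 mx lawx indep beta0 gamma0 bg nuq ppp).
Qed.
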